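(* Let $\lambda>0$ be known, let $f$ be a probability density on $\mathbb{R}$ with characteristic function $\phi_f(t)=\int_{-\infty}^\infty e^{itx}f(x)\,dx$, and let $X_1,X_2,\ldots$ be i.i.d. copies of $X=Y+Z$, where $Y=\sum_{j=1}^{N(\lambda)}W_j$ with $N(\lambda)$ Poisson distributed with parameter $\lambda$, $W_1,W_2,\ldots$ i.i.d. with density $f$, $Z$ standard normal, and $N(\lambda)$, $(W_j)_j$, $Z$ independent. Assume that: 1. $\phi_f$ is integrable on $\mathbb{R}$; 2. the kernel $w$ is the sinc kernel $w(x)=(\sin x)/(\pi x)$, i.e. its Fourier transform is $\phi_w=1_{[-1,1]}$; 3. the bandwidth $h=h_n>0$ satisfies $h_n\sim(\log n)^{-\beta}$ as $n\to\infty$, where $0<\beta<1/2$; 4. the truncating sequence is $M_n=C\log n$ for some constant $C>0$; 5. $|x|^{\rho}f(x)$ is integrable on $\mathbb{R}$ for some $\rho>3/2$. Let $\hat f_{nh}(x)=(M_n\wedge f_{nh}(x))\vee(-M_n)$ be the truncated estimator of $f(x)$ (with $f_{nh}$ as defined in the context). Then for every fixed $x\in\mathbb{R}$, $$\frac{\sqrt{n}}{h\,e^{1/(2h^2)}}\left(\hat f_{nh}(x)-\operatorname{E}[\hat f_{nh}(x)]\right)\ \xrightarrow{\ \mathcal{D}\ }\ \mathcal{N}\left(0,\frac{e^{2\lambda}}{2\pi^2\lambda^2}\right)\quad\text{as } n\to\infty,$$ where $\xrightarrow{\mathcal{D}}$ denotes convergence in distribution.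
   Context: An empty sum is $0$. The empirical characteristic function is $\phi_{emp}(t)=\frac1n\sum_{j=1}^n e^{itX_j}$. Since $\phi_w=1_{[-1,1]}$, the factor $\phi_w(ht)$ equals $1$ on $[-1/h,1/h]$. Distinguished logarithm: for each outcome $\omega$ for which the function $t\mapsto \frac{\phi_{emp}(t)\phi_w(ht)}{e^{-\lambda}e^{-t^2/2}}$ does not vanish on $[-1/h,1/h]$, $\operatorname{Log}\left(\frac{\phi_{emp}(t)\phi_w(ht)}{e^{-\lambda}e^{-t^2/2}}\right)$ denotes the unique continuous complex-valued function $L$ on $[-1/h,1/h]$ with $e^{L(t)}=\frac{\phi_{emp}(t)\phi_w(ht)}{e^{-\lambda}e^{-t^2/2}}$ and $L(0)=\lambda$ (the function being exponentiated to equals $e^\lambda$ at $t=0$). For such $\omega$ define $$f_{nh}(x)=\frac{1}{2\pi\lambda}\int_{-1/h}^{1/h}e^{-itx}\operatorname{Log}\left(\frac{\phi_{emp}(t)\phi_w(ht)}{e^{-\lambda}e^{-t^2/2}}\right)dt,$$ which is real; for the remaining $\omega$ (where the distinguished logarithm is undefined) $f_{nh}(x)$ is assigned an arbitrary fixed value, e.g. zero. Here $a\wedge b=\min(a,b)$ and $a\vee b=\max(a,b)$. *)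

(* Defs.v *)
From HB Require Import structures.
From mathcomp Require Import all_boot all_order all_algebra.
From mathcomp Require Import finmap.
From mathcomp Require Import all_classical all_reals all_analysis.
From mathcomp.real_closed Require Import complex.

Set Implicit Arguments.
Unset Strict Implicit.
Unset Printing Implicit Defensive.

Import Order.TTheory GRing.Theory Num.Theory.
Import numFieldNormedType.Exports.

Local Open Scope classical_set_scope.
Local Open Scope complex_scope.
Local Open Scope ring_scope.

Section Complex.
Context {R : realType}.

Definition cexp (z : R[i]) : R[i] :=
  (expR (complex.Re z) * cos (complex.Im z)) +i*
  (expR (complex.Re z) * sin (complex.Im z)).

Definition cexpi (s : R) : R[i] := cexp (0 +i* s).

Definition cintegrable d (T : measurableType d) (mu : {measure set T -> \bar R})
    (D : set T) (g : T -> R[i]) : Prop :=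
  mu.-integrable D (fun x => (complex.Re (g x))%:E) /\
  mu.-integrable D (fun x => (complex.Im (g x))%:E).

Definition cintegral d (T : measurableType d) (mu : {measure set T -> \bar R})
    (D : set T) (g : T -> R[i]) : R[i] :=
  (\int[mu]_(x in D) complex.Re (g x))%R +i*
  (\int[mu]_(x in D) complex.Im (g x))%R.

(* The alias R[i]^o carries the topology of the norm of R[i]. L is constrained,
   hence unique, only on [-r, r]. *)
Definition is_distinguished_log (psi : R -> R[i]) (r : R) (c : R[i])
    (L : R -> R[i]) : Prop :=
  [/\ {within `[- r, r], continuous (L : R -> R[i]^o)},
      forall t, t \in `[- r, r] -> cexp (L t) = psi t &
      L 0 = c].

Definition distinguished_log (psi : R -> R[i]) (r : R) (c : R[i]) : R -> R[i] :=
  xget (fun=> 0) [set L | is_distinguished_log psi r c L].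

End Complex.

Section Probability.
Context {R : realType}.

Definition probability_density (f : R -> R) : Prop :=
  [/\ measurable_fun [set: R] f,
      forall x, 0 <= f x &
      (\int[lebesgue_measure]_x (f x)%:E = 1)%E].

(* The characteristic function of the law with density f *)
Definition density_cf (f : R -> R) (t : R) : R[i] :=
  cintegral lebesgue_measure [set: R] (fun x => cexpi (t * x) * (f x)%:C).

Context d (T : measurableType d) (P : probability T R).

Definition sigma_rv d' (T' : measurableType d') (X : T -> T') : set (set T) :=
  preimage_set_system [set: T] X measurable.

Definition sigma_rvs d' (T' : measurableType d') (X : nat -> T -> T') :
    set (set T) :=
  <<s \bigcup_j sigma_rv (X j) >>.

Definition mutually_independent (I : choiceType) (F : I -> set (set T)) :
    Prop :=
  forall (J : {fset I}) (E : I -> set T),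
    (forall i, i \in J -> F i (E i)) ->
    P (\bigcap_(i in [set` J]) E i) = (\prod_(i <- J) P (E i))%E.

Definition independent_rvs d' (T' : measurableType d') (X : nat -> T -> T') :
    Prop :=
  mutually_independent (fun j => sigma_rv (X j)).

Definition independent3 (F G H : set (set T)) : Prop :=
  mutually_independent (fun i : 'I_3 => tnth [tuple F; G; H] i).

Definition cvg_in_distribution (V : nat -> T -> R)
    (Q : probability (measurableTypeR R) R) : Prop :=
  (forall n, measurable_fun [set: T] (V n)) /\
  forall r : R,
    continuous_at r (fun s : R => Q `]-oo, s]%classic) ->
    P (V n @^-1` `]-oo, r]%classic) @[n --> \oo] --> Q `]-oo, r]%classic.

End Probability.

Section Estimator.
Context {R : realType}.

Definition sinc_kernel (x : R) : R := if x == 0 then pi^-1 else sin x / (pi * x).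

(* The Fourier transform of the sinc kernel. As sinc_kernel is not absolutely
   integrable, the two are related by Fourier inversion (sinc_kernel_inversion). *)
Definition sinc_kernel_ft (t : R) : R := \1_(`[- 1, 1]%classic : set R) t.

Lemma Rintegral_is_derive (F f : R -> R) (a b : R) : a < b ->
  continuous f -> (forall t : R, is_derive t (1 : R) F (f t)) ->
  (\int[lebesgue_measure]_(t in `[a, b]) f t)%R = F b - F a.
Proof.
move=> ab cf dF; rewrite /Rintegral.
have dF1 t : derivable F t 1 by case: (dF t).
have cF : continuous F by move=> t; apply/differentiable_continuous/derivable1_diffP.
rewrite (continuous_FTC2 (F := F)) //.
- exact: continuous_subspaceT.
- by split=> [t _ //||]; [apply: cvg_at_right_filter|apply: cvg_at_left_filter]; exact: cF.
- by move=> t _; rewrite derive1E; case: (dF t).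
Qed.

Lemma sinc_kernel_inversion (x : R) :
  (sinc_kernel x)%:C = (2 * pi)^-1%:C *
    cintegral lebesgue_measure [set: R]
      (fun t => cexpi (- (t * x)) * (sinc_kernel_ft t)%:C).
Proof.
have pi0 : (pi : R) != 0 by rewrite gt_eqF// pi_gt0.
have dM (t : R) : is_derive t (1 : R) (fun t : R => t * x) x.
  have -> : (fun t : R => t * x) = x \*: (@idfun R).
    by apply/funext => s; rewrite /= /GRing.scale /= mulrC.
  by apply: is_derive_eq; rewrite /GRing.scale /= mulr1.
have cM : continuous (fun t : R => t * x).
  by move=> t; apply: cvgMl; exact: cvg_id.
have restr (g : R -> R) : (\int[lebesgue_measure]_t (g t * sinc_kernel_ft t))%R =
    (\int[lebesgue_measure]_(t in `[(-1)%R, 1%R]) g t)%R.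
  rewrite [RHS]Rintegral_mkcond; apply: eq_Rintegral => t _.
  rewrite /sinc_kernel_ft indicE patchE.
  by case: ifP => _; rewrite ?mulr1 ?mulr0.
have reE (s a : R) : complex.Re (cexpi s * a%:C) = cos s * a.
  by rewrite /cexpi /cexp /= expR0 !mul1r mulr0 subr0.
have imE (s a : R) : complex.Im (cexpi s * a%:C) = sin s * a.
  by rewrite /cexpi /cexp /= expR0 !mul1r mulr0 add0r.
rewrite /cintegral.
under eq_Rintegral do rewrite reE cosN.
under [X in _ +i* X]eq_Rintegral do rewrite imE sinN.
rewrite !restr.
have m11 : -1 < 1 :> R by rewrite -subr_gt0 opprK.
have -> : (\int[lebesgue_measure]_(t in `[(-1)%R, 1%R]) - sin (t * x))%R = 0.
  have [->|x0] := eqVneq x 0.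
    under eq_Rintegral do rewrite mulr0 sin0 oppr0.
    by rewrite Rintegral_cst//= mul0r.
  have dF (t : R) : is_derive t (1 : R) (fun t => cos (t * x) / x) (- sin (t * x)).
    have -> : (fun t => cos (t * x) / x) = x^-1 \*: (@cos R \o (fun t => t * x)).
      by apply/funext => s; rewrite /= /GRing.scale /= mulrC.
    have := @is_derive1_comp _ (@cos R) _ t _ _ (is_derive_cos _) (dM t).
    move=> /(@is_deriveZ _ _ _ _ x^-1) H.
    by apply: is_derive_eq; rewrite /GRing.scale /= mulrCA mulVf// mulr1.
  rewrite (Rintegral_is_derive m11 _ dF).
    by rewrite mulN1r cosN mul1r subrr.
  move=> t; apply: cvgN; apply: continuous_comp; first exact: cM.
  exact: continuous_sin.
have -> : (\int[lebesgue_measure]_(t in `[(-1)%R, 1%R]) cos (t * x))%R =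
    2 * pi * sinc_kernel x.
  rewrite /sinc_kernel; have [->|x0] := eqVneq x 0.
    under eq_Rintegral do rewrite mulr0 cos0.
    rewrite (Rintegral_is_derive m11 _ (fun t : R => is_derive_id t (1 : R))).
      by rewrite /= opprK mulfK.
    by move=> t; exact: cvg_cst.
  have dF (t : R) : is_derive t (1 : R) (fun t => sin (t * x) / x) (cos (t * x)).
    have -> : (fun t => sin (t * x) / x) = x^-1 \*: (@sin R \o (fun t => t * x)).
      by apply/funext => s; rewrite /= /GRing.scale /= mulrC.
    have := @is_derive1_comp _ (@sin R) _ t _ _ (is_derive_sin _) (dM t).
    move=> /(@is_deriveZ _ _ _ _ x^-1) H.
    by apply: is_derive_eq; rewrite /GRing.scale /= mulrCA mulVf// mulr1.
  rewrite (Rintegral_is_derive m11 _ dF).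
    rewrite mulN1r sinN mul1r mulNr opprK -mulr2n -[LHS]mulr_natl -mulrA.
    by rewrite [pi * x]mulrC invfM [sin x * (_ / _)]mulrA [sin x / x / pi]mulrC mulVKf.
  move=> t; apply: continuous_comp; first exact: cM.
  exact: continuous_cos.
have -> : (2 * pi * sinc_kernel x) +i* 0 = (2 * pi * sinc_kernel x)%:C by [].
by rewrite -rmorphM /= mulKf// mulf_neq0// pnatr_eq0.
Qed.

Definition empirical_cf (n : nat) (x : nat -> R) (t : R) : R[i] :=
  n%:R^-1 * \sum_(j < n) cexpi (t * x j).

Definition cf_ratio (lambda h : R) (n : nat) (x : nat -> R) (t : R) : R[i] :=
  (empirical_cf n x t * (sinc_kernel_ft (h * t))%:C) /
  (expR (- lambda) * expR (- (t ^+ 2 / 2)))%:C.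

(* The estimator f_nh at the point y from the data x 0, ..., x n.-1; v is its
   value where the distinguished logarithm is undefined. The integral is real,
   by the symmetry Log psi (- t) = (Log psi t)^*. *)
Definition fnh (lambda v h : R) (n : nat) (x : nat -> R) (y : R) : R :=
  let psi := cf_ratio lambda h n x in
  if `[< forall t, t \in `[- h^-1, h^-1] -> psi t != 0 >] then
    (2 * pi * lambda)^-1 *
    complex.Re (cintegral lebesgue_measure `[- h^-1, h^-1]
      (fun t => cexpi (- (t * y)) * distinguished_log psi h^-1 lambda%:C t))
  else v.

Definition fnh_trunc (lambda v h M : R) (n : nat) (x : nat -> R) (y : R) : R :=
  Num.max (Num.min M (fnh lambda v h n x y)) (- M).

End Estimator.

(* Main.v *)
Require Import Defs.
From HB Require Import structures.
From mathcomp Require Import all_boot all_order all_algebra.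
From mathcomp Require Import finmap.
From mathcomp Require Import all_classical all_reals all_analysis measurable_realfun.
From mathcomp.real_closed Require Import complex.
From mathcomp Require Import ring lra.

(** The deconvolved density is recovered from the distinguished logarithm of the
    empirical characteristic function on [-r, r], where r = 1 / h. The
    observations have characteristic function
    phi_X t = exp (lambda (phi_f t - 1) - t^2 / 2) (compound_sum_cf), and the
    function under the logarithm is exp (lambda phi_f) (1 + z), where
    z = phi_emp / phi_X - 1. As long as |z| <= 1/2 on [-r, r], its distinguished
    logarithm is lambda phi_f + log (1 + z) by uniqueness, so that f_nh is a
    deterministic term, plus a linear term in z, plus an error bounded by the
    integral of |z|^2 (fnh_linearization).

    Since r^2 = o(log n), the factor exp (r^2 / 2), which bounds 1 / phi_X, is
    smaller than any power of n. Chernoff bounds on a grid of n^2 + 1 frequencies,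
    together with Lipschitz continuity between them, show that |z| <= 1/2 outside
    an event of probability O(1 / n); on that event the truncation at C log n
    keeps the estimator bounded. The remainder is therefore O(n^(-1 + epsilon))
    in mean (remainder_mean, remainder_rate), which is negligible after
    multiplication by sqrt n / (h exp (1 / (2 h^2))), and truncation has no
    effect on the limit.

    The linear term is the mean of n independent centred variables, each being
    the transform of exp (i t (X_j - x)) / phi_X t over [-r, r]. As
    1 / |phi_X t| grows like exp (t^2 / 2), this transform is dominated by
    frequencies near the endpoints: the kernel r exp ((t^2 - r^2) / 2) has mass
    tending to 2, concentrated near t = r and t = -r (Rintegral_endpoint_kernel).
    There 1 / phi_X t is equivalent to exp (lambda + t^2 / 2), because phi_f
    vanishes at infinity, being integrable and Lipschitz. After normalization one
    summand is thus close in mean to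
    (exp lambda / (pi lambda)) cos (r (X_j - x)) (leading_approx), whose mean
    tends to 0 and whose variance tends to half the square of the coefficient,
    which is the variance in the theorem (centered_leadingP).

    The summands are uniformly bounded, so the characteristic functions of their
    normalized sums converge to that of the normal law (iid_array_cf); the
    remainder does not change the limit since it tends to 0 in mean. Convergence
    in distribution then follows by smoothing with a small Gaussian perturbation
    and Fourier inversion (levy_normal).

    Measurability of the estimator rests on an explicit formula for the
    distinguished logarithm: the sum of the principal logarithms of quotients of
    values of phi_emp at consecutive points of a fine subdivision
    (measurable_log_transform). *)

Set Implicit Arguments.
Unset Strict Implicit.
Unset Printing Implicit Defensive.

Import Order.TTheory GRing.Theory Num.Theory.
Import numFieldNormedType.Exports.

Local Open Scope classical_set_scope.
Local Open Scope ring_scope.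
(** * Elementary real and complex estimates *)

Section ElementaryBounds.
Context {R : realType}.
Implicit Types x y a b : R.

Lemma expR_le_quadratic x : x <= 2^-1 -> expR x <= 1 + x + 2 * x ^+ 2.
Proof.
move=> x2; have x1 : 0 < 1 - x by lra.
rewrite -[x in expR x]opprK expRN.
have := expR_ge1Dx (- x) => h.
apply: (@le_trans _ _ (1 - x)^-1); first by rewrite lef_pV2 ?posrE ?expR_gt0.
rewrite -[X in X <= _]mul1r ler_pdivrMr//.
suff : 0 <= x ^+ 2 * (1 - 2 * x) by rewrite expr2; nra.
by apply: mulr_ge0; [exact: sqr_ge0|lra].
Qed.

(** The Taylor bounds below are obtained from one another by this form of the
    mean value inequality, each function being the derivative of the next. *)
Lemma normr_le_derive (f f' : R -> R) (B x : R) :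
  (forall c, is_derive c (1 : R) f (f' c)) -> f 0 = 0 ->
  (forall c, `|c| <= `|x| -> `|f' c| <= B) -> `|f x| <= B * `|x|.
Proof.
move=> df f0 Bf.
have cf : continuous f.
  move=> t; apply/differentiable_continuous/derivable1_diffP.
  by case: (df t).
have [x0|x0] := leP 0 x.
  have [c cI] := MVT_segment x0 (fun t _ => df t) (continuous_subspaceT cf).
  rewrite f0 !subr0 => ->; rewrite normrM ler_wpM2r// Bf//.
  by move: cI; rewrite in_itv/= => /andP[c0 cx]; rewrite !ger0_norm.
have [c cI] := MVT_segment (ltW x0) (fun t _ => df t) (continuous_subspaceT cf).
rewrite f0 !sub0r => h; rewrite -normrN h normrM normrN ler_wpM2r// Bf//.
move: cI; rewrite in_itv/= => /andP[c0 cx]; rewrite !ler0_norm ?lerN2//.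
exact: ltW.
Qed.

Lemma normr_sin_le x : `|sin x| <= `|x|.
Proof.
rewrite -[leRHS]mul1r; apply: (@normr_le_derive _ cos) => //.
  exact: sin0.
by move=> c _; exact: cos_max.
Qed.

Lemma normr_cos_sub1_le x : `|cos x - 1| <= x ^+ 2.
Proof.
rewrite -real_normK ?num_real// expr2.
apply: (@normr_le_derive (fun x => cos x - 1) (fun x => - sin x)).
- by move=> c; apply: is_derive_eq; rewrite subr0.
- by rewrite cos0 subrr.
- by move=> c h; rewrite normrN (le_trans (normr_sin_le _)).
Qed.

Lemma normr_sin_sub_le x : `|sin x - x| <= `|x| ^+ 3.
Proof.
rewrite exprSr.
apply: (@normr_le_derive (fun x => sin x - x) (fun x => cos x - 1)).
- by rewrite sin0 subrr.
- move=> c h; rewrite (le_trans (normr_cos_sub1_le _))//.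
  by rewrite -real_normK ?num_real// lerXn2r ?nnegrE.
Qed.

Lemma normr_cos_taylor_le x : `|cos x - 1 + x ^+ 2 / 2| <= x ^+ 4.
Proof.
have -> : x ^+ 4 = `|x| ^+ 3 * `|x|.
  by rewrite -exprSr -normrX ger0_norm// exprn_even_ge0.
apply: (@normr_le_derive (fun x => cos x - 1 + x ^+ 2 / 2) (fun x => x - sin x)).
- move=> c; apply: is_derive_eq; rewrite /GRing.scale /=; by field.
- by rewrite cos0 subrr expr0n mul0r addr0.
- move=> c h; rewrite distrC (le_trans (normr_sin_sub_le _))//.
  by rewrite lerXn2r ?nnegrE.
Qed.

Lemma normr_cosB_le x y : `|cos x - cos y| <= `|x - y|.
Proof.
rewrite -[x in cos x](subrK y) -[leRHS]mul1r.
apply: (@normr_le_derive (fun t => cos (t + y) - cos y) (fun t => - sin (t + y))).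
- by move=> c; apply: is_derive_eq; rewrite /GRing.scale /= !(addr0, subr0, mulr1, mul1r).
- by rewrite add0r subrr.
- by move=> c _; rewrite normrN; exact: sin_max.
Qed.

Lemma normr_sinB_le x y : `|sin x - sin y| <= `|x - y|.
Proof.
have H (z : R) : sin z = - cos (z + pi / 2) by rewrite cosDpihalf opprK.
rewrite !H opprK addrC distrC (le_trans (normr_cosB_le _ _))//.
by rewrite opprD addrACA subrr addr0 distrC.
Qed.

Lemma normr_atan_sub_le x : `|atan x - x| <= `|x| ^+ 3.
Proof.
rewrite exprSr.
apply: (@normr_le_derive (fun x => atan x - x) (fun x => (1 + x ^+ 2)^-1 - 1)).
- by rewrite atan0 subrr.
- move=> c h; have c0 : 0 < 1 + c ^+ 2 by rewrite ltr_wpDr// sqr_ge0.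
  have -> : (1 + c ^+ 2)^-1 - 1 = - (c ^+ 2 / (1 + c ^+ 2)).
    by field; rewrite gt_eqF.
  rewrite normrN normrM (ger0_norm (sqr_ge0 _)) gtr0_norm ?invr_gt0//.
  rewrite ler_pdivrMr// (@le_trans _ _ (`|x| ^+ 2))//.
    by rewrite -real_normK ?num_real// lerXn2r ?nnegrE.
  by rewrite ler_peMr ?sqr_ge0// lerDl sqr_ge0.
Qed.

Lemma ln_ge_quadratic x : - (3 / 4) <= x -> x - 4 * x ^+ 2 <= ln (1 + x).
Proof.
move=> x34; have x0 : 0 < 1 + x by lra.
have h : ln (1 + x)^-1 <= (1 + x)^-1 - 1.
  have := @le_ln1Dx R ((1 + x)^-1 - 1).
  rewrite addrCA subrr addr0 ; apply.
  by rewrite ltrBrDr addNr invr_gt0.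
rewrite lnV ?posrE// in h.
have : (1 + x)^-1 - 1 <= - x + 4 * x ^+ 2.
  rewrite lerBlDr -[X in X <= _]mul1r ler_pdivrMr//.
  suff : 0 <= x ^+ 2 * (3 + 4 * x) by rewrite expr2; nra.
  by apply: mulr_ge0; [exact: sqr_ge0|lra].
lra.
Qed.

Lemma normr_ln1D_sub_le x : - (3 / 4) <= x -> `|ln (1 + x) - x| <= 4 * x ^+ 2.
Proof.
move=> x34; have := ln_ge_quadratic x34.
have : ln (1 + x) <= x by apply: le_ln1Dx; lra.
have := sqr_ge0 x => ? ? ?.
rewrite ler_norml; apply/andP; split; lra.
Qed.

End ElementaryBounds.

Section ComplexLog.
Context {R : realType}.
Local Open Scope complex_scope.
Local Notation cRe := (@complex.Re R).
Local Notation cIm := (@complex.Im R).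
Local Notation normc := (@Normc.normc R).
Implicit Types (z w : R[i]) (s t x : R).

Lemma complexP z w : cRe z = cRe w -> cIm z = cIm w -> z = w.
Proof. by case: z w => [a b] [c d] /= -> ->. Qed.

Lemma cReD z w : cRe (z + w) = cRe z + cRe w. Proof. by case: z; case: w. Qed.
Lemma cImD z w : cIm (z + w) = cIm z + cIm w. Proof. by case: z; case: w. Qed.
Lemma cReN z : cRe (- z) = - cRe z. Proof. by case: z. Qed.
Lemma cImN z : cIm (- z) = - cIm z. Proof. by case: z. Qed.
Lemma cReM z w : cRe (z * w) = cRe z * cRe w - cIm z * cIm w.
Proof. by case: z; case: w. Qed.
Lemma cImM z w : cIm (z * w) = cRe z * cIm w + cIm z * cRe w.
Proof. by case: z; case: w. Qed.
Lemma Re_sum (I : Type) (r : seq I) (F : I -> R[i]) :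
  cRe (\sum_(i <- r) F i) = \sum_(i <- r) cRe (F i).
Proof. exact: (big_morph _ cReD erefl). Qed.
Lemma Im_sum (I : Type) (r : seq I) (F : I -> R[i]) :
  cIm (\sum_(i <- r) F i) = \sum_(i <- r) cIm (F i).
Proof. exact: (big_morph _ cImD erefl). Qed.

Lemma normc_ReIm z : normc z = Num.sqrt (cRe z ^+ 2 + cIm z ^+ 2).
Proof. by case: z. Qed.

Lemma sqr_normcE z : normc z ^+ 2 = cRe z ^+ 2 + cIm z ^+ 2.
Proof. by rewrite normc_ReIm sqr_sqrtr// addr_ge0 ?sqr_ge0. Qed.

Lemma normc_ge0 z : 0 <= normc z. Proof. by rewrite normc_ReIm sqrtr_ge0. Qed.

Lemma normc_eq0 z : (normc z == 0) = (z == 0).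
Proof.
by apply/eqP/eqP => [/Normc.eq0_normc//|->]; rewrite Normc.normc0.
Qed.

Lemma normr_Re_le z : `|cRe z| <= normc z.
Proof.
by rewrite -sqrtr_sqr normc_ReIm ler_sqrt ?lerDl ?addr_ge0 ?sqr_ge0.
Qed.

Lemma normr_Im_le z : `|cIm z| <= normc z.
Proof.
by rewrite -sqrtr_sqr normc_ReIm ler_sqrt ?lerDr ?addr_ge0 ?sqr_ge0.
Qed.

Lemma normc_le_ReIm z : normc z <= `|cRe z| + `|cIm z|.
Proof.
rewrite -(@ler_pXn2r _ 2%N)// ?nnegrE ?normc_ge0 ?addr_ge0//.
rewrite sqr_normcE sqrrD !real_normK ?num_real//.
by rewrite lerD2r lerDl mulrn_wge0// mulr_ge0.
Qed.

Lemma normc_real x : normc x%:C = `|x|.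
Proof. by rewrite normc_ReIm /= expr0n addr0 sqrtr_sqr. Qed.

Lemma cexp0 : cexp (0 : R[i]) = 1.
Proof. by rewrite /cexp /= expR0 cos0 sin0 !mul1r. Qed.

Lemma cexpD z w : cexp (z + w) = cexp z * cexp w.
Proof.
rewrite /cexp; apply: complexP => /=; rewrite ?cReD ?cImD expRD ?cosD ?sinD; ring.
Qed.

Lemma cexp_real x : cexp x%:C = (expR x)%:C.
Proof. by rewrite /cexp /= cos0 sin0 mulr1 mulr0. Qed.

Lemma normc_cexp z : normc (cexp z) = expR (cRe z).
Proof.
rewrite normc_ReIm /cexp /= !exprMn -mulrDr cos2Dsin2 mulr1 sqrtr_sqr.
by rewrite ger0_norm ?expR_ge0.
Qed.

Lemma cexp_neq0 z : cexp z != 0.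
Proof. by rewrite -normc_eq0 normc_cexp gt_eqF ?expR_gt0. Qed.

Lemma cexpN z : cexp (- z) = (cexp z)^-1.
Proof.
by apply: (mulfI (cexp_neq0 z)); rewrite -cexpD subrr cexp0 divff ?cexp_neq0.
Qed.

Lemma cexp_sum (I : Type) (r : seq I) (F : I -> R[i]) :
  cexp (\sum_(i <- r) F i) = \prod_(i <- r) cexp (F i).
Proof. exact: (big_morph _ cexpD cexp0). Qed.

Lemma Re_cexpi s : cRe (cexpi s) = cos s.
Proof. by rewrite /cexpi /cexp /= expR0 mul1r. Qed.
Lemma Im_cexpi s : cIm (cexpi s) = sin s.
Proof. by rewrite /cexpi /cexp /= expR0 mul1r. Qed.

Lemma normc_cexpi s : normc (cexpi s) = 1.
Proof. by rewrite /cexpi normc_cexp expR0. Qed.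

Lemma cexpiD s t : cexpi (s + t) = cexpi s * cexpi t.
Proof. by rewrite /cexpi -cexpD; congr cexp; apply: complexP => /=; rewrite ?addr0. Qed.

Lemma cexpi_sum (I : Type) (r : seq I) (F : I -> R) :
  cexpi (\sum_(i <- r) F i) = \prod_(i <- r) cexpi (F i).
Proof. by apply: (big_morph _ cexpiD); rewrite /cexpi -[RHS]cexp0. Qed.

Definition clog z : R[i] := ln (normc z) +i* atan (cIm z / cRe z).

Lemma clogK z : 0 < cRe z -> cexp (clog z) = z.
Proof.
move=> a0; set q := cIm z / cRe z.
have nz : normc z = cRe z * Num.sqrt (1 + q ^+ 2).
  rewrite normc_ReIm -{2}(ger0_norm (ltW a0)) -sqrtr_sqr -sqrtrM ?sqr_ge0//.
  congr Num.sqrt; rewrite /q; field; exact: lt0r_neq0.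
have s0 : 0 < Num.sqrt (1 + q ^+ 2).
  by rewrite sqrtr_gt0 ltr_wpDr// sqr_ge0.
have lnk : expR (ln (normc z)) = normc z.
  by rewrite lnK// posrE nz mulr_gt0.
have Rez : cRe (cexp (clog z)) = cRe z.
  by rewrite /= lnk cos_atan nz mulfK// gt_eqF.
apply: complexP => //.
have cq : cos (atan q) != 0 by rewrite cos_atan invr_eq0 gt_eqF.
have : sin (atan q) = q * cos (atan q).
  by rewrite -[X in X * cos _](atanK q) /tan divfK.
rewrite /= -/q => ->; rewrite mulrCA; have /= -> := Rez.
by rewrite /q divfK// gt_eqF.
Qed.

Lemma clog1 : clog 1 = 0.
Proof. by rewrite /clog Normc.normc1 ln1 /= mul0r atan0. Qed.

(** With z = a + i b, the real part of clog (1 + z) is half of ln (1 + (2 a +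
    `|z|^2)) and its imaginary part is atan (b / (1 + a)), so that the real
    expansions of ln and atan apply. The constant is not sharp. *)
Lemma normc_clog1D_sub_le z : normc z <= 2^-1 ->
  normc (clog (1 + z) - z) <= 40 * normc z ^+ 2.
Proof.
move=> z2; set q := normc z; have q0 : 0 <= q := normc_ge0 z.
have az : `|cRe z| <= q := normr_Re_le z.
have bz : `|cIm z| <= q := normr_Im_le z.
have qE : q ^+ 2 = cRe z ^+ 2 + cIm z ^+ 2 := sqr_normcE z.
set a := cRe z in az qE *; set b := cIm z in bz qE *.
move: (az) (bz); rewrite !ler_norml => /andP[a1 a2] /andP[b1 b2].
have q2 : q <= 2^-1 := z2.
have q4 : q ^+ 2 <= q / 2 by rewrite expr2 ler_wpM2l.
have Rebound : `|cRe (clog (1 + z) - z)| <= 13 * q ^+ 2.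
  have nE : normc (1 + z) ^+ 2 = 1 + (2 * a + q ^+ 2).
    by rewrite sqr_normcE cReD cImD /= -/a -/b qE; ring.
  have n0 : 0 < normc (1 + z).
    rewrite lt_neqAle normc_ge0 andbT eq_sym -sqrf_eq0 nE gt_eqF//.
    have : 0 <= (2 * a + 1) ^+ 2 := sqr_ge0 _; have := sqr_ge0 b.
    rewrite qE; nra.
  have -> : cRe (clog (1 + z) - z) = 2^-1 * (ln (1 + (2 * a + q ^+ 2)) - (2 * a + q ^+ 2)) + 2^-1 * q ^+ 2.
    by rewrite cReD cReN /= -/a -nE lnXn//; field.
  have h34 : - (3 / 4) <= 2 * a + q ^+ 2.
    have := sqr_ge0 b; have := sqr_ge0 (a + 2^-1); rewrite qE; nra.
  have := normr_ln1D_sub_le h34.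
  have : (2 * a + q ^+ 2) ^+ 2 <= (5 / 2 * q) ^+ 2.
    rewrite -[leLHS]real_normK ?num_real// lerXn2r ?nnegrE//; first lra.
    by have := sqr_ge0 q; rewrite ler_norml => ?; apply/andP; split; lra.
  rewrite !ler_norml => h /andP[h1 h2]; rewrite expr2 in h *.
  by rewrite expr2 in h1 h2; apply/andP; split; nra.
have Imbound : `|cIm (clog (1 + z) - z)| <= 10 * q ^+ 2.
  rewrite cImD cImN /= cReD cImD /= -/a -/b add0r.
  have a0 : 0 < 1 + a by lra.
  have -> : atan (b / (1 + a)) - b = (atan (b / (1 + a)) - b / (1 + a)) - a * (b / (1 + a)).
    field; exact: lt0r_neq0.
  have yq : `|b / (1 + a)| <= 2 * q.
    rewrite normrM (@gtr0_norm _ (1 + a)^-1) ?invr_gt0// ler_pdivrMr//.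
    rewrite (le_trans bz)//; nra.
  rewrite (le_trans (ler_normB _ _))//.
  have h1 : `|b / (1 + a)| ^+ 3 <= 8 * q ^+ 2.
    rewrite (@le_trans _ _ ((2 * q) ^+ 3))//.
      by rewrite lerXn2r ?nnegrE//; lra.
    by rewrite exprMn exprS [q ^+ 3]exprS; have := sqr_ge0 q; nra.
  have h2 : `|a * (b / (1 + a))| <= 2 * q ^+ 2.
    by rewrite normrM expr2 mulrCA ler_pM.
  have := normr_atan_sub_le (b / (1 + a)); lra.
have := normc_le_ReIm (clog (1 + z) - z); have := sqr_ge0 q; lra.
Qed.

End ComplexLog.

(** * Bounded measurable functions and independence *)

Section BoundedMeasurable.
Context {R : realType} d (T : measurableType d).
Implicit Types f g : T -> R.

(** This class is stable under every operation needed on truncated or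
    trigonometric functions of random variables and its members are integrable
    for all probabilities, which discharges the integrability conditions of the
    linearity of expectation. *)
Definition bounded_measurable f :=
  measurable_fun [set: T] f /\ exists B : R, forall x, `|f x| <= B.

Lemma bounded_measurable_cst (c : R) : bounded_measurable (fun=> c).
Proof. by split; [exact: measurable_cst|exists `|c|]. Qed.

Lemma bounded_measurableD f g : bounded_measurable f -> bounded_measurable g ->
  bounded_measurable (fun x => f x + g x).
Proof.
move=> [mf [B fB]] [mg [C gC]]; split; first exact: measurable_funD.
by exists (B + C) => x; rewrite (le_trans (ler_normD _ _))// lerD.
Qed.

Lemma bounded_measurableN f : bounded_measurable f ->
  bounded_measurable (fun x => - f x).
Proof.
move=> [mf [B fB]]; split; first exact: measurableT_comp.
by exists B => x; rewrite normrN.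
Qed.

Lemma bounded_measurableB f g : bounded_measurable f -> bounded_measurable g ->
  bounded_measurable (fun x => f x - g x).
Proof.
by move=> bf bg; apply: bounded_measurableD => //; exact: bounded_measurableN.
Qed.

Lemma bounded_measurableM f g : bounded_measurable f -> bounded_measurable g ->
  bounded_measurable (fun x => f x * g x).
Proof.
move=> [mf [B fB]] [mg [C gC]]; split; first exact: measurable_funM.
by exists (B * C) => x; rewrite normrM ler_pM.
Qed.

Lemma bounded_measurable_norm f : bounded_measurable f ->
  bounded_measurable (fun x => `|f x|).
Proof.
move=> [mf [B fB]]; split; first exact: measurableT_comp.
by exists B => x; rewrite normr_id.
Qed.

Lemma bounded_measurable_indic (A : set T) : measurable A ->
  bounded_measurable (\1_A).
Proof.
move=> mA; split; first exact: measurable_indic.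
by exists 1 => x; rewrite indicE; case: (_ \in _); rewrite ?normr1 ?normr0.
Qed.

Lemma bounded_measurable_sum (I : Type) (s : seq I) (F : I -> T -> R) :
  (forall i, bounded_measurable (F i)) ->
  bounded_measurable (fun x => \sum_(i <- s) F i x).
Proof.
move=> bF; elim: s => [|i s ih].
  by under eq_fun do rewrite big_nil; exact: bounded_measurable_cst.
by under eq_fun do rewrite big_cons; exact: bounded_measurableD.
Qed.

Lemma bounded_measurable_prod (I : eqType) (s : seq I) (F : I -> T -> R) :
  (forall i, i \in s -> bounded_measurable (F i)) ->
  bounded_measurable (fun x => \prod_(i <- s) F i x).
Proof.
elim: s => [|i s ih] bF.
  by under eq_fun do rewrite big_nil; exact: bounded_measurable_cst.
under eq_fun do rewrite big_cons; apply: bounded_measurableM.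
  by apply: bF; rewrite mem_head.
by apply: ih => j js; apply: bF; rewrite in_cons js orbT.
Qed.

Lemma bounded_measurable_cos f : measurable_fun [set: T] f ->
  bounded_measurable (fun x => cos (f x)).
Proof.
move=> mf; split; last by exists 1 => x; exact: cos_max.
apply: measurableT_comp => //; apply: continuous_measurable_fun.
exact: continuous_cos.
Qed.

Lemma bounded_measurable_sin f : measurable_fun [set: T] f ->
  bounded_measurable (fun x => sin (f x)).
Proof.
move=> mf; split; last by exists 1 => x; exact: sin_max.
apply: measurableT_comp => //; apply: continuous_measurable_fun.
exact: continuous_sin.
Qed.

Variable P : probability T R.

Lemma bounded_measurable_integrable f : bounded_measurable f ->
  P.-integrable [set: T] (EFin \o f).
Proof.
move=> [mf [B fB]]; apply: measurable_bounded_integrable => //.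
  by rewrite (@le_lt_trans _ _ 1%E) ?ltry// probability_le1.
exists B; split; first exact: num_real.
by move=> M BM x _ /=; rewrite (le_trans (fB x))// ltW.
Qed.
Local Notation bint := bounded_measurable_integrable.

Lemma bintD f g : bounded_measurable f -> bounded_measurable g ->
  \int[P]_x (f x + g x) = \int[P]_x f x + \int[P]_x g x.
Proof. by move=> bf bg; rewrite RintegralD//; exact: bint. Qed.

Lemma bintB f g : bounded_measurable f -> bounded_measurable g ->
  \int[P]_x (f x - g x) = \int[P]_x f x - \int[P]_x g x.
Proof. by move=> bf bg; rewrite RintegralB//; exact: bint. Qed.

Lemma bintZ (c : R) f : bounded_measurable f ->
  \int[P]_x (c * f x) = c * \int[P]_x f x.
Proof. by move=> bf; rewrite RintegralZl//; exact: bint. Qed.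

Lemma bint_cst (c : R) : \int[P]_x c = c.
Proof. by rewrite Rintegral_cst//= probability_setT mulr1. Qed.

Lemma bint_sum (I : Type) (s : seq I) (F : I -> T -> R) :
  (forall i, bounded_measurable (F i)) ->
  \int[P]_x (\sum_(i <- s) F i x) = \sum_(i <- s) \int[P]_x F i x.
Proof.
move=> bF; elim: s => [|i s ih].
  by rewrite big_nil; under eq_Rintegral do rewrite big_nil; rewrite bint_cst.
rewrite big_cons; under eq_Rintegral do rewrite big_cons.
by rewrite bintD ?ih//; exact: bounded_measurable_sum.
Qed.

Lemma bint_le f g : bounded_measurable f -> bounded_measurable g ->
  (forall x, f x <= g x) -> \int[P]_x f x <= \int[P]_x g x.
Proof. by move=> bf bg fg; apply: le_Rintegral => //; exact: bint. Qed.

Lemma bint_norm_le f : bounded_measurable f ->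
  `|\int[P]_x f x| <= \int[P]_x `|f x|.
Proof. by move=> bf; apply: le_normr_Rintegral => //; exact: bint. Qed.

Lemma bint_norm_le_cst f (B : R) : bounded_measurable f ->
  (forall x, `|f x| <= B) -> `|\int[P]_x f x| <= B.
Proof.
move=> bf fB; rewrite (le_trans (bint_norm_le bf))//.
rewrite -[leRHS]bint_cst; apply: bint_le => //.
  exact: bounded_measurable_norm.
exact: bounded_measurable_cst.
Qed.

Lemma bint_indic (A : set T) : measurable A -> \int[P]_x \1_A x = fine (P A).
Proof. by move=> mA; rewrite /Rintegral integral_indic// setIT. Qed.

Lemma fine_probability_setC (A : set T) : measurable A ->
  fine (P (~` A)) = 1 - fine (P A).
Proof.
move=> mA; rewrite -!bint_indic//; last exact: measurableC.
rewrite -[X in X - _]bint_cst -bintB; last 2 first.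
  exact: bounded_measurable_cst.
  exact: bounded_measurable_indic.
apply: eq_Rintegral => x _; rewrite !indicE in_setC.
by case: (_ \in A) => /=; rewrite ?subrr ?subr0.
Qed.

(** The integer part of x when 0 <= x <= n, written as a sum of indicators of
    half-lines so that step n (g w) is a sum of indicators of events of g. *)
Let step (n : nat) (x : R) : R := \sum_(k < n) (k.+1%:R <= x)%R%:R.

Let step_id (n : nat) (x : R) : n%:R <= x -> step n x = n%:R.
Proof.
move=> nx; rewrite /step (eq_bigr (fun=> 1)).
  by rewrite sumr_const card_ord.
by move=> i _; rewrite (le_trans _ nx)// ler_nat.
Qed.

Let step_bounds (n : nat) (x : R) : 0 <= x <= n%:R -> `|x - step n x| <= 1.
Proof.
elim: n x => [|n ih] x /andP[x0 xn].
  by rewrite /step big_ord0 subr0 ger0_norm// (le_trans xn).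
have [nx|nx] := leP n.+1%:R x.
  by rewrite step_id// (_ : x = n.+1%:R) ?subrr ?normr0//; apply/le_anti/andP.
have -> : step n.+1 x = step n x.
  by rewrite /step big_ord_recr/= leNgt nx /= addr0.
have [xn'|xn'] := leP x n%:R; first by apply: ih; rewrite x0.
rewrite step_id 1?ltW// ger0_norm ?subr_ge0 1?ltW//.
by move: xn; rewrite -natr1; lra.
Qed.

(** Uniform approximation of g by step functions reduces the claim to the
    events of g. *)
Lemma uncorrelated_of_events (g H : T -> R) :
  bounded_measurable g -> bounded_measurable H ->
  (forall A : set R, measurable A ->
    \int[P]_x (\1_(g @^-1` A) x * H x) = fine (P (g @^-1` A)) * \int[P]_x H x) ->
  \int[P]_x (g x * H x) = (\int[P]_x g x) * \int[P]_x H x.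
Proof.
move=> bg bH hE; have [mg [B0 gB0]] := bg; have [mH [C0 HC0]] := bH.
pose B : R := `|B0| + 1; pose C : R := `|C0| + 1.
have B1 : 0 < B by rewrite ltr_wpDl.
have C1 : 0 < C by rewrite ltr_wpDl.
have gB x : `|g x| <= B.
  by rewrite (le_trans (gB0 x))// (le_trans (ler_norm _))// lerDl.
have HC x : `|H x| <= C.
  by rewrite (le_trans (HC0 x))// (le_trans (ler_norm _))// lerDl.
apply/eqP; rewrite -subr_eq0 -normr_le0; apply/ler_addgt0Pl => e e0.
rewrite addr0.
pose n := (Num.truncn (4 * B * C / e)).+1.
have n0 : (0 : R) < n%:R by rewrite ltr0n.
have nb : 4 * B * C / n%:R <= e.
  have := truncnS_gt (4 * B * C / e); rewrite -/n ltr_pdivrMr// => h.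
  by rewrite ler_pdivrMr// [e * _]mulrC ltW.
pose G x := (\sum_(k < n) (2 * B / n%:R * \1_(g @^-1` [set y | k.+1%:R <= (y + B) / (2 * B) * n%:R]) x)) - B.
have mlev k : measurable [set y : R | k.+1%:R <= (y + B) / (2 * B) * n%:R].
  rewrite -[X in measurable X]setTI; apply: measurable_fun_le => //.
  apply: measurable_funM => //; apply: measurable_funM => //.
  exact: measurable_funD.
have mglev k : measurable (g @^-1` [set y : R | k.+1%:R <= (y + B) / (2 * B) * n%:R]).
  by rewrite -[X in measurable X]setTI; exact: mg.
have bterm (k : 'I_n) : bounded_measurable (fun x => 2 * B / n%:R *
   \1_(g @^-1` [set y | k.+1%:R <= (y + B) / (2 * B) * n%:R]) x).
  apply: bounded_measurableM; first exact: bounded_measurable_cst.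
  exact: bounded_measurable_indic.
have bG : bounded_measurable G.
  apply: bounded_measurableB; last exact: bounded_measurable_cst.
  exact: bounded_measurable_sum.
have Gg x : `|g x - G x| <= 2 * B / n%:R.
  have -> : G x = 2 * B / n%:R * step n ((g x + B) / (2 * B) * n%:R) - B.
    rewrite /G /step mulr_sumr; congr (_ - _); apply: eq_bigr => k _.
    by rewrite indicE mem_setE.
  set u := step _ _.
  have -> : g x - (2 * B / n%:R * u - B) =
     2 * B / n%:R * ((g x + B) / (2 * B) * n%:R - u).
    by field; rewrite !gt_eqF.
  rewrite normrM (@gtr0_norm _ (2 * B / n%:R)) ?divr_gt0 ?mulr_gt0//.
  rewrite -[leRHS]mulr1 ler_wpM2l ?divr_ge0 ?mulr_ge0 ?(ltW B1) ?ler0n//.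
  have := gB x; rewrite ler_norml => /andP[g1 g2].
  apply: step_bounds; rewrite mulr_ge0 ?divr_ge0 ?(ltW n0)//=; [|lra..].
  rewrite -[leRHS]mul1r ler_wpM2r ?ler0n// ler_pdivrMr ?mulr_gt0//; lra.
have GE : \int[P]_x (G x * H x) = (\int[P]_x G x) * \int[P]_x H x.
  have -> : (fun x => G x * H x) = (fun x => (\sum_(k < n) (2 * B / n%:R *
     (\1_(g @^-1` [set y | k.+1%:R <= (y + B) / (2 * B) * n%:R]) x * H x))) - B * H x).
    apply/funext => x; rewrite /G mulrBl mulr_suml; congr (_ - _).
    by apply: eq_bigr => k _; rewrite mulrA.
  have bt (k : 'I_n) : bounded_measurable (fun x =>
     (\1_(g @^-1` [set y | k.+1%:R <= (y + B) / (2 * B) * n%:R]) x * H x)).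
    by apply: bounded_measurableM => //; exact: bounded_measurable_indic.
  have bt2 (k : 'I_n) : bounded_measurable (fun x => 2 * B / n%:R *
     (\1_(g @^-1` [set y | k.+1%:R <= (y + B) / (2 * B) * n%:R]) x * H x)).
    by apply: bounded_measurableM => //; exact: bounded_measurable_cst.
  rewrite bintB; last 2 first.
    exact: bounded_measurable_sum.
    by apply: bounded_measurableM => //; exact: bounded_measurable_cst.
  rewrite bint_sum// bintZ// /G bintB; last 2 first.
    exact: bounded_measurable_sum.
    exact: bounded_measurable_cst.
  rewrite bint_sum// bint_cst mulrBl mulr_suml; congr (_ - _).
  apply: eq_bigr => k _; rewrite !bintZ ?hE ?bint_indic ?mulrA//.
  exact: bounded_measurable_indic.
have bgG : bounded_measurable (fun x => g x - G x) by exact: bounded_measurableB.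
have e1 : `|\int[P]_x (g x * H x) - \int[P]_x (G x * H x)| <= 2 * B / n%:R * C.
  rewrite -bintB; try exact: bounded_measurableM.
  apply: bint_norm_le_cst; first by apply: bounded_measurableB; exact: bounded_measurableM.
  by move=> x; rewrite -mulrBl normrM ler_pM.
have e2 : `|(\int[P]_x G x) * \int[P]_x H x - (\int[P]_x g x) * \int[P]_x H x| <= 2 * B / n%:R * C.
  rewrite -mulrBl normrM distrC -bintB// ler_pM//; exact: bint_norm_le_cst.
rewrite -[X in `|X|](subrKA (\int[P]_x (G x * H x))) {2}GE.
rewrite (le_trans (ler_normD _ _))// (le_trans (lerD e1 e2))// (le_trans _ nb)//.
by rewrite le_eqVlt; apply/orP; left; apply/eqP; field; rewrite gt_eqF.
Qed.

End BoundedMeasurable.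

Lemma bounded_measurable_comp {R : realType} d (T : measurableType d)
    d' (T' : measurableType d') (X : T' -> T) (f : T -> R) :
  measurable_fun [set: T'] X -> bounded_measurable f ->
  bounded_measurable (fun x => f (X x)).
Proof.
move=> mX [mf [B fB]]; split; first exact: measurableT_comp.
by exists B => x.
Qed.

Section Independence.
Context {R : realType} d (T : measurableType d) (P : probability T R).
Local Open Scope complex_scope.
Local Notation cRe := (@complex.Re R).
Local Notation cIm := (@complex.Im R).

(** Functions are replaced by indicators one at a time by
    uncorrelated_of_events: in the generalized statement, s1 lists the
    functions not yet replaced and s2 the events. The case of events alone is
    the definition of independence. *)
Lemma mutually_independent_Rintegral (I : choiceType) (F : I -> set (set T))
    (s : seq I) (g : I -> T -> R) :
  mutually_independent P F -> uniq s ->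
  (forall i, i \in s -> bounded_measurable (g i)) ->
  (forall i, i \in s -> forall A : set R, measurable A -> F i (g i @^-1` A)) ->
  \int[P]_x (\prod_(i <- s) g i x) = \prod_(i <- s) \int[P]_x g i x.
Proof.
move=> indF us bg Fg.
suff: forall s1 s2 (E : I -> set T), uniq (s1 ++ s2) ->
  (forall i, i \in s1 -> bounded_measurable (g i)) ->
  (forall i, i \in s1 -> forall A : set R, measurable A -> F i (g i @^-1` A)) ->
  (forall i, i \in s2 -> measurable (E i)) ->
  (forall i, i \in s2 -> F i (E i)) ->
  \int[P]_x (\prod_(i <- s1) g i x * \prod_(i <- s2) \1_(E i) x) =
  (\prod_(i <- s1) \int[P]_x g i x) * \prod_(i <- s2) fine (P (E i)).
  move=> /(_ s [::] (fun=> set0)); rewrite cats0 big_nil mulr1 => <- //.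
  by apply: eq_Rintegral => x _; rewrite big_nil mulr1.
elim => [|i s1 ih] s2 E /=.
  move=> us2 _ _ mE FE; rewrite big_nil mul1r.
  under eq_Rintegral do rewrite big_nil mul1r.
  transitivity (fine (P (\bigcap_(i in [set` [fset i in s2]%fset]) E i))).
    rewrite -bint_indic; last first.
      apply: fin_bigcap_measurable => //= i.
      by rewrite inE; exact: mE.
    apply: eq_Rintegral => x _; rewrite indicE.
    have [xE|xE] := boolP (x \in _).
      rewrite big1_seq// => i /andP[_ is2]; rewrite indicE mem_set//.
      by move: xE; rewrite inE; apply; rewrite /= inE.
    have [i is2 xi] : exists2 i, i \in s2 & ~ E i x.
      apply: contrapT => h; move/negP: xE; apply; rewrite inE => i /=.
      by rewrite inE => is2; apply: contrapT => xi; apply: h; exists i.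
    apply/eqP; rewrite prodf_seq_eq0; apply/hasP; exists i => //=.
    by rewrite indicE memNset.
  rewrite indF; last by move=> i; rewrite inE; exact: FE.
  rewrite (perm_big s2)/=; last first.
    by apply: uniq_perm => //; move=> i; rewrite inE.
  elim: s2 {us2 FE} mE => [|i s2 ih] mE; first by rewrite !big_nil.
  rewrite !big_cons fineM ?ih//.
  - by move=> j js; apply: mE; rewrite in_cons js orbT.
  - by apply: fin_num_measure; apply: mE; rewrite mem_head.
  - rewrite big_seq prode_fin_num// => j js; apply: fin_num_measure.
    by apply: mE; rewrite in_cons js orbT.
move=> /andP[is1 us12] bg' Fg' mE FE.
have bg1 j : j \in s1 -> bounded_measurable (g j).
  by move=> js; apply: bg'; rewrite in_cons js orbT.
have Fg1 j : j \in s1 -> forall A : set R, measurable A -> F j (g j @^-1` A).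
  by move=> js; apply: Fg'; rewrite in_cons js orbT.
have bgi : bounded_measurable (g i) by apply: bg'; rewrite mem_head.
pose H x := \prod_(i <- s1) g i x * \prod_(i <- s2) \1_(E i) x.
have bH : bounded_measurable H.
  apply: bounded_measurableM; first exact: bounded_measurable_prod.
  apply: bounded_measurable_prod => j js; apply: bounded_measurable_indic.
  exact: mE.
have HE : \int[P]_x H x = (\prod_(i <- s1) \int[P]_x g i x) * \prod_(i <- s2) fine (P (E i)).
  exact: ih.
rewrite big_cons -mulrA -HE -uncorrelated_of_events//.
  by apply: eq_Rintegral => x _; rewrite big_cons -mulrA.
move=> A mA; pose E' j := if j == i then g i @^-1` A else E j.
have E's2 j : j \in s2 -> E' j = E j.
  move=> js; rewrite /E'; case: eqP => // ji; move: is1.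
  by rewrite mem_cat -ji js orbT.
have E'i : E' i = g i @^-1` A by rewrite /E' eqxx.
have ps2 : \prod_(j <- s2) fine (P (E' j)) = \prod_(j <- s2) fine (P (E j)).
  by apply: eq_big_seq => j js; rewrite E's2.
have is2 x : \prod_(j <- s2) \1_(E' j) x = \prod_(j <- s2) \1_(E j) x :> R.
  by apply: eq_big_seq => j js; rewrite E's2.
have := ih (i :: s2) E'; rewrite !big_cons E'i ps2 mulrCA -HE => <- //.
- by apply: eq_Rintegral => x _; rewrite !big_cons E'i is2 mulrCA.
- by rewrite uniq_catC /= mem_cat orbC -mem_cat is1/= uniq_catC.
- move=> j; rewrite in_cons => /orP[/eqP ->|js]; last by rewrite E's2//; exact: mE.
  by rewrite E'i -[X in measurable X]setTI; apply bgi.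
- move=> j; rewrite in_cons => /orP[/eqP ->|js]; last by rewrite E's2//; exact: FE.
  by rewrite E'i; apply: Fg'; rewrite ?mem_head.
Qed.

Definition cbounded_measurable (G : T -> R[i]) :=
  bounded_measurable (fun x => cRe (G x)) /\ bounded_measurable (fun x => cIm (G x)).

Lemma cbounded_measurableM (F G : T -> R[i]) :
  cbounded_measurable F -> cbounded_measurable G ->
  cbounded_measurable (fun x => F x * G x).
Proof.
move=> [F1 F2] [G1 G2]; split.
  under eq_fun do rewrite cReM.
  by apply: bounded_measurableB; exact: bounded_measurableM.
under eq_fun do rewrite cImM.
by apply: bounded_measurableD; exact: bounded_measurableM.
Qed.

Lemma cbounded_measurable_real (f : T -> R) :
  bounded_measurable f -> cbounded_measurable (fun x => (f x)%:C).
Proof. by move=> bf; split => //; exact: bounded_measurable_cst. Qed.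

Lemma cbounded_measurable_cst (c : R[i]) : cbounded_measurable (fun=> c).
Proof. by split; exact: bounded_measurable_cst. Qed.

Lemma cbounded_measurable_prod (I : eqType) (s : seq I) (F : I -> T -> R[i]) :
  (forall i, i \in s -> cbounded_measurable (F i)) ->
  cbounded_measurable (fun x => \prod_(i <- s) F i x).
Proof.
elim: s => [|i s ih] bF.
  by under eq_fun do rewrite big_nil; exact: cbounded_measurable_cst.
under eq_fun do rewrite big_cons; apply: cbounded_measurableM.
  by apply: bF; rewrite mem_head.
by apply: ih => j js; apply: bF; rewrite in_cons js orbT.
Qed.

Lemma cbounded_measurable_cexpi (X : T -> R) :
  measurable_fun [set: T] X -> cbounded_measurable (fun x => cexpi (X x)).
Proof.
move=> mX; split.
  by under eq_fun do rewrite Re_cexpi; exact: bounded_measurable_cos.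
by under eq_fun do rewrite Im_cexpi; exact: bounded_measurable_sin.
Qed.

Local Notation Ec := (cintegral P [set: T]).

Lemma eq_cintegral (F G : T -> R[i]) : F =1 G -> Ec F = Ec G.
Proof. by move=> /funext ->. Qed.

Lemma cintegralD (F G : T -> R[i]) :
  cbounded_measurable F -> cbounded_measurable G ->
  Ec (fun x => F x + G x) = Ec F + Ec G.
Proof.
move=> [F1 F2] [G1 G2]; apply: complexP; rewrite /= ?cReD ?cImD /=.
  by under eq_Rintegral do rewrite cReD; rewrite bintD.
by under eq_Rintegral do rewrite cImD; rewrite bintD.
Qed.

Lemma cintegralZ (c : R[i]) (F : T -> R[i]) :
  cbounded_measurable F -> Ec (fun x => c * F x) = c * Ec F.
Proof.
move=> [F1 F2]; have bc k := bounded_measurable_cst T (k : R).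
apply: complexP; rewrite /= ?cReM ?cImM /=.
  under eq_Rintegral do rewrite cReM; rewrite bintB ?bintZ//.
    exact: bounded_measurableM.
  exact: bounded_measurableM.
under eq_Rintegral do rewrite cImM; rewrite bintD ?bintZ//.
  exact: bounded_measurableM.
exact: bounded_measurableM.
Qed.

Lemma cintegral_real (f : T -> R) :
  Ec (fun x => (f x)%:C) = (\int[P]_x f x)%:C.
Proof. by apply: complexP => //=; rewrite bint_cst. Qed.

(** The complex factors listed in s1 are split one at a time into real and
    imaginary parts, which join the real factors listed in s2. *)
Lemma mutually_independent_cintegral (I : choiceType) (F : I -> set (set T))
    (s : seq I) (G : I -> T -> R[i]) :
  mutually_independent P F -> uniq s ->
  (forall i, i \in s -> cbounded_measurable (G i)) ->
  (forall i, i \in s -> forall A : set R, measurable A ->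
    F i ((cRe \o G i) @^-1` A) /\ F i ((cIm \o G i) @^-1` A)) ->
  Ec (fun x => \prod_(i <- s) G i x) = \prod_(i <- s) Ec (G i).
Proof.
move=> indF us bG FG.
suff: forall s1 s2 (g : I -> T -> R), uniq (s1 ++ s2) ->
  (forall i, i \in s1 -> cbounded_measurable (G i)) ->
  (forall i, i \in s1 -> forall A : set R, measurable A ->
    F i ((cRe \o G i) @^-1` A) /\ F i ((cIm \o G i) @^-1` A)) ->
  (forall i, i \in s2 -> bounded_measurable (g i)) ->
  (forall i, i \in s2 -> forall A : set R, measurable A -> F i (g i @^-1` A)) ->
  Ec (fun x => (\prod_(i <- s1) G i x) * (\prod_(i <- s2) g i x)%:C) =
  (\prod_(i <- s1) Ec (G i)) * (\prod_(i <- s2) \int[P]_x g i x)%:C.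
  move=> /(_ s [::] (fun=> fun=> 0)); rewrite cats0 => h.
  have := h us bG FG (fun i i0 => False_ind _ (notF i0)) (fun i i0 => False_ind _ (notF i0)).
  rewrite [X in _ = _ * X](_ : _ = 1); last by rewrite big_nil.
  rewrite mulr1 => <-; apply: eq_cintegral => x.
  by rewrite [X in _ = _ * X](_ : _ = 1) ?mulr1// big_nil.
elim => [|i s1 ih] s2 g /=.
  move=> us2 _ _ mg Fg; rewrite big_nil mul1r.
  under eq_cintegral do rewrite big_nil mul1r.
  by rewrite cintegral_real (mutually_independent_Rintegral indF).
move=> /andP[is1 us12] bG' FG' bg Fg.
have bG1 j : j \in s1 -> cbounded_measurable (G j).
  by move=> js; apply: bG'; rewrite in_cons js orbT.
have FG1 j : j \in s1 -> forall A : set R, measurable A ->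
    F j ((cRe \o G j) @^-1` A) /\ F j ((cIm \o G j) @^-1` A).
  by move=> js; apply: FG'; rewrite in_cons js orbT.
have bGi : cbounded_measurable (G i) by apply: bG'; rewrite mem_head.
have key (u : T -> R) : bounded_measurable u ->
   (forall A : set R, measurable A -> F i (u @^-1` A)) ->
   cbounded_measurable (fun x => (u x)%:C * ((\prod_(i <- s1) G i x) * (\prod_(i <- s2) g i x)%:C)) /\
   Ec (fun x => (u x)%:C * ((\prod_(i <- s1) G i x) * (\prod_(i <- s2) g i x)%:C)) =
   (\int[P]_x u x)%:C * ((\prod_(i <- s1) Ec (G i)) * (\prod_(i <- s2) \int[P]_x g i x)%:C).
  move=> bu Fu; split.
    apply: cbounded_measurableM; first exact: cbounded_measurable_real.
    apply: cbounded_measurableM; first exact: cbounded_measurable_prod.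
    by apply: cbounded_measurable_real; exact: bounded_measurable_prod.
  pose g' j := if j == i then u else g j.
  have g's2 j : j \in s2 -> g' j = g j.
    move=> js; rewrite /g'; case: eqP => // ji; move: is1.
    by rewrite mem_cat -ji js orbT.
  have g'i : g' i = u by rewrite /g' eqxx.
  have is2 x : \prod_(j <- s2) g' j x = \prod_(j <- s2) g j x.
    by apply: eq_big_seq => j js; rewrite g's2.
  have ps2 : \prod_(j <- s2) \int[P]_x g' j x = \prod_(j <- s2) \int[P]_x g j x.
    by apply: eq_big_seq => j js; rewrite g's2.
  have := ih (i :: s2) g'; rewrite big_cons g'i ps2 rmorphM mulrCA => <- //.
  - by apply: eq_cintegral => x; rewrite big_cons g'i is2 rmorphM mulrCA.
  - by rewrite uniq_catC /= mem_cat orbC -mem_cat is1/= uniq_catC.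
  - move=> j; rewrite in_cons => /orP[/eqP ->|js]; last by rewrite g's2//; exact: bg.
    by rewrite g'i.
  - move=> j; rewrite in_cons => /orP[/eqP ->|js]; last by rewrite g's2//; exact: Fg.
    by rewrite g'i.
have [b1 e1] := key _ bGi.1 (fun A mA => (FG' i (mem_head _ _) A mA).1).
have [b2 e2] := key _ bGi.2 (fun A mA => (FG' i (mem_head _ _) A mA).2).
have GE x : \prod_(i <- i :: s1) G i x * (\prod_(i <- s2) g i x)%:C =
  (cRe (G i x))%:C * ((\prod_(i <- s1) G i x) * (\prod_(i <- s2) g i x)%:C) +
  'i * ((cIm (G i x))%:C * ((\prod_(i <- s1) G i x) * (\prod_(i <- s2) g i x)%:C)).
  by rewrite big_cons -!mulrA [X in X * _]complexE mulrDl -mulrA.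
under eq_cintegral do rewrite GE.
rewrite cintegralD//; last first.
  by apply: cbounded_measurableM => //; exact: cbounded_measurable_cst.
have aux (a b q A B : R[i]) : a * (A * B) + q * (b * (A * B)) = (a + q * b) * A * B.
  by ring.
rewrite cintegralZ// e1 e2 big_cons [X in _ = X * _ * _]complexE aux.
by [].
Qed.

End Independence.

(** * The Fourier transform of the Gaussian density *)

Section DominatedConvergence.
Context {R : realType} d (T : measurableType d) (mu : {measure set T -> \bar R}).

Lemma cvg_Rintegral_dominated (D : set T) (f_ : nat -> T -> R) (f g : T -> R) :
  measurable D -> (forall n, measurable_fun D (f_ n)) ->
  (forall x, D x -> f_ ^~ x @ \oo --> f x) ->
  mu.-integrable D (EFin \o g) ->
  (forall n x, D x -> `|f_ n x| <= g x) ->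
  mu.-integrable D (EFin \o f) /\
  \int[mu]_(x in D) f_ n x @[n --> \oo] --> \int[mu]_(x in D) f x.
Proof.
move=> mD mf_ f_f ig f_g.
have mEf_ n : measurable_fun D (EFin \o f_ n) by exact/measurable_EFinP.
have cE : {ae mu, forall x, D x -> (EFin \o f_ n) x @[n --> \oo] --> (EFin \o f) x}.
  apply: aeW => x Dx; apply/fine_cvgP; split; first exact: nearW.
  exact: f_f.
have mEf : measurable_fun D (EFin \o f).
  apply: (@emeasurable_fun_cvg _ _ _ D (fun n => EFin \o f_ n)) => // x Dx.
  apply/fine_cvgP; split; first exact: nearW.
  exact: f_f.
have fg : {ae mu, forall x n, D x -> (`|(EFin \o f_ n) x| <= (EFin \o g) x)%E}.
  by apply: aeW => x n Dx; rewrite /= lee_fin; exact: f_g.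
have [intf _ cvf] := dominated_convergence mD mEf_ mEf cE ig fg.
split => //; apply: fine_cvg; rewrite fineK//.
exact: integrable_fin_num.
Qed.

End DominatedConvergence.

Section GaussianTransform.
Context {R : realType}.
Notation mu := (@lebesgue_measure R).
Implicit Types s t x : R.

Lemma cvg_Rintegral_itv (g : R -> R) : mu.-integrable [set: R] (EFin \o g) ->
  \int[mu]_(x in `[- n%:R, n%:R]) g x @[n --> \oo] --> \int[mu]_x g x.
Proof.
move=> ig.
have mg : measurable_fun [set: R] g by have /measurable_EFinP := measurable_int mu ig.
under eq_fun do rewrite Rintegral_mkcond.
apply: (@cvg_Rintegral_dominated _ _ _ mu setT
   (fun n => g \_ `[- n%:R, n%:R]) g (fun x => `|g x|) measurableT _ _ _ _).2.
- by move=> n; apply/(measurable_restrictT _ _).1 => //; exact: measurable_funTS.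
- move=> x _; apply/cvgrPdist_lt => e e0; near=> n.
  rewrite patchE mem_set ?subrr ?normr0//= in_itv/= -ler_norml.
  near: n; exact: nbhs_infty_ger.
- exact: integrable_norm.
- by move=> n x _; rewrite patchE; case: ifP => //; rewrite normr0.
Unshelve. all: end_near. Qed.

Lemma Rintegral_derive_eq0 (F f : R -> R) :
  continuous f -> (forall x, is_derive x (1 : R) F (f x)) ->
  mu.-integrable [set: R] (EFin \o f) ->
  F n%:R @[n --> \oo] --> (0 : R) -> F (- n%:R) @[n --> \oo] --> (0 : R) ->
  \int[mu]_x f x = 0.
Proof.
move=> cf dF intf F1 F2.
have h1 := cvg_Rintegral_itv intf.
have h2 : \int[mu]_(x in `[- n%:R, n%:R]) f x @[n --> \oo] --> (0 : R).
  rewrite -[X in _ --> X](subrr (0 : R)).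
  apply: cvg_trans (cvgB F1 F2); apply: near_eq_cvg; near=> n.
  rewrite (Rintegral_is_derive _ cf dF)//.
  by rewrite gtrN// ltr0n; near: n; exact: nbhs_infty_gt.
exact: (cvg_unique _ h1 h2).
Unshelve. all: end_near. Qed.

Lemma Rintegral_cst_itv (a b c : R) : a <= b ->
  \int[mu]_(y in `[a, b]) c = c * (b - a).
Proof.
move=> ab; rewrite /Rintegral integral_cst//.
rewrite [X in (_ * X)%E](_ : _ = (b - a)%:E) -?EFinM//.
rewrite [LHS]lebesgue_measure_itv /= lte_fin -EFinB.
by case: ltP => // ba; rewrite (@le_anti _ _ a b) ?subrr ?ab.
Qed.

Definition gaussian s x := expR (- (x ^+ 2 / (2 * s ^+ 2))).

Lemma gaussian_gt0 s x : 0 < gaussian s x. Proof. exact: expR_gt0. Qed.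

Lemma gaussian_le1 s x : gaussian s x <= 1.
Proof.
by rewrite /gaussian -[leRHS]expR0 ler_expR oppr_le0 divr_ge0 ?sqr_ge0// mulr_ge0 ?sqr_ge0.
Qed.

Lemma is_derive_gaussian s x : 0 < s ->
  is_derive x (1 : R) (gaussian s) (- (x / s ^+ 2) * gaussian s x).
Proof.
move=> s0; rewrite /gaussian.
by apply: is_derive_eq; rewrite /GRing.scale /=; field; rewrite gt_eqF.
Qed.

Lemma continuous_gaussian s : continuous (gaussian s).
Proof.
move=> x; apply: continuous_comp; last exact: continuous_expR.
apply: cvgN; apply: cvgM; last exact: cvg_cst.
exact: exprn_continuous.
Qed.

Lemma measurable_gaussian s : measurable_fun [set: R] (gaussian s).
Proof. by apply: continuous_measurable_fun; exact: continuous_gaussian. Qed.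

Lemma normal_pdf_gaussian m s x : 0 < s ->
  normal_pdf m s x = (s * Num.sqrt (2 * pi))^-1 * gaussian s (x - m).
Proof.
move=> s0; rewrite normal_pdfE ?gt_eqF// /normal_peak /normal_fun /gaussian.
congr (_^-1 * expR _); last by rewrite -mulr_natl mulNr.
rewrite -mulrnAr -mulr_natl sqrtrM ?sqr_ge0// sqrtr_sqr ger0_norm 1?ltW//.
Qed.

Lemma integrable_gaussian s : 0 < s -> mu.-integrable [set: R] (EFin \o gaussian s).
Proof.
move=> s0; have := integrableZl measurableT (s * Num.sqrt (2 * pi)) (integrable_normal_pdf 0 s).
apply: eq_integrable => // x _.
rewrite /= normal_pdf_gaussian// subr0 -EFinM mulVKf//.
by rewrite gt_eqF// mulr_gt0// sqrtr_gt0 mulr_gt0 ?pi_gt0.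
Qed.

Lemma Rintegral_gaussian s : 0 < s ->
  \int[mu]_x gaussian s x = s * Num.sqrt (2 * pi).
Proof.
move=> s0; have c0 : s * Num.sqrt (2 * pi) != 0.
  by rewrite gt_eqF// mulr_gt0// sqrtr_gt0 mulr_gt0 ?pi_gt0.
have : \int[mu]_x normal_pdf 0 s x = 1 by rewrite /Rintegral integral_normal_pdf.
under eq_Rintegral do rewrite normal_pdf_gaussian// subr0.
rewrite RintegralZl//; last exact: integrable_gaussian.
by move=> /(congr1 (fun z => s * Num.sqrt (2 * pi) * z)); rewrite mulVKf// mulr1.
Qed.

(** With q = x^2 / (4 s^2) the claim is `|x| * expR (- q) <= s; it follows from
    1 + q <= expR q, since s (1 + q) - `|x| = s (1 - `|x| / (2 s))^2. *)
Lemma normr_gaussian_le s x : 0 < s ->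
  `|x| * gaussian s x <= s * gaussian (Num.sqrt 2 * s) x.
Proof.
move=> s0; rewrite /gaussian exprMn sqr_sqrtr// [2 * (2 * _)]mulrA.
set q := x ^+ 2 / (2 * 2 * s ^+ 2).
have -> : - (x ^+ 2 / (2 * s ^+ 2)) = - q - q.
  by rewrite /q; field; rewrite gt_eqF.
rewrite expRD mulrCA [leRHS]mulrC ler_wpM2l ?expR_ge0//.
rewrite expRN ler_pdivrMr ?expR_gt0//.
apply: (@le_trans _ _ (s * (1 + q))); last by rewrite ler_wpM2l ?expR_ge1Dx// ltW.
have -> : s * (1 + q) = `|x| + s * (1 - `|x| / (2 * s)) ^+ 2.
  rewrite /q -[x ^+ 2]real_normK ?num_real//; field; exact: lt0r_neq0.
by rewrite lerDl mulr_ge0 ?sqr_ge0// ltW.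
Qed.

Lemma integrable_id_gaussian s : 0 < s ->
  mu.-integrable [set: R] (EFin \o (fun x => `|x| * gaussian s x)).
Proof.
move=> s0; have s2 : 0 < Num.sqrt 2 * s by rewrite mulr_gt0// sqrtr_gt0.
apply: (le_integrable measurableT _ _ (integrableZl measurableT s (integrable_gaussian s2))).
  apply/measurable_EFinP; apply: measurable_funM; last exact: measurable_gaussian.
  exact: normr_measurable.
move=> x _; rewrite /= lee_fin ger0_norm; last by rewrite mulr_ge0// ltW// gaussian_gt0.
by rewrite (le_trans (normr_gaussian_le _ s0))// ler_norm.
Qed.

Lemma integrable_gaussianM s (g : R -> R) (B : R) : 0 < s ->
  measurable_fun [set: R] g -> (forall x, `|g x| <= B) ->
  mu.-integrable [set: R] (EFin \o (fun x => g x * gaussian s x)).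
Proof.
move=> s0 mg gB.
apply: (le_integrable measurableT _ _ (integrableZl measurableT B (integrable_gaussian s0))).
  by apply/measurable_EFinP; apply: measurable_funM => //; exact: measurable_gaussian.
move=> x _; rewrite /= lee_fin !normrM ler_wpM2r//.
by rewrite (le_trans (gB x))// ler_norm.
Qed.

Lemma measurable_cosM t : measurable_fun [set: R] (fun x : R => cos (t * x)).
Proof.
apply: measurableT_comp; last exact: measurable_funM.
by apply: continuous_measurable_fun; exact: continuous_cos.
Qed.

Lemma measurable_sinM t : measurable_fun [set: R] (fun x : R => sin (t * x)).
Proof.
apply: measurableT_comp; last exact: measurable_funM.
by apply: continuous_measurable_fun; exact: continuous_sin.
Qed.

Lemma integrable_cos_gaussian s t : 0 < s ->
  mu.-integrable [set: R] (EFin \o (fun x => cos (t * x) * gaussian s x)).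
Proof.
move=> s0; apply: (@integrable_gaussianM _ _ 1) => //; first exact: measurable_cosM.
by move=> x; exact: cos_max.
Qed.

Lemma integrable_idsin_gaussian s t : 0 < s ->
  mu.-integrable [set: R] (EFin \o (fun x => - x * sin (t * x) * gaussian s x)).
Proof.
move=> s0; apply: (le_integrable measurableT _ _ (integrable_id_gaussian s0)).
  apply/measurable_EFinP; apply: measurable_funM; last exact: measurable_gaussian.
  apply: measurable_funM; last exact: measurable_sinM.
  exact: oppr_measurable.
move=> x _; rewrite /= lee_fin !normrM normrN normr_id ler_wpM2r//.
by rewrite ler_piMr// sin_max.
Qed.

Lemma is_derive_gaussian_transform s t : 0 < s ->
  is_derive t (1 : R) (fun t => \int[mu]_x (cos (t * x) * gaussian s x))
    (\int[mu]_x (- x * sin (t * x) * gaussian s x)).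
Proof.
move=> s0.
have d1 u x : is_derive u (1 : R) (fun t => cos (t * x) * gaussian s x)
    (- x * sin (u * x) * gaussian s x).
  by apply: is_derive_eq; rewrite /GRing.scale /=; ring.
have pE u x : partial1of2 (fun t x => cos (t * x) * gaussian s x) u x =
    - x * sin (u * x) * gaussian s x.
  by rewrite partial1of2E; have [_ ->] := d1 u x.
have tI : `]t - 1, t + 1[%classic t by rewrite /= in_itv/=; apply/andP; split; lra.
have H := @cvg_differentiation_under_integral R _ _ mu
  (fun t x => cos (t * x) * gaussian s x) setT measurableT t (t - 1) (t + 1) tI
  (fun u _ => integrable_cos_gaussian u s0)
  (fun u x _ _ => let: DeriveDef h _ := d1 u x in h)
  (fun x => `|x| * gaussian s x)
  (fun x => mulr_ge0 (normr_ge0 x) (ltW (gaussian_gt0 s x)))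
  (integrable_id_gaussian s0).
have {}H := H _.
have cH : h^-1 *: (\int[mu]_x (cos ((h + t) * x) * gaussian s x) - \int[mu]_x (cos (t * x) * gaussian s x))
    @[h --> (0 : R)^'] --> \int[mu]_x (- x * sin (t * x) * gaussian s x).
  under [X in _ --> X]eq_Rintegral do rewrite -pE.
  apply: H => u x _ _; rewrite pE !normrM normrN (gtr0_norm (gaussian_gt0 _ _)).
  by rewrite ler_pM2r ?gaussian_gt0// ler_piMr// sin_max.
split.
  apply/cvg_ex; eexists; under eq_fun do rewrite scaler1; exact: cH.
apply: cvg_lim => //; under eq_fun do rewrite scaler1; exact: cH.
Qed.

(** Integration by parts: the difference of the two integrands is the
    derivative of s^2 sin(t x) gaussian s x, which vanishes at infinity. *)
Lemma Rintegral_idsin_gaussian s t : 0 < s ->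
  \int[mu]_x (- x * sin (t * x) * gaussian s x) =
  - (s ^+ 2 * t) * \int[mu]_x (cos (t * x) * gaussian s x).
Proof.
move=> s0.
have cg := @continuous_gaussian s.
have cM : continuous (fun x : R => t * x).
  by move=> x; apply: cvgM; [exact: cvg_cst|exact: cvg_id].
pose F x := s ^+ 2 * sin (t * x) * gaussian s x.
pose f x := - x * sin (t * x) * gaussian s x + s ^+ 2 * t * (cos (t * x) * gaussian s x).
have dF x : is_derive x (1 : R) F (f x).
  have dg := is_derive_gaussian x s0.
  by apply: is_derive_eq; rewrite /f /GRing.scale /=; field; exact: lt0r_neq0.
have i1 := integrable_idsin_gaussian t s0.
have i2 := integrableZl measurableT (s ^+ 2 * t) (integrable_cos_gaussian t s0).
have intf : mu.-integrable [set: R] (EFin \o f) by exact: integrableD i1 i2.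
have cf : continuous f.
  have csin : continuous (fun x => sin (t * x)).
    by move=> x; apply: continuous_comp; [exact: cM|exact: continuous_sin].
  have ccos : continuous (fun x => cos (t * x)).
    by move=> x; apply: continuous_comp; [exact: cM|exact: continuous_cos].
  move=> x; apply: cvgD.
    apply: cvgM; last exact: cg.
    by apply: cvgM; [apply: cvgN; exact: cvg_id|exact: csin].
  apply: cvgM; first exact: cvg_cst.
  by apply: cvgM; [exact: ccos|exact: cg].
have Fbound x : `|F x| <= s ^+ 2 * gaussian s x.
  rewrite /F 2!normrM (ger0_norm (sqr_ge0 s)) (gtr0_norm (gaussian_gt0 _ _)).
  by rewrite ler_pM2r ?gaussian_gt0// ler_piMr ?sqr_ge0// sin_max.
have g0 : gaussian s n%:R @[n --> \oo] --> (0 : R).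
  have h : (n%:R * (2 * s ^+ 2)^-1 : R) @[n --> \oo] --> +oo.
    have h0 : r * (2 * s ^+ 2)^-1 @[r --> +oo] --> +oo.
      by apply: gt0_cvgMly; [rewrite invr_gt0 mulr_gt0 ?exprn_gt0|exact: cvg_id].
    exact: (cvg_comp _ _ (@cvgr_idn R) h0).
  have h2 : expR (- (n%:R * (2 * s ^+ 2)^-1 : R)) @[n --> \oo] --> (0 : R).
    exact: (cvg_comp _ _ h (@cvgr_expR R)).
  apply: (@squeeze_cvgr _ _ _ _ (cst 0) _ _ _ _ _ h2); last exact: cvg_cst.
  near=> n; rewrite ltW ?gaussian_gt0//= ler_expR lerN2 ler_wpM2r//.
    by rewrite invr_ge0 mulr_ge0 ?sqr_ge0.
  rewrite expr2 ler_peMl// ler1n; near: n; exact: nbhs_infty_gt.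
have F0 (v : nat -> R) : (forall n, gaussian s (v n) = gaussian s n%:R) ->
    F (v n) @[n --> \oo] --> (0 : R).
  move=> vE; apply/norm_cvg0P.
  apply: (@squeeze_cvgr _ _ _ _ (cst 0) (fun n => s ^+ 2 * gaussian s n%:R)).
  - by near=> n; rewrite normr_ge0/= -vE.
  - exact: cvg_cst.
  - by rewrite -[X in _ --> X](mulr0 (s ^+ 2)); apply: cvgM => //; exact: cvg_cst.
have := Rintegral_derive_eq0 cf dF intf.
rewrite /f RintegralD// RintegralZl//; last exact: integrable_cos_gaussian.
move=> h; apply/eqP; rewrite -subr_eq0 mulNr opprK; apply/eqP; apply: h.
- exact: F0.
- by apply: F0 => n; rewrite /gaussian sqrrN.
Unshelve. all: end_near. Qed.

(** The transform solves y' = - s^2 t y, by differentiation under the integral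
    sign and integration by parts. *)
Lemma gaussian_transform s t : 0 < s ->
  \int[mu]_x (cos (t * x) * gaussian s x) =
  s * Num.sqrt (2 * pi) * expR (- (s ^+ 2 * t ^+ 2 / 2)).
Proof.
move=> s0; pose J t := \int[mu]_x (cos (t * x) * gaussian s x).
pose G t := J t * expR (s ^+ 2 * t ^+ 2 / 2).
have dG u : is_derive u (1 : R) G 0.
  have dJ := is_derive_gaussian_transform u s0.
  rewrite Rintegral_idsin_gaussian// -/(J u) in dJ.
  rewrite /G; have dJ' : is_derive u (1 : R) J (- (s ^+ 2 * u) * J u) by exact: dJ.
  by apply: is_derive_eq; rewrite /GRing.scale /=; field.
have GE := is_derive_0_is_cst t 0 dG.
have G0 : G 0 = s * Num.sqrt (2 * pi).
  rewrite /G /J expr0n mulr0 mul0r expR0 mulr1 -Rintegral_gaussian//.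
  by apply: eq_Rintegral => x _; rewrite mul0r cos0 mul1r.
rewrite -G0 -GE /G expRN mulfK//.
by rewrite gt_eqF ?expR_gt0.
Qed.

End GaussianTransform.

Section InversionAndTightness.
Context {R : realType}.
Notation mu := (@lebesgue_measure R).
Implicit Types s t x y : R.

Lemma sqrt2pi_gt0 : 0 < Num.sqrt (2 * pi) :> R.
Proof. by rewrite sqrtr_gt0 mulr_gt0 ?pi_gt0. Qed.

(** The transform of a Gaussian of deviation 1/s is a multiple of a Gaussian of
    deviation s, so inversion is an instance of gaussian_transform. *)
Lemma normal_pdf_inversion s y : 0 < s ->
  normal_pdf 0 s y = (2 * pi)^-1 * \int[mu]_u (cos (u * y) * expR (- (s ^+ 2 * u ^+ 2 / 2))).
Proof.
move=> s0; have si0 : 0 < s^-1 by rewrite invr_gt0.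
have := gaussian_transform y si0.
have -> : (fun x => cos (y * x) * gaussian s^-1 x) =
    (fun u => cos (u * y) * expR (- (s ^+ 2 * u ^+ 2 / 2))).
  apply/funext => u; rewrite mulrC [y * u]mulrC mulrC /gaussian; congr (_ * expR (- _)).
  by field; rewrite gt_eqF.
move=> ->; rewrite normal_pdf_gaussian// subr0 /gaussian.
have -> : - (s^-1 ^+ 2 * y ^+ 2 / 2) = - (y ^+ 2 / (2 * s ^+ 2)) by field; rewrite gt_eqF.
rewrite [RHS]mulrA; congr (_ * _).
have h : Num.sqrt (2 * pi) ^+ 2 = 2 * pi :> R by rewrite sqr_sqrtr// mulr_ge0 ?pi_ge0.
have q0 := @sqrt2pi_gt0.
by set q := Num.sqrt _ in h q0 *; rewrite -h; field; rewrite !gt_eqF.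
Qed.

Lemma normal_pdf_peak s y : 0 < s -> normal_pdf 0 s y <= s^-1.
Proof.
move=> s0; rewrite normal_pdf_gaussian//.
have c1 : 1 <= Num.sqrt (2 * pi) :> R.
  rewrite -[leLHS]sqrtr1 ler_sqrt ?mulr_ge0 ?pi_ge0//.
  have := @pi_ge2 R; lra.
rewrite -[leRHS]mulr1 ler_pM ?invr_ge0 ?mulr_ge0 ?(ltW s0) ?sqrtr_ge0//.
- by rewrite ltW ?gaussian_gt0.
- by rewrite lef_pV2 ?posrE ?mulr_gt0 ?sqrt2pi_gt0// ler_peMr// ltW.
- exact: gaussian_le1.
Qed.

(** Only the factor s matters: it makes a concentrated Gaussian density small
    away from its mean, by expR (- a) <= a^-1. *)
Lemma normal_pdf_tail s e y m : 0 < s -> 0 < e -> e <= `|y - m| ->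
  normal_pdf m s y <= 2 * s / e ^+ 2.
Proof.
move=> s0 e0 ey; rewrite normal_pdf_gaussian//.
have c1 : 1 <= Num.sqrt (2 * pi) :> R.
  rewrite -[leLHS]sqrtr1 ler_sqrt ?mulr_ge0 ?pi_ge0//.
  have := @pi_ge2 R; lra.
have -> : 2 * s / e ^+ 2 = s^-1 * (2 * s ^+ 2 / e ^+ 2).
  by field; rewrite !gt_eqF.
apply: ler_pM; rewrite ?invr_ge0 ?mulr_ge0 ?(ltW s0) ?sqrtr_ge0//.
- by rewrite ltW ?gaussian_gt0.
- by rewrite lef_pV2 ?posrE ?mulr_gt0 ?sqrt2pi_gt0// ler_peMr// ltW.
rewrite /gaussian expRN -[leRHS]invrK lef_pV2 ?posrE ?expR_gt0//; last first.
  by rewrite invr_gt0 divr_gt0 ?mulr_gt0 ?exprn_gt0.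
rewrite invfM invrK mulrC.
apply: (@le_trans _ _ ((y - m) ^+ 2 / (2 * s ^+ 2))).
  rewrite ler_pM2r ?invr_gt0 ?mulr_gt0 ?exprn_gt0//.
  by rewrite -[leRHS]real_normK ?num_real// lerXn2r ?nnegrE ?normr_ge0// ltW.
by rewrite (le_trans _ (expR_ge1Dx _))// lerDr.
Qed.

End InversionAndTightness.

Section FubiniDominated.
Context {R : realType} d (T : measurableType d) (P : probability T R).
Notation mu := (@lebesgue_measure R).

(** A bound by an integrable function of the second variable alone suffices
    because P has mass 1. *)
Lemma fubini_dominated (K : T * R -> R) (g : R -> R) :
  measurable_fun [set: T * R] K -> mu.-integrable [set: R] (EFin \o g) ->
  (forall w y, `|K (w, y)| <= g y) ->
  [/\ bounded_measurable (fun w => \int[mu]_y K (w, y)),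
      mu.-integrable [set: R] (EFin \o (fun y => \int[P]_w K (w, y))) &
      \int[P]_w (\int[mu]_y K (w, y)) = \int[mu]_y (\int[P]_w K (w, y))].
Proof.
move=> mK ig Kg.
have mEK : measurable_fun [set: T * R] (EFin \o K) by exact/measurable_EFinP.
have g0 y : 0 <= g y by rewrite (le_trans _ (Kg point y))//.
have mKw w : measurable_fun [set: R] (fun y => K (w, y)).
  exact: measurableT_comp mK (measurable_pair1 w).
have iKw w : mu.-integrable [set: R] (fun y => (K (w, y))%:E).
  apply: (le_integrable measurableT _ _ ig); first by apply/measurable_EFinP; exact: (mKw w).
  by move=> y _; rewrite /= lee_fin (le_trans (Kg _ _))// ler_norm.
have bKy y : bounded_measurable (fun w => K (w, y)).
  split; first exact: measurableT_comp mK (measurable_pair2 y).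
  by exists (g y) => w; exact: Kg.
have iK : (P \x mu)%E.-integrable [set: T * R] (EFin \o K).
  apply/(integrable12ltyP P mu mEK).
  apply: (@le_lt_trans _ _ (\int[P]_w \int[mu]_y (g y)%:E)%E); last first.
    rewrite integral_cst//= probability_setT mule1.
    exact: integrable_lty ig.
  apply: ge0_le_integral => //.
  - by move=> w _; exact: integral_ge0.
  - have mA : measurable_fun [set: T * R] (abse \o (EFin \o K)).
      exact: measurableT_comp.
    have h := @measurable_fun_fubini_tonelli_F _ _ T _ R mu (abse \o (EFin \o K)) mA.
    by apply: h => z; rewrite /= lee_fin.
  - move=> w _; apply: ge0_le_integral => //.
    + by apply: measurableT_comp => //; apply/measurable_EFinP; exact: (mKw w).
    + exact: measurable_int ig.
    + by move=> y _; rewrite /= lee_fin Kg.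
have FE w : (\int[mu]_y K (w, y))%:E = (\int[mu]_y (K (w, y))%:E)%E.
  by rewrite /Rintegral fineK//; exact: integrable_fin_num (iKw w).
have GE y : (\int[P]_w K (w, y))%:E = (\int[P]_w (K (w, y))%:E)%E.
  rewrite /Rintegral fineK//; apply: integrable_fin_num => //.
  exact: bounded_measurable_integrable (bKy y).
split.
- split.
    apply/measurable_EFinP; rewrite (_ : EFin \o _ = fubini_F mu (EFin \o K)).
      exact: measurable_fubini_F iK.
    by apply/funext => w; rewrite /= FE.
  exists (\int[mu]_y g y) => w.
  have h := le_normr_Rintegral measurableT (iKw w); rewrite (le_trans h)//.
  apply: le_Rintegral => //.
  exact: integrable_norm (iKw w).
- have mG := measurable_fubini_G iK.
  apply: (le_integrable measurableT _ _ ig).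
    rewrite (_ : EFin \o _ = fubini_G P (EFin \o K)) //.
    by apply/funext => y; rewrite /= GE.
  move=> y _; rewrite /= lee_fin [leRHS]ger0_norm//.
  by apply: bint_norm_le_cst => // w; exact: Kg.
- have := Fubini iK => /(congr1 fine).
  rewrite {1}/Rintegral; under [X in _ -> fine X = _]eq_integral do rewrite FE.
  move=> ->; rewrite /Rintegral; congr fine; apply: eq_integral => y _.
  by rewrite -GE.
Qed.

End FubiniDominated.

(** * From characteristic functions to convergence in distribution *)

Section Arithmetic.
Context {R : realType}.
Implicit Types x y e p : R.

Let sub_le_swap x y e : x - y <= e -> x - e <= y. Proof. lra. Qed.

Lemma sub_le_of_dist x y e : `|x - y| <= e -> x - e <= y.
Proof. by rewrite ler_norml => /andP[_ /sub_le_swap]. Qed.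

Lemma dist_ge_sub x y e : e <= x - y -> e <= `|x - y|.
Proof. by move=> h; rewrite (le_trans h)// ler_norm. Qed.

Lemma dist_le_of_halves p q J1 J2 e : J1 - e / 2 <= p -> J2 - e / 2 <= 1 - p ->
  q - e / 2 <= J1 -> 1 - q - e / 2 <= J2 -> `|q - p| <= e.
Proof. by move=> *; rewrite ler_norml; apply/andP; split; lra. Qed.

Lemma sub_le_thirds x y z p e : x - e / 3 <= y -> y - e / 3 <= z ->
  z - e / 3 <= p -> x - e <= p.
Proof. lra. Qed.

End Arithmetic.

Section ContinuityTheorem.
Context {R : realType} d (T : measurableType d) (P : probability T R).
Notation mu := (@lebesgue_measure R).
Variables (V : nat -> T -> R) (s : R).
Hypothesis s0 : 0 < s.
Hypothesis mV : forall n, measurable_fun [set: T] (V n).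
Hypothesis cosV : forall u : R,
  \int[P]_w cos (u * V n w) @[n --> \oo] --> expR (- (s ^+ 2 * u ^+ 2 / 2)).
Hypothesis sinV : forall u : R, \int[P]_w sin (u * V n w) @[n --> \oo] --> (0 : R).

Let bcos n u : bounded_measurable (fun w => cos (u * V n w)).
Proof. by apply: bounded_measurable_cos; exact: measurable_funM. Qed.

Let bsin n u : bounded_measurable (fun w => sin (u * V n w)).
Proof. by apply: bounded_measurable_sin; exact: measurable_funM. Qed.

Lemma measurable_normal_pdf2 (e : R) (X : T -> R) : 0 < e ->
  measurable_fun [set: T] X ->
  measurable_fun [set: T * R] (fun z => normal_pdf (X z.1) e z.2).
Proof.
move=> e0 mX; under eq_fun do rewrite normal_pdf_gaussian//.
apply: measurable_funM => //.
apply: measurableT_comp; first exact: measurable_gaussian.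
by apply: measurable_funB => //; exact: measurableT_comp.
Qed.

(** By Fourier inversion the left-hand side is the integral over u of the
    characteristic function of V n against expR (- (e^2 u^2 / 2)), which
    dominates the integrand; hence pointwise convergence of the characteristic
    functions suffices. *)
Lemma cvg_smoothed_density (e y : R) : 0 < e ->
  \int[P]_w normal_pdf (V n w) e y @[n --> \oo] -->
  normal_pdf 0 (Num.sqrt (s ^+ 2 + e ^+ 2)) y.
Proof.
move=> e0; pose E u := expR (- (e ^+ 2 * u ^+ 2 / 2)) : R.
have E0 u : 0 < E u by exact: expR_gt0.
have EE : E = gaussian e^-1.
  by apply/funext => u; rewrite /E /gaussian; congr (expR (- _)); field; rewrite gt_eqF.
have iE : mu.-integrable [set: R] (EFin \o E).
  by rewrite EE; apply: integrable_gaussian; rewrite invr_gt0.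
have mE : measurable_fun [set: R] E by rewrite EE; exact: measurable_gaussian.
have s'0 : 0 < Num.sqrt (s ^+ 2 + e ^+ 2).
  by rewrite sqrtr_gt0 addr_gt0 ?exprn_gt0.
pose K n (z : T * R) := cos (z.2 * (y - V n z.1)) * E z.2.
have mK n : measurable_fun [set: T * R] (K n).
  apply: measurable_funM; last exact: measurableT_comp mE measurable_snd.
  apply: measurableT_comp.
    by apply: continuous_measurable_fun; exact: continuous_cos.
  apply: measurable_funM; first exact: measurable_snd.
  apply: measurable_funB => //; exact: measurableT_comp (mV n) measurable_fst.
have KE n w u : `|K n (w, u)| <= E u.
  by rewrite /K /= normrM (gtr0_norm (E0 u)); apply: ler_piMl; [exact: ltW|exact: cos_max].
have fub n := fubini_dominated P (mK n) iE (KE n).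
have pdfE n w : normal_pdf (V n w) e y = (2 * pi)^-1 * \int[mu]_u K n (w, u).
  rewrite -[LHS]/(normal_pdf _ _ _) normal_pdf_gaussian//.
  have := normal_pdf_inversion (y - V n w) e0.
  rewrite normal_pdf_gaussian// subr0 => ->.
  by [].
have -> : (fun n => \int[P]_w normal_pdf (V n w) e y) =
    (fun n => (2 * pi)^-1 * \int[mu]_u \int[P]_w K n (w, u)).
  apply/funext => n; have [bK _ <-] := fub n.
  by rewrite -bintZ//; apply: eq_Rintegral => w _; exact: pdfE.
rewrite normal_pdf_inversion//; apply: cvgM; first exact: cvg_cst.
have KP n u : \int[P]_w K n (w, u) =
   (cos (u * y) * \int[P]_w cos (u * V n w) + sin (u * y) * \int[P]_w sin (u * V n w)) * E u.
  transitivity (\int[P]_w (cos (u * y) * E u * cos (u * V n w) + sin (u * y) * E u * sin (u * V n w))).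
    by apply: eq_Rintegral => w _; rewrite /K mulrBr cosB; ring.
  rewrite bintD ?bintZ//; [by ring|..];
  by apply: bounded_measurableM => //; exact: bounded_measurable_cst.
apply: (@cvg_Rintegral_dominated _ _ _ mu setT
  (fun n u => \int[P]_w K n (w, u)) _ E measurableT _ _ iE _).2.
- by move=> n; have [_ i2 _] := fub n; have /measurable_EFinP := measurable_int mu i2.
- move=> u _; under eq_fun do rewrite KP.
  rewrite sqr_sqrtr ?addr_ge0 ?sqr_ge0//.
  have -> : expR (- ((s ^+ 2 + e ^+ 2) * u ^+ 2 / 2)) = expR (- (s ^+ 2 * u ^+ 2 / 2)) * E u.
    by rewrite -expRD; congr expR; ring.
  rewrite mulrA; apply: cvgM; last exact: cvg_cst.
  rewrite -[X in _ --> X]addr0; apply: cvgD.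
    by apply: cvgM; [exact: cvg_cst|exact: cosV].
  by rewrite -[X in _ --> X](mulr0 (sin (u * y))); apply: cvgM; [exact: cvg_cst|exact: sinV].
- move=> n u _; have bK : bounded_measurable (fun w => K n (w, u)).
    split; first exact: measurableT_comp (mK n) (measurable_pair2 u).
    by exists (E u) => w; exact: KE.
  by apply: bint_norm_le_cst.
Qed.

Let phi := normal_pdf 0 s.

Let phi_int : mu.-integrable [set: R] (EFin \o phi).
Proof. exact: integrable_normal_pdf. Qed.

Let phi_ge0 y : 0 <= phi y. Proof. exact: normal_pdf_ge0. Qed.

(** The inner integral is the probability that V n w, perturbed by an
    independent centred Gaussian variable of deviation e, falls into [a, b]. *)
Lemma cvg_smoothed_interval (e a b : R) : 0 < e ->
  [/\ (forall n, bounded_measurable (fun w => \int[mu]_(y in `[a, b]) normal_pdf (V n w) e y)) &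
  \int[P]_w (\int[mu]_(y in `[a, b]) normal_pdf (V n w) e y) @[n --> \oo] -->
  \int[mu]_(y in `[a, b]) normal_pdf 0 (Num.sqrt (s ^+ 2 + e ^+ 2)) y].
Proof.
move=> e0.
have icst (c : R) : mu.-integrable [set: R] (EFin \o (fun y => c * \1_(`[a, b]%classic : set R) y)).
  rewrite (_ : EFin \o _ = (fun y => c%:E * (\1_(`[a, b]%classic : set R) y)%:E)%E) //.
  by apply: integrableZl => //; exact: integrable_indic_itv.
pose K n (z : T * R) := normal_pdf (V n z.1) e z.2 * \1_(`[a, b]%classic : set R) z.2.
have mK n : measurable_fun [set: T * R] (K n).
  apply: measurable_funM; first exact: measurable_normal_pdf2.
  have mi : measurable_fun [set: R] (\1_(`[a, b]%classic : set R) : R -> R).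
    exact: measurable_indic.
  exact: measurableT_comp mi measurable_snd.
have pk m y : normal_pdf m e y <= e^-1.
  rewrite normal_pdf_gaussian//; have := normal_pdf_peak (y - m) e0.
  by rewrite normal_pdf_gaussian// subr0.
have KE n w y : `|K n (w, y)| <= e^-1 * \1_(`[a, b]%classic : set R) y.
  by rewrite normrM !ger0_norm ?normal_pdf_ge0// ler_wpM2r// pk.
have fub n := fubini_dominated P (mK n) (icst e^-1) (KE n).
have KI (f : R -> R) : \int[mu]_y (f y * \1_(`[a, b]%classic : set R) y) = \int[mu]_(y in `[a, b]) f y.
  rewrite [RHS]Rintegral_mkcond; apply: eq_Rintegral => y _.
  by rewrite indicE patchE; case: ifP => _; rewrite ?mulr1 ?mulr0.
split.
  move=> n; have [bK _ _] := fub n.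
  by under eq_fun do rewrite -KI.
have -> : (fun n => \int[P]_w (\int[mu]_(y in `[a, b]) normal_pdf (V n w) e y)) =
   (fun n => \int[mu]_y (\int[P]_w K n (w, y))).
  apply/funext => n; have [_ _ <-] := fub n.
  by apply: eq_Rintegral => w _; rewrite -KI.
rewrite -KI.
apply: (@cvg_Rintegral_dominated _ _ _ mu setT
  (fun n y => \int[P]_w K n (w, y)) _ (fun y => e^-1 * \1_(`[a, b]%classic : set R) y) measurableT _ _ (icst _) _).2.
- by move=> n; have [_ i2 _] := fub n; have /measurable_EFinP := measurable_int mu i2.
- move=> y _.
  have bp n : bounded_measurable (fun w => normal_pdf (V n w) e y).
    split; first exact: measurableT_comp (measurable_normal_pdf2 e0 (mV n)) (measurable_pair2 y).
    by exists e^-1 => w; rewrite ger0_norm ?normal_pdf_ge0.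
  have -> : (fun n => \int[P]_w K n (w, y)) = (fun n => \int[P]_w normal_pdf (V n w) e y * \1_(`[a, b]%classic : set R) y).
    by apply/funext => n; rewrite mulrC -bintZ//; apply: eq_Rintegral => w _; rewrite mulrC.
  by apply: cvgM; [exact: cvg_smoothed_density|exact: cvg_cst].
- move=> n y _; have bK : bounded_measurable (fun w => K n (w, y)).
    split; first exact: measurableT_comp (mK n) (measurable_pair2 y).
    by eexists => w; exact: KE.
  by apply: bint_norm_le_cst.
Qed.

(** When the eta-neighbourhood of [a, b] lies in A, a perturbation of V n by
    Gaussian noise of small deviation z can be in [a, b] only if V n is in A,
    up to a probability of order z. The perturbed probability converges by
    cvg_smoothed_interval, and the limit is close to that without noise because
    widening the deviation from s to s1 >= s multiplies the density by s / s1
    at least. *)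
Lemma liminf_normal_interval (A : set R) (a b eta e : R) : measurable A ->
  a <= b -> 0 < eta -> 0 < e ->
  (forall v y, ~ A v -> a <= y <= b -> eta <= `|y - v|) ->
  \forall n \near \oo,
    \int[mu]_(y in `[a, b]) phi y - e <= fine (P (V n @^-1` A)).
Proof.
move=> mA ab eta0 e0 sep.
pose c := 1 + (b - a) * 2 / eta ^+ 2 + s^-1.
have c0 : 0 < c.
  rewrite /c -addrA ltr_pwDl// addr_ge0 ?invr_ge0 ?(ltW s0)// divr_ge0 ?sqr_ge0// mulr_ge0// subr_ge0//.
pose z := e / (3 * c).
have z0 : 0 < z by rewrite divr_gt0 ?mulr_gt0.
have zc : z * c = e / 3 by rewrite /z; field; rewrite gt_eqF.
have z1 : (b - a) * (2 * z / eta ^+ 2) <= e / 3.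
  rewrite -zc (_ : _ * _ = z * ((b - a) * 2 / eta ^+ 2)); last by field; rewrite gt_eqF.
  by rewrite ler_pM2l// /c addrAC lerDr addr_ge0// invr_ge0 ltW.
have z2 : z / s <= e / 3.
  rewrite -zc ler_pM2l// /c lerDr addr_ge0// divr_ge0 ?sqr_ge0// mulr_ge0// subr_ge0//.
pose s' := Num.sqrt (s ^+ 2 + z ^+ 2).
have s'0 : 0 < s' by rewrite sqrtr_gt0 addr_gt0 ?exprn_gt0.
have s's : s <= s'.
  by rewrite -[leLHS](ger0_norm (ltW s0)) -sqrtr_sqr ler_sqrt ?addr_ge0 ?sqr_ge0// lerDl sqr_ge0.
have s'sz : s' <= s + z.
  have sz0 : 0 <= s + z by rewrite addr_ge0// ltW.
  rewrite -[leRHS](ger0_norm sz0) -sqrtr_sqr ler_sqrt ?sqr_ge0//.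
  by rewrite sqrrD lerD2r lerDl mulrn_wge0// mulr_ge0// ltW.
have [bG cG] := cvg_smoothed_interval a b z0; rewrite -/s' in cG.
have mI : measurable (`[a, b]%classic : set R) by [].
have phiI : mu.-integrable `[a, b] (EFin \o phi).
  by apply: (integrableS measurableT) => //; exact: phi_int.
have phiI1 : \int[mu]_(y in `[a, b]) phi y <= 1.
  have : \int[mu]_y phi y = 1 by rewrite /Rintegral integral_normal_pdf.
  move=> <-; rewrite Rintegral_mkcond; apply: le_Rintegral => //.
    by rewrite -restrict_EFin; apply/integrable_restrict => //; rewrite setTI.
  by move=> y _; rewrite patchE; case: ifP.
have phi0 : 0 <= \int[mu]_(y in `[a, b]) phi y by apply: Rintegral_ge0.
have low : \int[mu]_(y in `[a, b]) phi y - e / 3 <= \int[mu]_(y in `[a, b]) normal_pdf 0 s' y.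
  apply: (@le_trans _ _ ((s / s') * \int[mu]_(y in `[a, b]) phi y)).
    have : 1 - e / 3 <= s / s'.
      rewrite ler_pdivlMr//; apply: (@le_trans _ _ ((1 - z / s) * s')).
        by rewrite ler_pM2r// lerB.
      have [zs|zs] := leP 0 (1 - z / s); last first.
        by rewrite (@le_trans _ _ 0) ?(ltW s0)// nmulr_rle0// ltW.
      rewrite (le_trans (ler_wpM2l zs s'sz))//.
      have -> : (1 - z / s) * (s + z) = s - z ^+ 2 / s by field; rewrite gt_eqF.
      by rewrite lerBlDr lerDl divr_ge0 ?sqr_ge0// ltW.
    move=> h; have := ler_wpM2r phi0 h; rewrite mulrBl mul1r.
    have : e / 3 * \int[mu]_(y in `[a, b]) phi y <= e / 3.
      by rewrite ler_piMr// divr_ge0// ltW.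
    by move: (\int[mu]_(y in _) phi y) => I1; lra.
  have -> : s / s' * \int[mu]_(y in `[a, b]) phi y = \int[mu]_(y in `[a, b]) (s / s' * phi y).
    by rewrite RintegralZl.
  apply: (@le_Rintegral _ _ _ mu); first exact: mI.
  - have iZ : mu.-integrable `[a, b] (fun y => ((s / s')%:E * (EFin \o phi) y)%E).
      by apply: integrableZl => //; exact: phiI.
    exact: iZ.
  - by apply: (integrableS measurableT) => //; exact: integrable_normal_pdf.
  move=> y _; rewrite /phi !normal_pdf_gaussian// subr0.
  rewrite (_ : s / s' * _ = (s' * Num.sqrt (2 * pi))^-1 * gaussian s y); last first.
    by field; rewrite !gt_eqF// ?sqrt2pi_gt0.
  rewrite ler_wpM2l ?invr_ge0 ?mulr_ge0 ?(ltW s'0) ?sqrtr_ge0//.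
  rewrite /gaussian ler_expR lerN2 ler_wpM2l ?sqr_ge0//.
  rewrite lef_pV2 ?posrE ?mulr_gt0 ?exprn_gt0// ler_pM2l//.
  by rewrite lerXn2r// nnegrE ltW.
have GA n w : \int[mu]_(y in `[a, b]) normal_pdf (V n w) z y <= \1_A (V n w) + e / 3.
  have inn : mu.-integrable `[a, b] (EFin \o normal_pdf (V n w) z).
    by apply: (integrableS measurableT) => //; exact: integrable_normal_pdf.
  rewrite indicE; have [VA|VA] := boolP (V n w \in A).
    apply: (@le_trans _ _ 1); last by rewrite lerDl divr_ge0// ltW.
    have : \int[mu]_y normal_pdf (V n w) z y = 1 by rewrite /Rintegral integral_normal_pdf.
    move=> <-; rewrite Rintegral_mkcond; apply: le_Rintegral => //.
    - by rewrite -restrict_EFin; apply/integrable_restrict => //; rewrite setTI.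
    - exact: integrable_normal_pdf.
    - by move=> y _; rewrite patchE; case: ifP => //; rewrite normal_pdf_ge0.
  rewrite add0r; apply: le_trans z1.
  have -> : (b - a) * (2 * z / eta ^+ 2) = \int[mu]_(y in `[a, b]) (2 * z / eta ^+ 2).
    by rewrite Rintegral_cst_itv// mulrC.
  apply: le_Rintegral => //.
    apply: (@continuous_compact_integrable _ (cst _)); first exact: segment_compact.
    by apply: continuous_subspaceT => ?; exact: cvg_cst.
  move=> y; rewrite /= in_itv/= => yab; apply: normal_pdf_tail => //.
  by apply: sep => // /mem_set; rewrite (negbTE VA).
have Plow n : \int[P]_w (\int[mu]_(y in `[a, b]) normal_pdf (V n w) z y) - e / 3 <= fine (P (V n @^-1` A)).
  have mVA : measurable (V n @^-1` A) by rewrite -[X in measurable X]setTI; exact: mV.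
  rewrite lerBlDr -bint_indic// -[X in _ + X](bint_cst P) -bintD; last 2 first.
    exact: bounded_measurable_indic.
    exact: bounded_measurable_cst.
  apply: bint_le => //; apply: bounded_measurableD; last exact: bounded_measurable_cst.
  exact: bounded_measurable_indic.
have e30 : 0 < e / 3 by rewrite divr_gt0.
near=> n; have := Plow n; move: (fine _) => p hp.
have h : \int[mu]_(y in `[a, b]) normal_pdf 0 s' y - e / 3 <= \int[P]_w (\int[mu]_(y in `[a, b]) normal_pdf (V n w) z y).
  near: n; move/cvgrPdist_le : cG => /(_ _ e30); apply: filterS => n.
  exact: sub_le_of_dist.
exact: (sub_le_thirds low h).
Unshelve. all: end_near. Qed.

(** The half-line up to r and its complement both contain neighbourhoods of
    compact intervals that carry almost all their normal mass. The two lower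
    bounds of liminf_normal_interval therefore determine the limit. *)
Theorem levy_normal : cvg_in_distribution P V (normal_prob 0 s).
Proof.
split => // r _.
pose Phi := \int[mu]_(y in `]-oo, r]) phi y.
have PhiE : normal_prob 0 s `]-oo, r]%classic = Phi%:E.
  rewrite /Phi /Rintegral fineK// integrable_fin_num//.
  by apply: (integrableS measurableT) => //; exact: phi_int.
have PhiC : \int[mu]_(y in `]r, +oo[) phi y = 1 - Phi.
  have : \int[mu]_y phi y = 1 by rewrite /Rintegral integral_normal_pdf.
  rewrite -(itv_setU_setT false r) Rintegral_setU//.
  - by rewrite -/Phi => <-; rewrite addrAC subrr add0r.
  - by rewrite itv_setU_setT; exact: phi_int.
  - exact: disjoint_rays.
have cut (A : set R) (I : nat -> set R) : measurable A -> (forall k, measurable (I k)) ->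
   (forall y, A y -> \forall k \near \oo, I k y) -> (forall k, I k `<=` A) ->
   \int[mu]_(y in I k) phi y @[k --> \oo] --> \int[mu]_(y in A) phi y.
  move=> mA mI AI IA; rewrite [X in _ --> X]Rintegral_mkcond.
  under eq_fun do rewrite Rintegral_mkcond.
  apply: (@cvg_Rintegral_dominated _ _ _ mu setT _ _ phi measurableT _ _ phi_int _).2.
  - move=> k; apply/(measurable_restrictT _ _).1; first exact: mI.
    apply: measurable_funTS.
    exact: measurable_normal_pdf.
  - move=> y _; have [yA|yA] := boolP (y \in A).
      apply: cvg_near_cst; have := AI y (set_mem yA); apply: filterS => k ky.
      by rewrite !patchE yA mem_set.
    apply: cvg_near_cst; apply: nearW => k.
    rewrite !patchE (negbTE yA) memNset// => /IA /mem_set.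
    by rewrite (negbTE yA).
  - by move=> k y _; rewrite patchE; case: ifP => _; rewrite ?normr0// ger0_norm.
have c1 : \int[mu]_(y in `[- k%:R, r - k.+1%:R^-1]) phi y @[k --> \oo] --> Phi.
  rewrite /Phi -Rintegral_itv_bndo_bndc; last first.
    by apply: (integrableS measurableT) => //; exact: phi_int.
  apply: cut => //.
  - move=> y; rewrite /= in_itv/= => yr; have yr' : 0 < r - y by rewrite subr_gt0.
    near=> k; rewrite /= in_itv/=; apply/andP; split.
      rewrite lerNl; near: k; exact: nbhs_infty_ger.
    rewrite lerBrDr -lerBrDl ltW//; near: k; exact: (near_infty_natSinv_lt (PosNum yr')).
  - move=> k y; rewrite /= !in_itv/= => /andP[_ yr]; rewrite (le_lt_trans yr)//.
    by rewrite ltrBlDr ltrDl invr_gt0.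
have c2 : \int[mu]_(y in `[r + k.+1%:R^-1, k%:R]) phi y @[k --> \oo] --> 1 - Phi.
  rewrite -PhiC; apply: cut => //.
  - move=> y; rewrite /= in_itv/= andbT => yr; have yr' : 0 < y - r by rewrite subr_gt0.
    near=> k; rewrite /= in_itv/=; apply/andP; split.
      rewrite -lerBrDl ltW//; near: k; exact: (near_infty_natSinv_lt (PosNum yr')).
    near: k; exact: nbhs_infty_ger.
  - move=> k y; rewrite /= !in_itv/= andbT => /andP[yr _]; rewrite (lt_le_trans _ yr)//.
    by rewrite ltrDl invr_gt0.
rewrite [X in _ --> X](_ : _ = Phi%:E)//; apply/fine_cvgP; split.
  apply: nearW => n; apply: fin_num_measure.
  by rewrite -[X in measurable X]setTI; exact: mV.
apply/cvgrPdist_le => /= e e0; have e20 : 0 < e / 2 by rewrite divr_gt0.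
near \oo => k.
have k0 : (0 : R) < k.+1%:R^-1 by rewrite invr_gt0.
have h1 : Phi - e / 2 <= \int[mu]_(y in `[- k%:R, r - k.+1%:R^-1]) phi y.
  near: k; move/cvgrPdist_le : c1 => /(_ _ e20); apply: filterS => n.
  exact: sub_le_of_dist.
have h2 : 1 - Phi - e / 2 <= \int[mu]_(y in `[r + k.+1%:R^-1, k%:R]) phi y.
  near: k; move/cvgrPdist_le : c2 => /(_ _ e20); apply: filterS => n.
  exact: sub_le_of_dist.
have k1 : - k%:R <= r - k.+1%:R^-1.
  rewrite lerBrDr -lerBrDl opprK; apply: (@le_trans _ _ 1).
    by rewrite invf_le1 ?ler1n.
  rewrite -lerBlDl; near: k; exact: nbhs_infty_ger.
have k2 : r + k.+1%:R^-1 <= k%:R.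
  apply: (@le_trans _ _ (r + 1)); first by rewrite lerD2l invf_le1 ?ler1n.
  near: k; exact: nbhs_infty_ger.
have mVr n (A : set R) : measurable A -> measurable (V n @^-1` A).
  by move=> mA; rewrite -[X in measurable X]setTI; exact: mV.
have PC n : fine (P (V n @^-1` `]r, +oo[%classic)) = 1 - fine (P (V n @^-1` `]-oo, r]%classic)).
  have -> : V n @^-1` `]r, +oo[%classic = ~` (V n @^-1` `]-oo, r]%classic).
    apply/seteqP; split => w; rewrite /= !in_itv/= andbT ltNge; first by move=> /negP.
    by move=> /negP.
  by rewrite fine_probability_setC//; exact: mVr.
near=> n.
have g1 : \int[mu]_(y in `[- k%:R, r - k.+1%:R^-1]) phi y - e / 2 <= fine (P (V n @^-1` `]-oo, r]%classic)).
  near: n; apply: (@liminf_normal_interval _ _ _ (k.+1%:R^-1)) => //.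
  move=> v y; rewrite /= in_itv/= => /negP; rewrite -ltNge => rv /andP[_ yr].
  by rewrite distrC dist_ge_sub// lerBrDr addrC (le_trans _ (ltW rv))// -lerBrDr.
have g2 : \int[mu]_(y in `[r + k.+1%:R^-1, k%:R]) phi y - e / 2 <= fine (P (V n @^-1` `]r, +oo[%classic)).
  near: n; apply: (@liminf_normal_interval _ _ _ (k.+1%:R^-1)) => //.
  move=> v y; rewrite /= in_itv/= andbT => /negP; rewrite -leNgt => rv /andP[yr _].
  by rewrite dist_ge_sub// lerBrDl (le_trans _ yr)// lerD2r.
rewrite PC in g2; exact: (dist_le_of_halves g1 g2 h1 h2).
Unshelve. all: end_near. Qed.

End ContinuityTheorem.

(** * Independent identically distributed variables *)

Section ComplexModulus.
Context {R : realType}.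
Local Open Scope complex_scope.
Local Notation cRe := (@complex.Re R).
Local Notation cIm := (@complex.Im R).
Local Notation normc := (@Normc.normc R).

Lemma normcX (z : R[i]) n : normc (z ^+ n) = normc z ^+ n.
Proof.
by elim: n => [|n ih]; rewrite ?expr0 ?Normc.normc1// !exprS Normc.normcM ih.
Qed.

Lemma normc_sum (I : Type) (s : seq I) (F : I -> R[i]) :
  normc (\sum_(i <- s) F i) <= \sum_(i <- s) normc (F i).
Proof.
elim: s => [|i s ih]; first by rewrite !big_nil Normc.normc0.
by rewrite !big_cons (le_trans (le_normcD _ _))// lerD2l.
Qed.

Lemma normc_exprB_le (z w : R[i]) n : normc z <= 1 -> normc w <= 1 ->
  normc (z ^+ n - w ^+ n) <= n%:R * normc (z - w).
Proof.
move=> z1 w1; elim: n => [|n ih].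
  by rewrite !expr0 subrr Normc.normc0 mul0r.
have -> : z ^+ n.+1 - w ^+ n.+1 = z * (z ^+ n - w ^+ n) + (z - w) * w ^+ n.
  by rewrite !exprS; ring.
rewrite (le_trans (le_normcD _ _))// !Normc.normcM -natr1 mulrDl mul1r lerD//.
  by rewrite (le_trans _ ih)// ler_piMl// normc_ge0.
by rewrite ler_piMr ?normc_ge0// normcX exprn_ile1// normc_ge0.
Qed.

Context d (T : measurableType d) (P : probability T R).

Lemma normc_cintegral_le (F : T -> R[i]) (B : R) : cbounded_measurable F ->
  (forall x, normc (F x) <= B) -> normc (cintegral P [set: T] F) <= B.
Proof.
move=> bF FB; set w := cintegral _ _ _.
have B0 : 0 <= B by rewrite (le_trans _ (FB point))// normc_ge0.
have [w0|w0] := leP (normc w) 0; first by rewrite (le_trans w0).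
(* rotate so that the integral becomes its own modulus *)
pose c := (w^*)%C.
have nc : normc c = normc w by rewrite /c !normc_ReIm; case: (w) => a b /=; rewrite sqrrN.
have bcF : cbounded_measurable (fun x => c * F x).
  by apply: cbounded_measurableM => //; exact: cbounded_measurable_cst.
have : normc w ^+ 2 = \int[P]_x cRe (c * F x).
  have -> : \int[P]_x cRe (c * F x) = cRe (cintegral P [set: T] (fun x => c * F x)) by [].
  rewrite cintegralZ// -/w /c sqr_normcE cReM; case: (w) => a b /=; ring.
move=> e; have : normc w ^+ 2 <= normc w * B.
  rewrite e -[leRHS](bint_cst P); apply: bint_le; [exact: bcF.1|exact: bounded_measurable_cst|].
  move=> x; rewrite (le_trans (ler_norm _))// (le_trans (normr_Re_le _))//.
  by rewrite Normc.normcM nc ler_wpM2l// normc_ge0.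
by rewrite expr2 ler_pM2l.
Qed.

End ComplexModulus.

Section IID.
Context {R : realType} d (T : measurableType d) (P : probability T R).
Local Open Scope complex_scope.
Local Notation cRe := (@complex.Re R).
Local Notation cIm := (@complex.Im R).
Local Notation normc := (@Normc.normc R).
Local Notation Ec := (cintegral P [set: T]).
Variable X : nat -> T -> R.
Hypothesis mX : forall i, measurable_fun [set: T] (X i).
Hypothesis indX : independent_rvs P X.
Hypothesis idX : forall i (g : R -> R), bounded_measurable g ->
  \int[P]_w g (X i w) = \int[P]_w g (X 0 w).

Lemma sigma_rv_comp d' (T' : measurableType d') (Y : T -> T') (g : T' -> R) (A : set R) :
  measurable_fun [set: T'] g -> measurable A -> sigma_rv Y ((g \o Y) @^-1` A).
Proof.
move=> mg mA; exists (g @^-1` A); last by rewrite setTI.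
by rewrite -[X in measurable X]setTI; exact: mg.
Qed.

Let bX i (g : R -> R) : bounded_measurable g -> bounded_measurable (fun w => g (X i w)).
Proof. by move=> bg; exact: bounded_measurable_comp. Qed.

Lemma iid_Rintegral_prod (g : R -> R) n : bounded_measurable g ->
  \int[P]_w (\prod_(0 <= j < n) g (X j w)) = (\int[P]_w g (X 0 w)) ^+ n.
Proof.
move=> bg.
rewrite (mutually_independent_Rintegral (g := fun j w => g (X j w)) indX (iota_uniq _ _)).
- rewrite (eq_bigr (fun=> \int[P]_w g (X 0 w))); last by move=> i _; exact: idX.
  by rewrite prodr_const_nat subn0.
- by move=> i _; exact: bX.
- by move=> i _ A mA; apply: sigma_rv_comp => //; exact: bg.1.
Qed.

Lemma iid_cintegral_prod (g : R -> R[i]) n : cbounded_measurable g ->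
  Ec (fun w => \prod_(0 <= j < n) g (X j w)) = (Ec (fun w => g (X 0 w))) ^+ n.
Proof.
move=> [b1 b2].
rewrite (mutually_independent_cintegral (G := fun j w => g (X j w)) indX (iota_uniq _ _)).
- rewrite (eq_bigr (fun=> Ec (fun w => g (X 0 w)))).
    by rewrite prodr_const_nat subn0.
  by move=> i _; apply: complexP => /=; [exact: (idX _ b1)|exact: (idX _ b2)].
- by move=> i _; split; [exact: (bX i b1)|exact: (bX i b2)].
- move=> i _ A mA; split.
    by apply: (@sigma_rv_comp _ _ (X i) (fun x => cRe (g x))) => //; exact: b1.1.
  by apply: (@sigma_rv_comp _ _ (X i) (fun x => cIm (g x))) => //; exact: b2.1.
Qed.

Lemma iid_uncorrelated (a b : R -> R) i j : i != j ->
  bounded_measurable a -> bounded_measurable b ->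
  \int[P]_w (a (X i w) * b (X j w)) = (\int[P]_w a (X 0 w)) * \int[P]_w b (X 0 w).
Proof.
move=> ij ba bb.
pose g k w := if k == i then a (X k w) else b (X k w).
have gi : g i = fun w => a (X i w) by apply/funext => w; rewrite /g eqxx.
have gj : g j = fun w => b (X j w) by apply/funext => w; rewrite /g eq_sym (negbTE ij).
have := @mutually_independent_Rintegral _ _ _ P _ _ [:: i; j] g indX.
rewrite !big_cons !big_nil mulr1 gi gj (idX _ ba) (idX _ bb) => <-.
- by apply: eq_Rintegral => w _; rewrite !big_cons big_nil mulr1 gi gj.
- by rewrite /= inE ij.
- by move=> k; rewrite !inE => /orP[] /eqP ->; rewrite ?gi ?gj; exact: bX.
- move=> k; rewrite !inE => /orP[] /eqP -> A mA; rewrite ?gi ?gj.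
    by apply: sigma_rv_comp => //; exact: ba.1.
  by apply: sigma_rv_comp => //; exact: bb.1.
Qed.

Lemma iid_variance_sum (a : R -> R) n : bounded_measurable a ->
  \int[P]_w a (X 0 w) = 0 ->
  \int[P]_w (\sum_(0 <= j < n) a (X j w)) ^+ 2 = n%:R * \int[P]_w (a (X 0 w)) ^+ 2.
Proof.
move=> ba a0.
have bS m : bounded_measurable (fun w => \sum_(0 <= j < m) a (X j w)).
  by apply: bounded_measurable_sum => j; exact: bX.
have ba2 : bounded_measurable (fun x => a x ^+ 2).
  by under eq_fun do rewrite expr2; exact: bounded_measurableM.
elim: n => [|n ih].
  rewrite mul0r; under eq_Rintegral do rewrite big_nil expr0n.
  by rewrite bint_cst.
have -> : (fun w => (\sum_(0 <= j < n.+1) a (X j w)) ^+ 2) =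
  (fun w => (\sum_(0 <= j < n) a (X j w)) ^+ 2 +
     (2 * (\sum_(0 <= j < n) (a (X j w) * a (X n w))) + a (X n w) ^+ 2)).
  apply/funext => w; rewrite big_nat_recr//= -mulr_suml; ring.
have bp j : bounded_measurable (fun w => a (X j w) * a (X n w)).
  by apply: bounded_measurableM; exact: bX.
have bps : bounded_measurable (fun w => \sum_(0 <= j < n) (a (X j w) * a (X n w))).
  exact: bounded_measurable_sum.
have bps2 : bounded_measurable (fun w => 2 * \sum_(0 <= j < n) (a (X j w) * a (X n w))).
  by apply: bounded_measurableM => //; exact: bounded_measurable_cst.
have bSS : bounded_measurable (fun w => (\sum_(0 <= j < n) a (X j w)) ^+ 2).
  by under eq_fun do rewrite expr2; exact: bounded_measurableM.
rewrite bintD ?bintD ?bintZ ?ih ?bint_sum//; [|exact: (bX n ba2)|apply: bounded_measurableD => //; exact: (bX n ba2)].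
rewrite big_nat big1 ?mulr0 ?add0r; last first.
  move=> j /andP[_ jn]; rewrite iid_uncorrelated ?a0 ?mul0r//.
  by rewrite neq_ltn jn.
by rewrite (idX n ba2) -natr1 mulrDl mul1r.
Qed.

(** Only the second moments of the summands survive in the limit. The
    characteristic function of the sum is an n-th power; since n-th powers of
    two points of the unit disc are at most n times as far apart as the points,
    it may be compared with the n-th power of a Gaussian factor whose logarithm
    has the same second-order term. As the bound B is uniform in n, Taylor
    errors of orders 3 and 4 multiplied by n tend to 0. *)
Theorem iid_array_cf (phi : nat -> R -> R) (B s : R) (u : R) :
  (forall n, measurable_fun [set: R] (phi n)) ->
  (forall n x, `|phi n x| <= B) ->
  (forall n, \int[P]_w phi n (X 0 w) = 0) ->
  \int[P]_w (phi n (X 0 w)) ^+ 2 @[n --> \oo] --> s ^+ 2 ->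
  \int[P]_w cos (u * ((Num.sqrt n%:R)^-1 * \sum_(0 <= j < n) phi n (X j w))) @[n --> \oo]
     --> expR (- (s ^+ 2 * u ^+ 2 / 2)) /\
  \int[P]_w sin (u * ((Num.sqrt n%:R)^-1 * \sum_(0 <= j < n) phi n (X j w))) @[n --> \oo]
     --> (0 : R).
Proof.
move=> mphi phiB phi0 phi2.
have bphi n : bounded_measurable (phi n) by split; [exact: mphi|exists B].
have bphi2 n : bounded_measurable (fun x => phi n x ^+ 2).
  by under eq_fun do rewrite expr2; exact: bounded_measurableM.
have B0 : 0 <= B by rewrite (le_trans _ (phiB 0%N 0)).
pose v n := \int[P]_w (phi n (X 0 w)) ^+ 2.
have v0 n : 0 <= v n by apply: Rintegral_ge0 => w _; exact: sqr_ge0.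
have vB n : v n <= B ^+ 2.
  rewrite -[leRHS](bint_cst P); apply: bint_le; [exact: (bX 0%N (bphi2 n))|exact: bounded_measurable_cst|].
  move=> w; rewrite -[leLHS]real_normK ?num_real// lerXn2r ?nnegrE//.
pose c n : R := u / Num.sqrt n%:R.
pose z n := Ec (fun w => cexpi (c n * phi n (X 0 w))).
pose V n w := u * ((Num.sqrt n%:R)^-1 * \sum_(0 <= j < n) phi n (X j w)).
have VE n w : cexpi (V n w) = \prod_(0 <= j < n) cexpi (c n * phi n (X j w)).
  by rewrite /V mulrA mulr_sumr cexpi_sum.
have mc n : measurable_fun [set: R] (fun x => c n * phi n x) by exact: measurable_funM.
have bg n : cbounded_measurable (fun x : R => cexpi (c n * phi n x)).
  exact: cbounded_measurable_cexpi.
have zE n : Ec (fun w => cexpi (V n w)) = z n ^+ n.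
  under eq_cintegral do rewrite VE.
  exact: (iid_cintegral_prod n (bg n)).
pose x n : R := c n ^+ 2 * v n / 2.
pose w n : R := expR (- x n).
have x0 n : 0 <= x n by rewrite /x divr_ge0// mulr_ge0 ?sqr_ge0.
have z1 n : normc (z n) <= 1.
  apply: normc_cintegral_le => [|t]; last by rewrite normc_cexpi.
  by apply: cbounded_measurable_cexpi; apply: measurableT_comp (mc n) (mX 0%N).
have w1 n : normc (w n)%:C <= 1.
  by rewrite normc_real gtr0_norm ?expR_gt0// -[leRHS]expR0 ler_expR oppr_le0.
have Rez n : cRe (z n) = \int[P]_w cos (c n * phi n (X 0 w)).
  by apply: eq_Rintegral => t _; rewrite Re_cexpi.
have ReB n : `|cRe (z n) - w n| <= c n ^+ 4 * B ^+ 4 * 2.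
  have -> : cRe (z n) - w n = (cRe (z n) - 1 + x n) - (w n - 1 + x n) by ring.
  have e1 : `|cRe (z n) - 1 + x n| <= c n ^+ 4 * B ^+ 4.
    have bc : bounded_measurable (fun w => cos (c n * phi n (X 0 w))).
      by apply: bounded_measurable_cos; apply: measurableT_comp (mc n) (mX 0%N).
    have -> : cRe (z n) - 1 + x n = \int[P]_w (cos (c n * phi n (X 0 w)) - 1 + (c n * phi n (X 0 w)) ^+ 2 / 2).
      have -> : (fun w => cos (c n * phi n (X 0 w)) - 1 + (c n * phi n (X 0 w)) ^+ 2 / 2) =
        (fun w => cos (c n * phi n (X 0 w)) - 1 + c n ^+ 2 / 2 * phi n (X 0 w) ^+ 2).
        by apply/funext => t; congr (_ + _); field.
      rewrite bintD ?bintB ?bintZ ?bint_cst//.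
      - by rewrite Rez /x /v; field.
      - exact: (bX _ (bphi2 n)).
      - exact: bounded_measurable_cst.
      - by apply: bounded_measurableB => //; exact: bounded_measurable_cst.
      - apply: bounded_measurableM; first exact: bounded_measurable_cst.
        exact: (bX _ (bphi2 n)).
    apply: bint_norm_le_cst.
      apply: bounded_measurableD; first by apply: bounded_measurableB => //; exact: bounded_measurable_cst.
      apply: bounded_measurableM; last exact: bounded_measurable_cst.
      under eq_fun do rewrite exprMn; apply: bounded_measurableM; first exact: bounded_measurable_cst.
      exact: (bX _ (bphi2 n)).
    move=> t; rewrite (le_trans (normr_cos_taylor_le _))// exprMn ler_wpM2l ?exprn_even_ge0//.
    rewrite -[leLHS]ger0_norm ?exprn_even_ge0// normrX lerXn2r ?nnegrE//.
  have e2 : `|w n - 1 + x n| <= c n ^+ 4 * B ^+ 4.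
    have h1 : 1 - x n <= w n by rewrite /w; exact: expR_ge1Dx.
    have h2 : w n <= 1 - x n + 2 * x n ^+ 2.
      have := @expR_le_quadratic R (- x n); rewrite sqrrN; apply.
      by rewrite (@le_trans _ _ 0)// oppr_le0.
    have h3 : 2 * x n ^+ 2 <= c n ^+ 4 * B ^+ 4.
      have -> : 2 * x n ^+ 2 = c n ^+ 4 * (v n ^+ 2 / 2) by rewrite /x; field.
      rewrite ler_wpM2l ?exprn_even_ge0// ler_pdivrMr// (@le_trans _ _ (B ^+ 4))//.
        by rewrite (_ : B ^+ 4 = (B ^+ 2) ^+ 2) ?lerXn2r ?nnegrE ?sqr_ge0// -exprM.
      by rewrite ler_peMr ?exprn_ge0// ler1n.
    rewrite ger0_norm; [lra|lra].
  rewrite (le_trans (ler_normB _ _))//; lra.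
have ImB n : `|cIm (z n)| <= `|c n| ^+ 3 * B ^+ 3.
  have -> : cIm (z n) = \int[P]_w (sin (c n * phi n (X 0 w)) - c n * phi n (X 0 w)).
    rewrite bintB ?bintZ ?phi0 ?mulr0 ?subr0; [|exact: (bX _ (bphi n))|..].
    - by apply: eq_Rintegral => t _; rewrite Im_cexpi.
    - by apply: bounded_measurable_sin; apply: measurableT_comp (mc n) (mX 0%N).
    - by apply: bounded_measurableM; [exact: bounded_measurable_cst|exact: (bX _ (bphi n))].
  apply: bint_norm_le_cst.
    apply: bounded_measurableB.
      by apply: bounded_measurable_sin; apply: measurableT_comp (mc n) (mX 0%N).
    by apply: bounded_measurableM; [exact: bounded_measurable_cst|exact: (bX _ (bphi n))].
  move=> t; rewrite (le_trans (normr_sin_sub_le _))// normrM exprMn ler_wpM2l ?exprn_ge0//.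
  by rewrite lerXn2r ?nnegrE.
pose r n : R := `|u| ^+ 3 * B ^+ 3 * (Num.sqrt n%:R)^-1 + 2 * u ^+ 4 * B ^+ 4 * n%:R^-1.
have key n : (0 < n)%N -> normc (z n ^+ n - ((w n) ^+ n)%:C) <= r n.
  move=> n0; have n0' : (0 : R) < n%:R by rewrite ltr0n.
  rewrite rmorphXn (le_trans (normc_exprB_le n (z1 n) (w1 n)))//.
  have sn : Num.sqrt n%:R ^+ 2 = n%:R :> R by rewrite sqr_sqrtr// ler0n.
  have s0 : 0 < Num.sqrt n%:R :> R by rewrite sqrtr_gt0.
  have : normc (z n - (w n)%:C) <= c n ^+ 4 * B ^+ 4 * 2 + `|c n| ^+ 3 * B ^+ 3.
    rewrite (le_trans (normc_le_ReIm _))// cReD cReN cImD cImN /= subr0.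
    exact: lerD (ReB n) (ImB n).
  move=> /(ler_wpM2l (ltW n0')) h; rewrite (le_trans h)//.
  rewrite /r /c normrM normfV (gtr0_norm s0).
  move: (Num.sqrt n%:R) sn s0 => q <- q0; rewrite le_eqVlt; apply/orP; left; apply/eqP.
  by field; rewrite gt_eqF.
have sinv0 : (Num.sqrt n%:R)^-1 @[n --> \oo] --> (0 : R).
  have ps : {near \oo, forall n, 0 < Num.sqrt n%:R :> R}.
    by near=> n; rewrite sqrtr_gt0 ltr0n; near: n; exact: nbhs_infty_gt.
  apply/(gtr0_cvgV0 ps)/cvgryPge => A; near=> n.
  have [A0|A0] := leP A 0; first by rewrite (le_trans A0)// sqrtr_ge0.
  rewrite -[A]ger0_norm ?(ltW A0)// -sqrtr_sqr ler_wsqrtr//.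
  by near: n; exact: nbhs_infty_ger.
have inv0 : n%:R^-1 @[n --> \oo] --> (0 : R).
  have ps : {near \oo, forall n, 0 < n%:R :> R}.
    by near=> n; rewrite ltr0n; near: n; exact: nbhs_infty_gt.
  by apply/(gtr0_cvgV0 ps); exact: cvgr_idn.
have r0 : r n @[n --> \oo] --> (0 : R).
  have z3 : `|u| ^+ 3 * B ^+ 3 * 0 + 2 * u ^+ 4 * B ^+ 4 * 0 = 0 by rewrite !mulr0 addr0.
  by rewrite -z3; apply: cvgD; apply: cvgM => //; exact: cvg_cst.
have wn : (w n) ^+ n @[n --> \oo] --> expR (- (s ^+ 2 * u ^+ 2 / 2)).
  have : expR (- (v n * u ^+ 2 / 2)) @[n --> \oo] --> expR (- (s ^+ 2 * u ^+ 2 / 2)).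
    apply: continuous_cvg; first exact: continuous_expR.
    by apply: cvgN; apply: cvgM; [apply: cvgM => //; exact: cvg_cst|exact: cvg_cst].
  apply: cvg_trans; apply: near_eq_cvg; near=> n.
  have n0 : (0 : R) < n%:R by rewrite ltr0n; near: n; exact: nbhs_infty_gt.
  rewrite /w -expRM_natl; congr expR; rewrite /x /c.
  have sn : Num.sqrt n%:R ^+ 2 = n%:R :> R by rewrite sqr_sqrtr// ltW.
  by rewrite exprMn exprVn sn; field; rewrite gt_eqF.
have cvg_of (f : nat -> R) (l : nat -> R) (L : R) : (forall n, (0 < n)%N -> `|f n - l n| <= r n) ->
    l n @[n --> \oo] --> L -> f n @[n --> \oo] --> L.
  move=> fl lL; have -> : f = (fun n => (f n - l n) + l n).
    by apply/funext => n; rewrite subrK.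
  rewrite -[X in _ --> X]add0r; apply: cvgD => //.
  apply/norm_cvg0P; apply: (@squeeze_cvgr _ _ _ _ (cst 0) r) => //; last exact: cvg_cst.
  by near=> n; rewrite normr_ge0 fl//; near: n; exact: nbhs_infty_gt.
split.
  apply: (cvg_of _ (fun n => w n ^+ n)) => // n n0; rewrite (le_trans _ (key n n0))//.
  rewrite (le_trans _ (normr_Re_le _))// cReD cReN -zE /=.
  by under [X in _ <= `|X - _|]eq_Rintegral do rewrite expR0 mul1r.
apply: (cvg_of _ (fun=> 0)); last exact: cvg_cst.
move=> n n0; rewrite (le_trans _ (key n n0))//.
rewrite (le_trans _ (normr_Im_le _))// cImD cImN -zE /=.
by under [X in _ <= `|X - _|]eq_Rintegral do rewrite expR0 mul1r.
Unshelve. all: end_near. Qed.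

End IID.

(** * Distinguished logarithms *)

Section ComplexContinuity.
Context {R : realType}.
Local Open Scope complex_scope.
Local Notation cRe := (@complex.Re R).
Local Notation cIm := (@complex.Im R).
Local Notation normc := (@Normc.normc R).

Lemma normr_complex (z : R[i]) : `|z| = (normc z)%:C.
Proof. by case: z. Qed.

Lemma continuous_lipschitz1 (g : R[i] -> R) :
  (forall z w, `|g z - g w| <= normc (z - w)) -> continuous (g : R[i]^o -> R).
Proof.
move=> lg z; have FF : Filter (nbhs (z : R[i]^o)) by exact: nbhs_filter.
apply/cvgrPdist_lt => e e0.
have e0' : 0 < e%:C :> R[i] by rewrite ltcR.
have := @cvg_id _ (nbhs (z : R[i]^o)); move/cvgrPdist_lt => /(_ _ e0').
apply: filterS => w; rewrite normr_complex ltcR => /(le_lt_trans _); apply.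
exact: lg.
Qed.

Lemma continuous_Re : continuous (cRe : R[i]^o -> R).
Proof.
apply: continuous_lipschitz1 => z w.
by rewrite -cReN -cReD normr_Re_le.
Qed.

Lemma continuous_Im : continuous (cIm : R[i]^o -> R).
Proof.
apply: continuous_lipschitz1 => z w.
by rewrite -cImN -cImD normr_Im_le.
Qed.

Lemma cvg_complex (S : Type) (F : set_system S) (FF : Filter F) (g : S -> R[i]) (l : R[i]) :
  (cRe (g x) @[x --> F] --> cRe l) -> (cIm (g x) @[x --> F] --> cIm l) ->
  (g : S -> R[i]^o) x @[x --> F] --> (l : R[i]^o).
Proof.
move=> /cvgrPdist_lt ga /cvgrPdist_lt gb; apply/cvgrPdist_lt => e e0.
have eE : e = (cRe e)%:C by move: e0; rewrite ltcE /= => /andP[/eqP h _]; apply: complexP.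
have e2 : 0 < cRe e / 2 by move: e0; rewrite eE ltcR => ?; rewrite divr_gt0.
near=> x; rewrite normr_complex eE ltcR (le_lt_trans (normc_le_ReIm _))//.
rewrite cReD cReN cImD cImN [ltRHS]splitr ltrD//; near: x; [exact: ga|exact: gb].
Unshelve. all: end_near. Qed.

Lemma continuous_complexP (S : topologicalType) (g : S -> R[i]) :
  continuous (g : S -> R[i]^o) <->
  continuous (fun x => cRe (g x)) /\ continuous (fun x => cIm (g x)).
Proof.
split=> [cg|[ca cb] x]; last by apply: cvg_complex; [exact: ca|exact: cb].
split=> x.
  exact: (continuous_comp (cg x) (@continuous_Re _)).
exact: (continuous_comp (cg x) (@continuous_Im _)).
Qed.

Lemma within_continuous_complexP (D : set R) (g : R -> R[i]) :
  {within D, continuous (g : R -> R[i]^o)} <->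
  {within D, continuous (fun x => cRe (g x))} /\ {within D, continuous (fun x => cIm (g x))}.
Proof. exact: (@continuous_complexP (subspace D)). Qed.

Lemma cvg_Re (S : Type) (F : set_system S) (FF : Filter F) (g : S -> R[i]) (l : R[i]) :
  ((g : S -> R[i]^o) x @[x --> F] --> (l : R[i]^o)) -> cRe (g x) @[x --> F] --> cRe l.
Proof. by move=> gl; apply: (cvg_comp _ _ gl); exact: continuous_Re. Qed.

Lemma cvg_Im (S : Type) (F : set_system S) (FF : Filter F) (g : S -> R[i]) (l : R[i]) :
  ((g : S -> R[i]^o) x @[x --> F] --> (l : R[i]^o)) -> cIm (g x) @[x --> F] --> cIm l.
Proof. by move=> gl; apply: (cvg_comp _ _ gl); exact: continuous_Im. Qed.

Lemma cvg_clog (S : Type) (F : set_system S) (FF : Filter F) (z : S -> R[i]) (l : R[i]) :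
  0 < cRe l -> ((z : S -> R[i]^o) x @[x --> F] --> (l : R[i]^o)) ->
  ((fun x => clog (z x)) : S -> R[i]^o) x @[x --> F] --> (clog l : R[i]^o).
Proof.
move=> l0 zl; have za := cvg_Re FF zl; have zb := cvg_Im FF zl.
apply: cvg_complex => /=.
  have -> : (fun x => ln (normc (z x))) = (fun x => ln (Num.sqrt (cRe (z x) ^+ 2 + cIm (z x) ^+ 2))).
    by apply/funext => y; rewrite normc_ReIm.
  rewrite normc_ReIm.
  have p0 : 0 < cRe l ^+ 2 + cIm l ^+ 2 by rewrite ltr_pwDl ?sqr_ge0// exprn_gt0.
  apply: continuous_cvg; first by apply: continuous_ln; rewrite sqrtr_gt0.
  apply: continuous_cvg; first exact: sqrt_continuous.
  by apply: cvgD; rewrite [X in _ --> X]expr2; under eq_fun do rewrite expr2; apply: cvgM.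
apply: continuous_cvg; first exact: continuous_atan.
by apply: cvgM => //; apply: cvgV => //; rewrite gt_eqF.
Qed.

Lemma Re_gt0_of_near1 (z : R[i]) : normc z <= 2^-1 -> 0 < cRe (1 + z).
Proof.
move=> z2; rewrite cReD /=.
have := le_trans (normr_Re_le z) z2; rewrite ler_norml => /andP[h _].
by rewrite -ltrBlDl sub0r (lt_le_trans _ h)// ltrN2 invf_lt1// ltr1n.
Qed.

End ComplexContinuity.

Section DistinguishedLog.
Context {R : realType}.
Local Open Scope complex_scope.
Local Notation cRe := (@complex.Re R).
Local Notation cIm := (@complex.Im R).
Local Notation normc := (@Normc.normc R).

(** A continuous function with values in the discrete set of periods of the
    exponential is constant on an interval. *)
Lemma cexp_eq1_segment (D : R -> R[i]) (r : R) : 0 <= r ->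
  {within `[- r, r], continuous (D : R -> R[i]^o)} ->
  (forall t, t \in `[- r, r] -> cexp (D t) = 1) -> D 0 = 0 ->
  forall t, t \in `[- r, r] -> D t = 0.
Proof.
move=> r0 /within_continuous_complexP[_ cI] D1 D0 t tr.
have Rez : cRe (D t) = 0.
  have := normc_cexp (D t); rewrite D1// Normc.normc1 -[LHS]expR0.
  by move/expR_inj.
apply: complexP => //=.
have cos1 s : s \in `[- r, r] -> cos (cIm (D s)) = 1.
  move=> sr; have Res : cRe (D s) = 0.
    have := normc_cexp (D s); rewrite D1// Normc.normc1 -[LHS]expR0.
    by move/expR_inj.
  by have := D1 s sr => /(congr1 cRe); rewrite /= Res expR0 mul1r.
(* otherwise the imaginary part would take some value in ]0, 1] *)
apply: contrapT => It0.
pose v := Num.min `|cIm (D t)| 1.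
have v0 : 0 < v by rewrite lt_min ltr01 normr_gt0 andbT; apply/eqP.
have v1 : v <= 1 by rewrite ge_min lexx orbT.
suff [s sr sv] : exists2 s, s \in `[- r, r] & `|cIm (D s)| = v.
  have := cos1 s sr; rewrite -cos_norm sv -[X in _ = X]cos0 => h.
  have pi1 : 1 <= pi :> R by rewrite (le_trans _ (pi_ge2 _))// ler1n.
  have : v = 0 by apply: cos_inj => //; rewrite in_itv/= ?lexx ?pi_ge0// (ltW v0) (le_trans v1).
  by move=> ve; move: v0; rewrite ve ltxx.
have cN : {within `[- r, r], continuous (fun s => `|cIm (D s)|)}.
  by move=> s; apply: cvg_norm; exact: cI.
have z0 : 0 \in `[- r, r] by rewrite in_itv/= r0 oppr_le0 r0.
have vt : v <= `|cIm (D t)| by rewrite ge_min lexx.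
move: tr; rewrite in_itv/= => /andP[tr1 tr2].
have [t0|t0] := leP 0 t.
  have cN' : {within `[0, t], continuous (fun s => `|cIm (D s)|)}.
    apply: continuous_subspaceW cN; apply: subset_itv; rewrite bnd_simp//.
    by rewrite oppr_le0.
  have [|s st sE] := IVT t0 cN' (v := v).
    by rewrite D0/= normr0 (min_idPl _) ?(ltW v0)// (max_idPr _) ?vt// normr_ge0.
  exists s => //; move: st; rewrite !in_itv/= => /andP[s1 s2].
  by rewrite (le_trans _ s1) ?oppr_le0// (le_trans s2).
have cN' : {within `[t, 0], continuous (fun s => `|cIm (D s)|)}.
  by apply: continuous_subspaceW cN; apply: subset_itv; rewrite bnd_simp.
have [|s st sE] := IVT (ltW t0) cN' (v := v).
  by rewrite D0/= normr0 (min_idPr _) ?(ltW v0)// (max_idPl _) ?vt// normr_ge0.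
exists s => //; move: st; rewrite !in_itv/= => /andP[s1 s2].
by rewrite (le_trans tr1)// (le_trans s2).
Qed.

Lemma distinguished_log_unique (psi : R -> R[i]) (r : R) (c : R[i]) (L1 L2 : R -> R[i]) :
  0 <= r -> is_distinguished_log psi r c L1 -> is_distinguished_log psi r c L2 ->
  forall t, t \in `[- r, r] -> L1 t = L2 t.
Proof.
move=> r0 [c1 e1 i1] [c2 e2 i2] t tr; apply/eqP; rewrite -subr_eq0; apply/eqP.
apply: (@cexp_eq1_segment (fun t => L1 t - L2 t) r r0 _ _ _ t tr).
- by move=> s; apply: cvgB; [exact: c1|exact: c2].
- by move=> s sr; rewrite cexpD cexpN e1// e2// divff// -e2// cexp_neq0.
- by rewrite i1 i2 subrr.
Qed.

Lemma distinguished_logE (psi : R -> R[i]) (r : R) (c : R[i]) (L : R -> R[i]) :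
  0 <= r -> is_distinguished_log psi r c L ->
  forall t, t \in `[- r, r] -> distinguished_log psi r c t = L t.
Proof.
move=> r0 dL; apply: distinguished_log_unique (dL) => //.
by rewrite /distinguished_log; apply: (@xgetPex _ _ [set L | is_distinguished_log psi r c L]); exists L.
Qed.

(** Principal logarithms of 1 + z depend continuously on z near 0, and by
    uniqueness this candidate is the distinguished logarithm. *)
Lemma distinguished_log_perturb (psi l z : R -> R[i]) (r : R) :
  {within `[- r, r], continuous (l : R -> R[i]^o)} ->
  {within `[- r, r], continuous (z : R -> R[i]^o)} ->
  (forall t, t \in `[- r, r] -> psi t = cexp (l t) * (1 + z t)) ->
  (forall t, t \in `[- r, r] -> normc (z t) <= 2^-1) -> z 0 = 0 ->
  is_distinguished_log psi r (l 0) (fun t => l t + clog (1 + z t)).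
Proof.
move=> /subspace_continuousP cl /subspace_continuousP cz psiE z2 z0; split.
- apply/subspace_continuousP => t tr; apply: cvgD; first exact: cl.
  apply: cvg_clog; first by apply: Re_gt0_of_near1; exact: z2.
  by apply: cvgD; [exact: cvg_cst|exact: cz].
- by move=> t tr; rewrite cexpD clogK ?psiE//; apply: Re_gt0_of_near1; exact: z2.
- by rewrite z0 addr0 clog1 addr0.
Qed.

(** When consecutive values of phi on the subdivision of the segment from 0 to
    t are close, the principal logarithms of their quotients add up to a
    logarithm of phi t. Being explicit in phi, this formula depends measurably
    on phi. *)
Definition polygonal_log (phi : R -> R[i]) (m : nat) (t : R) : R[i] :=
  \sum_(0 <= k < m) clog (phi (k.+1%:R / m%:R * t) / phi (k%:R / m%:R * t)).

(** By the Lipschitz bound, consecutive values differ by at most K * r / m,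
    hence their quotients are within 1/2 of 1. *)
Lemma polygonal_logP (phi : R -> R[i]) (K delta r : R) (m : nat) :
  0 <= r -> 0 < delta -> phi 0 = 1 ->
  (forall s t, normc (phi s - phi t) <= K * `|s - t|) ->
  (forall t, t \in `[- r, r] -> delta <= normc (phi t)) ->
  (0 < m)%N -> K * r / m%:R <= delta / 2 ->
  is_distinguished_log phi r 0 (polygonal_log phi m).
Proof.
move=> r0 d0 phi1 lip low m0 mK.
have m0' : (0 : R) < m%:R by rewrite ltr0n.
have K0 : 0 <= K.
  by have := le_trans (normc_ge0 _) (lip 1 0); rewrite subr0 normr1 mulr1.
have cphi : continuous (phi : R -> R[i]^o).
  move=> t; apply: cvg_complex; apply/cvgrPdist_lt => e e0.
    near=> s; rewrite -cReN -cReD (le_lt_trans (normr_Re_le _))//.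
    rewrite (le_lt_trans (lip _ _))// (@le_lt_trans _ _ ((K + 1) * `|t - s|)) ?ler_wpM2r ?lerDl//.
    rewrite mulrC -ltr_pdivlMr ?ltr_wpDl//; near: s.
    by apply: cvgr_dist_lt => //; rewrite divr_gt0 ?ltr_wpDl.
  near=> s; rewrite -cImN -cImD (le_lt_trans (normr_Im_le _))//.
  rewrite (le_lt_trans (lip _ _))// (@le_lt_trans _ _ ((K + 1) * `|t - s|)) ?ler_wpM2r ?lerDl//.
  rewrite mulrC -ltr_pdivlMr ?ltr_wpDl//; near: s.
  by apply: cvgr_dist_lt => //; rewrite divr_gt0 ?ltr_wpDl.
have tI (t : R) (k : nat) : (k <= m)%N -> t \in `[- r, r] -> k%:R / m%:R * t \in `[- r, r].
  move=> km; rewrite !in_itv/= -!ler_norml => tr; rewrite normrM.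
  rewrite ger0_norm ?divr_ge0// (le_trans _ tr)// ler_piMl//.
  by rewrite ler_pdivrMr// mul1r ler_nat.
have phi0 t : t \in `[- r, r] -> phi t != 0.
  by move=> tr; rewrite -normc_eq0 gt_eqF// (lt_le_trans d0)// low.
have qnear (t : R) (k : nat) : (k < m)%N -> t \in `[- r, r] ->
    0 < cRe (phi (k.+1%:R / m%:R * t) / phi (k%:R / m%:R * t)).
  move=> km tr; have tk := tI t k (ltnW km) tr.
  have -> : phi (k.+1%:R / m%:R * t) / phi (k%:R / m%:R * t) =
     1 + (phi (k.+1%:R / m%:R * t) - phi (k%:R / m%:R * t)) / phi (k%:R / m%:R * t).
    by rewrite mulrBl divff ?phi0// addrCA subrr addr0.
  apply: Re_gt0_of_near1; rewrite Normc.normcM Normc.normcV.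
  rewrite ler_pdivrMr ?(lt_le_trans d0 (low _ tk))//.
  rewrite (le_trans (lip _ _))// (le_trans _ (ler_wpM2l _ (low _ tk))) ?invr_ge0//.
  apply: (@le_trans _ _ (K * r / m%:R)); last by rewrite [leRHS]mulrC.
  rewrite -[leRHS]mulrA ler_wpM2l//.
  rewrite -mulrBl -mulrBl -natrB// subSnn mul1r normrM gtr0_norm ?invr_gt0// mulrC.
  rewrite ler_pM2r ?invr_gt0//.
  by move: tr; rewrite in_itv/= -ler_norml.
split.
- apply/subspace_continuousP => t tr; rewrite /polygonal_log.
  have tr' : t \in `[- r, r] by exact: tr.
  have : forall s : seq nat, {subset s <= iota 0 m} ->
    ((fun t => \sum_(k <- s) clog (phi (k.+1%:R / m%:R * t) / phi (k%:R / m%:R * t))) : R -> R[i]^o) x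
     @[x --> within `[- r, r] (nbhs t)] -->
    ((\sum_(k <- s) clog (phi (k.+1%:R / m%:R * t) / phi (k%:R / m%:R * t))) : R[i]^o).
    elim=> [|k s ih] sm.
      by under eq_fun do rewrite big_nil; rewrite big_nil; exact: cvg_cst.
    under eq_fun do rewrite big_cons; rewrite big_cons.
    have km : (k < m)%N by have := sm k (mem_head _ _); rewrite mem_iota.
    apply: cvgD; last by apply: ih => j js; apply: sm; rewrite in_cons js orbT.
    apply: cvg_clog; first exact: qnear.
    have cscale (c : R) : ((fun x => phi (c * x)) : R -> R[i]^o) x @[x --> within `[- r, r] (nbhs t)] --> (phi (c * t) : R[i]^o).
      apply: cvg_within_filter; apply: (@continuous_comp _ _ _ (fun x => c * x) (phi : R -> R[i]^o)); last exact: cphi.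
      by apply: cvgM; [exact: cvg_cst|exact: cvg_id].
    apply: cvgM; first exact: cscale.
    by apply: cvgV; [apply: phi0; apply: tI => //; exact: ltnW|exact: cscale].
  by move=> /(_ (index_iota 0 m)); apply => k; rewrite /index_iota subn0.
- move=> t tr; rewrite cexp_sum.
  rewrite big_nat (eq_bigr (fun k => phi (k.+1%:R / m%:R * t) / phi (k%:R / m%:R * t))); last first.
    by move=> k /andP[_ km]; rewrite clogK// qnear.
  rewrite -big_nat.
  have : forall j, (j <= m)%N -> \prod_(0 <= k < j) (phi (k.+1%:R / m%:R * t) / phi (k%:R / m%:R * t)) = phi (j%:R / m%:R * t).
    elim=> [|j ih] jm; first by rewrite big_nil !mul0r phi1.
    rewrite big_nat_recr//= ih ?(ltnW jm)// mulrCA divff ?mulr1//.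
    by apply: phi0; apply: tI => //; exact: ltnW.
  by move=> /(_ m (leqnn m)) ->; rewrite divff ?mul1r// gt_eqF.
- rewrite /polygonal_log big1// => k _; rewrite !mulr0 phi1 divff ?oner_eq0//.
  exact: clog1.
Unshelve. all: end_near. Qed.

End DistinguishedLog.

(** * Measurability of the logarithm transform *)

Section MeasurableFunctions.
Context {R : realType} d (T : measurableType d).
Local Open Scope complex_scope.
Local Notation cRe := (@complex.Re R).
Local Notation cIm := (@complex.Im R).
Local Notation normc := (@Normc.normc R).
Notation mu := (@lebesgue_measure R).

(** The identity x^-1 = x * (x^2)^-1 reduces inversion to a power of a
    nonnegative function; it holds at 0 as well. *)
Lemma measurable_funVr (f : T -> R) : measurable_fun [set: T] f ->
  measurable_fun [set: T] (fun x => (f x)^-1).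
Proof.
move=> mf; have -> : (fun x => (f x)^-1) = (fun x => f x * (f x ^+ 2) `^ (-1)).
  apply/funext => x; rewrite powR_inv1 ?sqr_ge0//.
  have [->|f0] := eqVneq (f x) 0; first by rewrite mul0r invr0.
  by rewrite expr2 invfM mulVKf.
apply: measurable_funM => //.
by have := measurableT_comp (@measurable_powR R (-1)) (measurable_funX 2 mf).
Qed.

Definition cmeasurable (F : T -> R[i]) :=
  measurable_fun [set: T] (fun x => cRe (F x)) /\ measurable_fun [set: T] (fun x => cIm (F x)).

Lemma cmeasurable_cst c : cmeasurable (fun=> c).
Proof. by split; exact: measurable_cst. Qed.

Lemma cmeasurableD F G : cmeasurable F -> cmeasurable G -> cmeasurable (fun x => F x + G x).
Proof.
move=> [F1 F2] [G1 G2]; split.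
  by under eq_fun do rewrite cReD; exact: measurable_funD.
by under eq_fun do rewrite cImD; exact: measurable_funD.
Qed.

Lemma cmeasurableM F G : cmeasurable F -> cmeasurable G -> cmeasurable (fun x => F x * G x).
Proof.
move=> [F1 F2] [G1 G2]; split.
  by under eq_fun do rewrite cReM; apply: measurable_funB; exact: measurable_funM.
by under eq_fun do rewrite cImM; apply: measurable_funD; exact: measurable_funM.
Qed.

Lemma cmeasurable_sum (I : Type) (s : seq I) (F : I -> T -> R[i]) :
  (forall i, cmeasurable (F i)) -> cmeasurable (fun x => \sum_(i <- s) F i x).
Proof.
move=> mF; elim: s => [|i s ih].
  by under eq_fun do rewrite big_nil; exact: cmeasurable_cst.
by under eq_fun do rewrite big_cons; exact: cmeasurableD.
Qed.

Lemma cmeasurable_sqr_normc F : cmeasurable F ->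
  measurable_fun [set: T] (fun x => normc (F x) ^+ 2).
Proof.
move=> [F1 F2]; under eq_fun do rewrite sqr_normcE.
by apply: measurable_funD; exact: measurable_funX.
Qed.

Lemma cmeasurableV F : cmeasurable F -> cmeasurable (fun x => (F x)^-1).
Proof.
move=> mF; have [F1 F2] := mF; have mN := cmeasurable_sqr_normc mF.
have ReV (z : R[i]) : cRe (z^-1) = cRe z * (normc z ^+ 2)^-1.
  by rewrite sqr_normcE; case: z.
have ImV (z : R[i]) : cIm (z^-1) = - cIm z * (normc z ^+ 2)^-1.
  by rewrite sqr_normcE; case: z => a b; rewrite mulNr.
split.
  by under eq_fun do rewrite ReV; apply: measurable_funM => //; exact: measurable_funVr.
under eq_fun do rewrite ImV; apply: measurable_funM; last exact: measurable_funVr.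
exact: measurableT_comp.
Qed.

Lemma cmeasurable_clog F : cmeasurable F -> cmeasurable (fun x => clog (F x)).
Proof.
move=> mF; have [F1 F2] := mF; have mN := cmeasurable_sqr_normc mF.
split => /=.
  have mS : measurable_fun [set: T] (fun x => normc (F x)).
    have -> : (fun x => normc (F x)) = (fun x => Num.sqrt (normc (F x) ^+ 2)).
      by apply/funext => x; rewrite sqrtr_sqr ger0_norm// normc_ge0.
    apply: (measurableT_comp _ mN); apply: continuous_measurable_fun.
    exact: sqrt_continuous.
  by have := measurableT_comp (@measurable_ln R) mS.
have mat : measurable_fun [set: R] (@atan R).
  by apply: continuous_measurable_fun; exact: continuous_atan.
apply: (measurableT_comp mat); apply: measurable_funM => //.
exact: measurable_funVr.
Qed.

Lemma cmeasurable_cexpi (f : T -> R) : measurable_fun [set: T] f ->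
  cmeasurable (fun x => cexpi (f x)).
Proof.
move=> mf; split; [under eq_fun do rewrite Re_cexpi|under eq_fun do rewrite Im_cexpi].
  by case: (bounded_measurable_cos mf).
by case: (bounded_measurable_sin mf).
Qed.

End MeasurableFunctions.

Lemma cmeasurable_comp {R : realType} d (T : measurableType d) d' (T' : measurableType d')
  (F : T -> R[i]) (g : T' -> T) :
  cmeasurable F -> measurable_fun [set: T'] g -> cmeasurable (fun x => F (g x)).
Proof. by move=> [F1 F2] mg; split; [exact: (measurableT_comp F1 mg)|exact: (measurableT_comp F2 mg)]. Qed.

Section MeasurableLog.
Context {R : realType} d (T : measurableType d).
Local Open Scope complex_scope.
Local Notation cRe := (@complex.Re R).
Local Notation cIm := (@complex.Im R).
Local Notation normc := (@Normc.normc R).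
Notation mu := (@lebesgue_measure R).

Lemma measurable_Rintegral_param (K : T * R -> R) (D : set R) :
  measurable D -> measurable_fun [set: T * R] K ->
  measurable_fun [set: T] (fun w => \int[mu]_(t in D) K (w, t)).
Proof.
move=> mD mK; pose K' z := K z * \1_D z.2.
have mK' : measurable_fun [set: T * R] (EFin \o K').
  apply/measurable_EFinP; apply: measurable_funM => //.
  have mi : measurable_fun [set: R] (\1_D : R -> R) by exact: measurable_indic.
  exact: measurableT_comp mi measurable_snd.
have KE w : \int[mu]_(t in D) K (w, t) =
   fine (\int[mu]_t (EFin \o K')^\+ (w, t) - \int[mu]_t (EFin \o K')^\- (w, t))%E.
  rewrite Rintegral_mkcond /Rintegral integralE; congr (fine (_ - _)%E);
  apply: eq_integral => t _;
  rewrite !(funeposE, funenegE) /K' /= patchE indicE;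
  by case: (t \in D); rewrite ?mulr1 ?mulr0.
under eq_fun do rewrite KE.
apply: measurableT_comp; first exact: fine_measurable.
apply: emeasurable_funB.
  have mp : measurable_fun [set: T * R] ((EFin \o K')^\+)%E by exact: measurable_funepos.
  by have := @measurable_fun_fubini_tonelli_F _ _ T _ R mu _ mp; apply => z; exact: funepos_ge0.
have mp : measurable_fun [set: T * R] ((EFin \o K')^\-)%E by exact: measurable_funeneg.
by have := @measurable_fun_fubini_tonelli_F _ _ T _ R mu _ mp; apply => z; exact: funeneg_ge0.
Qed.

Variables (phi : T -> R -> R[i]) (r : R).
Hypothesis r0 : 0 <= r.
Hypothesis mphi : cmeasurable (fun z : T * R => phi z.1 z.2).
Hypothesis lip : forall w, exists K : R,
  forall s t, normc (phi w s - phi w t) <= K * `|s - t|.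

Let clamp (t : R) := Num.max (- r) (Num.min r t).

Let clamp_in t : clamp t \in `[- r, r].
Proof.
rewrite in_itv/= /clamp le_max lexx/= ge_max ge_min lexx/=.
by rewrite (le_trans _ r0)// oppr_le0.
Qed.

Let clamp_id t : t \in `[- r, r] -> clamp t = t.
Proof.
rewrite in_itv/= => /andP[t1 t2].
by rewrite /clamp (min_idPr _)// (max_idPr _).
Qed.

Let lipN w : continuous (fun t => normc (phi w t)).
Proof.
have [K lipK] := lip w.
have K0 : 0 <= K.
  by have := le_trans (normc_ge0 _) (lipK 1 0); rewrite subr0 normr1 mulr1.
move=> t; apply/cvgrPdist_lt => e e0; near=> s.
have h : `|normc (phi w t) - normc (phi w s)| <= normc (phi w t - phi w s).
  have tri (z u : R[i]) : normc z <= normc (z - u) + normc u.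
    by rewrite -{1}[z](subrK u) le_normcD.
  rewrite ler_norml; apply/andP; split; last by rewrite lerBlDr.
  have := tri (phi w s) (phi w t); rewrite -(opprB (phi w t)) normcN.
  by rewrite lerNl opprB lerBlDr.
rewrite (le_lt_trans h)// (le_lt_trans (lipK _ _))//.
rewrite (@le_lt_trans _ _ ((K + 1) * `|t - s|)) ?ler_wpM2r ?lerDl//.
rewrite mulrC -ltr_pdivlMr ?ltr_wpDl//; near: s.
by apply: cvgr_dist_lt => //; rewrite divr_gt0 ?ltr_wpDl.
Unshelve. all: end_near. Qed.

Let continuous_clamp : continuous clamp.
Proof.
have cmin : continuous ((fun=> r) \min (@idfun R)).
  by move=> t; apply: continuous_min; [exact: cvg_cst|exact: cvg_id].
by move=> t; apply: (@continuous_max _ _ (fun=> - r) _ t (cvg_cst _)); exact: cmin.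
Qed.

(** By compactness, non-vanishing on [-r, r] is uniform, hence detected on
    countably many points. *)
Let nonvanishing_unif w : (forall t, t \in `[- r, r] -> phi w t != 0) ->
  exists2 delta, 0 < delta & forall t, t \in `[- r, r] -> delta <= normc (phi w t).
Proof.
move=> h; have rr : - r <= r by rewrite (le_trans _ r0)// oppr_le0.
have [c cr cmin] := EVT_min rr (continuous_subspaceT (@lipN w)).
exists (normc (phi w c)) => //.
by rewrite lt_neqAle normc_ge0 andbT eq_sym normc_eq0 h.
Qed.

Lemma measurable_nonvanishing :
  measurable [set w | forall t, t \in `[- r, r] -> phi w t != 0].
Proof.
have -> : [set w | forall t, t \in `[- r, r] -> phi w t != 0] =
  \bigcup_k \bigcap_j [set w | k.+1%:R^-1 <= normc (phi w (clamp (ratr (odflt 0 (@choice.unpickle rat j))))) ^+ 2].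
  apply/seteqP; split => w /=.
    move=> /nonvanishing_unif[delta d0 h].
    have d20 : 0 < delta ^+ 2 by rewrite exprn_gt0.
    have [k _ hk] := near_infty_natSinv_lt (PosNum d20).
    exists k => // j _ /=; rewrite (le_trans (ltW (hk k (leqnn k))))//=.
    by rewrite lerXn2r ?nnegrE ?(ltW d0) ?normc_ge0// h.
  move=> [k _ hk] t tr; rewrite -normc_eq0 -sqrf_eq0.
  suff : k.+1%:R^-1 <= normc (phi w t) ^+ 2.
    by apply: contraTneq => ->; rewrite -ltNge invr_gt0.
  rewrite leNgt; apply/negP => lt1.
  pose g s := normc (phi w (clamp s)) ^+ 2.
  have cg : continuous g.
    move=> s; rewrite /g; apply: (@continuous_comp _ _ _ (fun s => normc (phi w (clamp s))) (fun x => x ^+ 2)); last exact: exprn_continuous.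
    by apply: (@continuous_comp _ _ _ clamp (fun s => normc (phi w s))); [exact: continuous_clamp|exact: lipN].
  have oU : open [set s | g s < k.+1%:R^-1].
    have -> : [set s | g s < k.+1%:R^-1] = g @^-1` [set x | x < k.+1%:R^-1] by [].
    by apply: open_comp; [move=> s _; exact: cg|exact: open_lt].
  have [|s [us [q _ qs]]] := @dense_rat R _ _ oU.
    by exists t; rewrite /= /g clamp_id.
  move: us; rewrite /= -qs /g => lts.
  have hkj j : k.+1%:R^-1 <= normc (phi w (clamp (ratr (odflt 0 (@choice.unpickle rat j))))) ^+ 2.
    exact: hk.
  have := hkj (@choice.pickle rat q); rewrite choice.pickleK leNgt => /negP; exact.
apply: bigcupT_measurable => k; apply: bigcapT_measurable => j.
rewrite -[X in measurable X]setTI; apply: measurable_fun_le => //.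
apply: cmeasurable_sqr_normc.
exact: (cmeasurable_comp mphi (measurable_pair2 (clamp (ratr (odflt 0 (@choice.unpickle rat j)))))).
Qed.

Variables (l : R -> R[i]) (psi : T -> R -> R[i]).
Hypothesis cl : continuous (l : R -> R[i]^o).
Hypothesis phi1 : forall w, (forall t, t \in `[- r, r] -> phi w t != 0) -> phi w 0 = 1.
Hypothesis psiE : forall w t, t \in `[- r, r] -> psi w t = cexp (l t) * phi w t.

Let polygonal_log_cvg w : (forall t, t \in `[- r, r] -> phi w t != 0) ->
  \forall m \near \oo, is_distinguished_log (psi w) r (l 0)
    (fun t => l t + polygonal_log (phi w) m t).
Proof.
move=> h; have [delta d0 low] := nonvanishing_unif h.
have [K lipK] := lip w; near=> m.
have m0 : (0 < m)%N by near: m; exact: nbhs_infty_gt.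
have mK : K * r / m%:R <= delta / 2.
  rewrite ler_pdivrMr ?ltr0n// [delta / 2 * _]mulrC -ler_pdivrMr ?divr_gt0//.
  near: m; exact: nbhs_infty_ger.
have [cL eL iL] := polygonal_logP r0 d0 (phi1 h) lipK low m0 mK.
split.
- move=> t; apply: cvgD; last exact: cL.
  exact: (continuous_subspaceT cl).
- by move=> t tr; rewrite cexpD eL// psiE.
- by rewrite iL addr0.
Unshelve. all: end_near. Qed.

(** For each outcome the polygonal logarithms are eventually equal to the
    distinguished logarithm on [-r, r], hence the transform is a pointwise
    limit of the integrals of explicit measurable functions. *)
Lemma measurable_log_transform (y v : R) :
  measurable_fun [set: T] (fun w =>
    if `[< forall t, t \in `[- r, r] -> phi w t != 0 >] then
    \int[mu]_(t in `[- r, r]) cRe (cexpi (- (t * y)) * distinguished_log (psi w) r (l 0) t)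
    else v).
Proof.
pose J m w := \int[mu]_(t in `[- r, r]) cRe (cexpi (- (t * y)) * (l t + polygonal_log (phi w) m t)).
have mgood : measurable_fun [set: T] (fun w => `[< forall t, t \in `[- r, r] -> phi w t != 0 >]).
  apply: (measurable_fun_bool true); rewrite setTI.
  rewrite (_ : _ @^-1` _ = [set w | forall t, t \in `[- r, r] -> phi w t != 0]).
    exact: measurable_nonvanishing.
  by apply/seteqP; split => w /=; [move/asboolP|move=> h; apply/asboolP].
have mJ m : measurable_fun [set: T] (J m).
  have mK : measurable_fun [set: T * R] (fun z => cRe (cexpi (- (z.2 * y)) * (l z.2 + polygonal_log (phi z.1) m z.2))).
    have [] // := @cmeasurableM _ _ (T * R)%type (fun z => cexpi (- (z.2 * y))) (fun z => l z.2 + polygonal_log (phi z.1) m z.2).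
      apply: cmeasurable_cexpi; apply: measurableT_comp => //.
      by apply: measurable_funM.
    apply: cmeasurableD.
      have [l1 l2] : continuous (fun x => cRe (l x)) /\ continuous (fun x => cIm (l x)).
        exact/continuous_complexP.
      by split; [exact: measurableT_comp (continuous_measurable_fun l1) measurable_snd|exact: measurableT_comp (continuous_measurable_fun l2) measurable_snd].
    apply: cmeasurable_sum => k; apply: cmeasurable_clog.
    have mscale (c : R) : cmeasurable (fun z : T * R => phi z.1 (c * z.2)).
      have : measurable_fun [set: T * R] (fun z : T * R => (z.1, c * z.2)).
        apply/measurable_fun_pair; first exact: measurable_fst.
        by apply: measurable_funM => //; exact: measurable_snd.
      exact: (cmeasurable_comp mphi).
    by apply: cmeasurableM => //; exact: cmeasurableV.
  exact: (measurable_Rintegral_param _ mK).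
apply: (measurable_fun_cvg (h := fun m w => if `[< forall t, t \in `[- r, r] -> phi w t != 0 >] then J m w else v)).
- by move=> m; apply: measurable_fun_ifT => //; exact: measurable_cst.
- move=> w _; case: asboolP => h; last exact: cvg_cst.
  apply: cvg_near_cst; have := polygonal_log_cvg h; apply: filterS => m Lm.
  apply: eq_Rintegral => t; rewrite inE /= => tr.
  by rewrite (distinguished_logE r0 Lm).
Qed.

End MeasurableLog.

(** * The exponential series of a complex number *)

Section ComplexExponentialSeries.
Context {R : realType}.
Local Open Scope complex_scope.
Local Notation cRe := (@complex.Re R).
Local Notation cIm := (@complex.Im R).
Local Notation normc := (@Normc.normc R).

Lemma is_derive_exp_partial (c : nat -> R) m (s : R) :
  is_derive s (1 : R) (fun s => \sum_(0 <= k < m.+1) c k / k`!%:R * s ^+ k)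
    (\sum_(0 <= k < m) c k.+1 / k`!%:R * s ^+ k).
Proof.
elim: m => [|m ih].
  rewrite big_geq// (_ : (fun s => _) = fun=> c 0%N).
    by apply: is_derive_cst.
  by apply/funext => t; rewrite big_nat1 fact0 divr1 expr0 mulr1.
have -> : (fun s => \sum_(0 <= k < m.+2) c k / k`!%:R * s ^+ k) =
  (fun s => \sum_(0 <= k < m.+1) c k / k`!%:R * s ^+ k + c m.+1 / m.+1`!%:R * s ^+ m.+1).
  by apply/funext => t; rewrite big_nat_recr.
rewrite big_nat_recr//=; apply: is_deriveD.
have hX : is_derive s (1 : R) (fun x : R => x ^+ m.+1) (m.+1%:R * s ^+ m).
  have := @is_deriveX _ _ (@id R) m.+1 s 1 1 (is_derive_id _ _).
  by rewrite exprfctE /GRing.scale /= mulr1.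
have -> : c m.+1 / m`!%:R * s ^+ m = c m.+1 / m.+1`!%:R * (m.+1%:R * s ^+ m).
  have S0 : m.+1%:R != 0 :> R by rewrite pnatr_eq0.
  by rewrite factS natrM invfM -!mulrA; congr (_ * _); rewrite [RHS]mulrCA mulKf.
exact: (is_deriveZ (c m.+1 / m.+1`!%:R) hX).
Qed.

(** With q the partial sum, the derivative in s of exp (- s z) q (s z) is - z
    exp (- s z) times the last term of q (s z), and the mean value inequality
    applies to its real and imaginary parts. *)
Lemma normc_exp_partial_le (z : R[i]) m :
  normc (cexp (- z) * \sum_(0 <= k < m.+1) (k`!%:R^-1)%:C * z ^+ k - 1) <=
  2 * (expR (normc z) * normc z ^+ m.+1 / m`!%:R).
Proof.
set B := (X in 2 * X).
pose a := cRe z; pose b := cIm z.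
pose A k s : R := \sum_(0 <= k < k) cRe (z ^+ k) / k`!%:R * s ^+ k.
pose D k s : R := \sum_(0 <= k < k) cIm (z ^+ k) / k`!%:R * s ^+ k.
pose u s : R := expR (- (s * a)) * cos (s * b).
pose v s : R := - (expR (- (s * a)) * sin (s * b)).
pose ta s := cRe (z ^+ m) / m`!%:R * s ^+ m.
pose tb s := cIm (z ^+ m) / m`!%:R * s ^+ m.
have dA s : is_derive s (1 : R) (A m.+1) (a * A m s - b * D m s).
  have -> : a * A m s - b * D m s = \sum_(0 <= k < m) cRe (z ^+ k.+1) / k`!%:R * s ^+ k.
    rewrite /A /D !mulr_sumr -sumrB; apply: eq_bigr => k _.
    by rewrite exprS cReM -/a -/b; ring.
  exact: (is_derive_exp_partial (fun k => cRe (z ^+ k))).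
have dD s : is_derive s (1 : R) (D m.+1) (a * D m s + b * A m s).
  have -> : a * D m s + b * A m s = \sum_(0 <= k < m) cIm (z ^+ k.+1) / k`!%:R * s ^+ k.
    rewrite /A /D !mulr_sumr -big_split/=; apply: eq_bigr => k _.
    by rewrite exprS cImM -/a -/b; ring.
  exact: (is_derive_exp_partial (fun k => cIm (z ^+ k))).
have AS s : A m.+1 s = A m s + ta s by rewrite /A big_nat_recr.
have DS s : D m.+1 s = D m s + tb s by rewrite /D big_nat_recr.
have du s : is_derive s (1 : R) u (- a * u s + b * v s).
  by apply: is_derive_eq; rewrite /u /v /GRing.scale /=; ring.
have dv s : is_derive s (1 : R) v (- a * v s - b * u s).
  by apply: is_derive_eq; rewrite /u /v /GRing.scale /=; ring.
have uvB s : `|s| <= 1 -> normc (- z * (u s +i* v s) * (ta s +i* tb s)) <= B.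
  move=> s1.
  have -> : u s +i* v s = cexp (- (s%:C * z)).
    rewrite /cexp /u /v; apply: complexP; rewrite /= !cReN ?cImN !cReM ?cImM /= !mul0r ?subr0 ?addr0.
      by rewrite cosN.
    by rewrite sinN mulrN.
  have -> : ta s +i* tb s = (s ^+ m / m`!%:R)%:C * z ^+ m.
    by apply: complexP; rewrite ?cReM ?cImM /= !mul0r ?subr0 ?addr0 /ta /tb; ring.
  rewrite !Normc.normcM normcN normc_cexp normc_real normcX normrM normfV normrX normr_nat.
  rewrite cReN cReM /= mul0r subr0 /B.
  have -> : expR (normc z) * normc z ^+ m.+1 / m`!%:R =
     normc z * expR (normc z) * (1 / m`!%:R * normc z ^+ m) by rewrite exprS; ring.
  apply: ler_pM; rewrite ?mulr_ge0 ?invr_ge0 ?exprn_ge0 ?normc_ge0 ?expR_ge0//.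
    rewrite ler_wpM2l ?normc_ge0// ler_expR.
    rewrite (le_trans (ler_norm _))// normrN normrM -[leRHS]mul1r ler_pM//.
    exact: normr_Re_le.
  by rewrite ler_wpM2r ?exprn_ge0 ?normc_ge0// ler_wpM2r ?invr_ge0// exprn_ile1.
have s1 : `|1 : R| <= 1 by rewrite normr1.
have A0 : A m.+1 0 = 1.
  rewrite /A big_nat_recl// expr0 fact0 divr1 expr0 mulr1 /= big1_seq ?addr0// => k _.
  by rewrite expr0n mulr0.
have D0 : D m.+1 0 = 0.
  rewrite /D big_nat_recl// expr0 fact0 divr1 expr0 mulr1 /= big1_seq ?addr0// => k _.
  by rewrite expr0n mulr0.
have hRe : `|u 1 * A m.+1 1 - v 1 * D m.+1 1 - 1| <= B.
  rewrite -[leRHS]mulr1 -[in leRHS](@normr1 R).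
  apply: (@normr_le_derive R (fun s => u s * A m.+1 s - v s * D m.+1 s - 1)
     (fun s => cRe (- z * (u s +i* v s) * (ta s +i* tb s)))).
  - move=> s; have := du s; have := dv s; have := dA s; have := dD s => *.
    apply: is_derive_eq; rewrite /GRing.scale /= !cReM !cImM !cReN cImN -/a -/b /=.
    by rewrite AS DS; ring.
  - by rewrite A0 D0 /u mul0r oppr0 expR0 mul0r cos0 !mulr1 mulr0 subr0 subrr.
  - by move=> s; rewrite normr1 => /uvB; apply: le_trans; exact: normr_Re_le.
have hIm : `|u 1 * D m.+1 1 + v 1 * A m.+1 1| <= B.
  rewrite -[leRHS]mulr1 -[in leRHS](@normr1 R).
  apply: (@normr_le_derive R (fun s => u s * D m.+1 s + v s * A m.+1 s)
     (fun s => cIm (- z * (u s +i* v s) * (ta s +i* tb s)))).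
  - move=> s; have := du s; have := dv s; have := dA s; have := dD s => *.
    apply: is_derive_eq; rewrite /GRing.scale /= !cImM !cReM !cReN cImN -/a -/b /=.
    by rewrite AS DS; ring.
  - by rewrite A0 D0 /u /v !mul0r sin0 !mulr0 oppr0 mul0r addr0.
  - by move=> s; rewrite normr1 => /uvB; apply: le_trans; exact: normr_Im_le.
have reS : cRe (\sum_(0 <= k < m.+1) (k`!%:R^-1)%:C * z ^+ k) = A m.+1 1.
  rewrite Re_sum; apply: eq_bigr => k _.
  by rewrite cReM /= mul0r subr0 expr1n mulr1 mulrC.
have imS : cIm (\sum_(0 <= k < m.+1) (k`!%:R^-1)%:C * z ^+ k) = D m.+1 1.
  rewrite Im_sum; apply: eq_bigr => k _.
  by rewrite cImM /= mul0r addr0 expr1n mulr1 mulrC.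
have ceE : cexp (- z) = u 1 +i* v 1.
  by rewrite /cexp /u /v cReN cImN !mul1r cosN sinN mulrN.
rewrite (le_trans (normc_le_ReIm _))// mulr_natl mulr2n; apply: lerD.
  suff -> : cRe (cexp (- z) * \sum_(0 <= k < m.+1) (k`!%:R^-1)%:C * z ^+ k - 1) =
    u 1 * A m.+1 1 - v 1 * D m.+1 1 - 1 by [].
  by rewrite cReD cReN cReM reS imS ceE.
suff -> : cIm (cexp (- z) * \sum_(0 <= k < m.+1) (k`!%:R^-1)%:C * z ^+ k - 1) =
    u 1 * D m.+1 1 + v 1 * A m.+1 1 by [].
by rewrite cImD cImN cImM reS imS ceE /= subr0.
Qed.

Lemma cvg_exp_series (z : R[i]) :
  normc (\sum_(0 <= k < m) (k`!%:R^-1)%:C * z ^+ k - cexp z) @[m --> \oo] --> (0 : R).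
Proof.
rewrite -(cvg_shiftS _).
apply: (@squeeze_cvgr _ _ _ _ (fun=> 0) (fun m => expR (normc z) * (2 * (expR (normc z) * normc z * exp_coeff (normc z) m)))).
- near=> m; rewrite normc_ge0 /=.
  have -> : \sum_(0 <= k < m.+1) (k`!%:R^-1)%:C * z ^+ k - cexp z =
    cexp z * (cexp (- z) * (\sum_(0 <= k < m.+1) (k`!%:R^-1)%:C * z ^+ k) - 1).
    by rewrite mulrBr mulrA -cexpD subrr cexp0 mul1r mulr1.
  rewrite Normc.normcM normc_cexp ler_pM ?normc_ge0 ?expR_ge0//.
    by rewrite ler_expR (le_trans (ler_norm _))// normr_Re_le.
  by rewrite (le_trans (normc_exp_partial_le _ _))// /exp_coeff /= exprS !mulrA.
- exact: cvg_cst.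
- rewrite -(mulr0 (expR (normc z))); apply: cvgMr.
  rewrite -(mulr0 2); apply: cvgMr.
  rewrite -(mulr0 (expR (normc z) * normc z)); apply: cvgMr.
  exact: cvg_exp_coeff.
Unshelve. all: end_near. Qed.

End ComplexExponentialSeries.

(** * Random variables with a density *)

Section DensityLaw.
Context {R : realType} d (T : measurableType d) (P : probability T R).
Local Open Scope complex_scope.
Local Notation normc := (@Normc.normc R).
Local Notation mu := (@lebesgue_measure R).
Variables (f : R -> R) (Y : {RV P >-> R}).
Hypothesis f_density : probability_density f.
Hypothesis lawY : forall A : set R, measurable A ->
  distribution P Y A = (\int[mu]_(x in A) (f x)%:E)%E.

Let integrable_density : mu.-integrable [set: R] (EFin \o f).
Proof.
have [mf f0 f1] := f_density; apply/integrableP; split; first exact/measurable_EFinP.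
under eq_integral do rewrite /= ger0_norm//.
by rewrite f1 ltry.
Qed.

(** The density f is almost everywhere equal to the Radon-Nikodym derivative of
    the law of Y, for which the change of variables formula is known. *)
Lemma ge0_integral_density (g : R -> R) : measurable_fun [set: R] g ->
  (forall x, 0 <= g x) ->
  (\int[P]_w (g (Y w))%:E = \int[mu]_x (g x * f x)%:E)%E.
Proof.
move=> mg g0; have [mf f0 f1] := f_density.
have mY : @measurable_fun _ _ _ (measurableTypeR R) [set: T] Y.
  by move=> mT A mA; exact: (measurable_funP Y).
pose Y' : {RV P >-> measurableTypeR R} := HB.pack (Y : T -> measurableTypeR R) (isMeasurableFun.Build _ _ _ (measurableTypeR R) Y mY).
pose nu := distribution P Y'.
have dom : nu `<< mu.
  apply/null_content_dominatesP => A mA A0; rewrite [LHS](lawY mA).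
  apply: null_set_integral => //.
  exact: measurable_funTS (measurable_int _ integrable_density).
have aeE : ae_eq mu [set: R] (EFin \o f) (Radon_Nikodym_SigmaFinite.f nu mu).
  apply: integral_ae_eq => //.
    exact: measurable_int (Radon_Nikodym_SigmaFinite.f_integrable dom).
  move=> E _ mE; rewrite -Radon_Nikodym_SigmaFinite.f_integral//.
  by rewrite [RHS](lawY mE).
transitivity (\int[nu]_x (g x)%:E)%E.
  rewrite [RHS]ge0_integral_pushforward//.
    exact/measurable_EFinP.
  by move=> x _; rewrite lee_fin.
rewrite -(Radon_Nikodym_SigmaFinite.change_of_variables dom (f := EFin \o g))//; last first.
  exact/measurable_EFinP.
apply: ae_eq_integral => //.
- apply: emeasurable_funM; first exact/measurable_EFinP.
  exact: measurable_int (Radon_Nikodym_SigmaFinite.f_integrable dom).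
- by apply/measurable_EFinP; exact: measurable_funM.
- apply: filterS aeE => x /= h _; rewrite EFinM; congr (_ * _)%E.
  by rewrite -h.
Qed.

Lemma integrable_density_bounded (g : R -> R) : bounded_measurable g ->
  mu.-integrable [set: R] (EFin \o (fun x => g x * f x)).
Proof.
have [mf f0 f1] := f_density.
move=> [mg [B gB]].
apply: (le_integrable measurableT _ _ (integrableZl measurableT B integrable_density)).
  by apply/measurable_EFinP; exact: measurable_funM.
move=> x _ /=; rewrite lee_fin !normrM (ger0_norm (f0 x)) ler_wpM2r//.
by rewrite (le_trans (gB x))// ler_norm.
Qed.

Lemma Rintegral_density (g : R -> R) : bounded_measurable g ->
  \int[P]_w g (Y w) = \int[mu]_x (g x * f x).
Proof.
have [mf f0 f1] := f_density; move=> bg; have [mg [B gB]] := bg.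
have gB0 x : 0 <= g x + B by have := gB x; rewrite ler_norml => /andP[]; lra.
have bgB : bounded_measurable (fun x => g x + B).
  by apply: bounded_measurableD => //; exact: bounded_measurable_cst.
have := ge0_integral_density bgB.1 gB0 => /(congr1 fine).
have mY : measurable_fun [set: T] Y by [].
rewrite -!/(Rintegral _ _ _) bintD; last 2 first.
- exact: bounded_measurable_comp mY bg.
- exact: bounded_measurable_cst.
rewrite bint_cst.
have -> : \int[mu]_x ((g x + B) * f x) = \int[mu]_x (g x * f x) + B.
  have iB : mu.-integrable [set: R] (EFin \o (fun x => B * f x)).
    by apply: (@integrable_density_bounded (fun=> B)); exact: bounded_measurable_cst.
  under eq_Rintegral do rewrite mulrDl.
  rewrite RintegralD//; last exact: integrable_density_bounded.
  rewrite RintegralZl//.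
  by rewrite {2}/Rintegral f1 /= mulr1.
by move=> /addIr.
Qed.

Lemma cintegral_cexpi_density t : cintegral P [set: T] (fun w => cexpi (t * Y w)) = density_cf f t.
Proof.
have [b1 b2] : cbounded_measurable (fun x : R => cexpi (t * x)).
  by apply: cbounded_measurable_cexpi; exact: measurable_funM.
apply: complexP; rewrite /cintegral.
  rewrite [LHS](Rintegral_density b1); apply: eq_Rintegral => x _.
  by rewrite /= mulr0 subr0.
rewrite [LHS](Rintegral_density b2); apply: eq_Rintegral => x _.
by rewrite /= mulr0 add0r.
Qed.

Lemma truncated_first_moment_le (m : nat) :
  mu.-integrable [set: R] (EFin \o (fun x => `|x| * f x)) ->
  \int[P]_w Num.min `|Y w| m%:R <= \int[mu]_x (`|x| * f x).
Proof.
have [mf f0 f1] := f_density; move=> i1.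
have bm : bounded_measurable (fun x : R => Num.min `|x| m%:R).
  split; first by apply: measurable_minr => //; exact: measurableT_comp.
  exists m%:R => x; rewrite ger0_norm ?ge_min ?lexx ?orbT// le_min normr_ge0 ler0n//.
rewrite (Rintegral_density bm); apply: le_Rintegral => //.
  exact: integrable_density_bounded.
by move=> x _; rewrite ler_wpM2r// ge_min lexx.
Qed.

End DensityLaw.

(** * Compound Poisson sums with Gaussian noise *)

Lemma min_normD {R : realType} (a b m : R) : 0 <= m ->
  Num.min `|a + b| m <= Num.min `|a| m + Num.min `|b| m.
Proof.
move=> m0; have ab := ler_normD a b; have := normr_ge0 a; have := normr_ge0 b.
by rewrite !minEle; do 3 case: ifPn; rewrite -?ltNge; lra.
Qed.

Lemma min_norm_sum {R : realType} (a : nat -> R) (m : R) k : 0 <= m ->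
  Num.min `|\sum_(0 <= j < k) a j| m <= \sum_(0 <= j < k) Num.min `|a j| m.
Proof.
move=> m0; elim: k => [|k ih]; first by rewrite !big_geq// normr0 ge_min lexx.
by rewrite !big_nat_recr//= (le_trans (min_normD _ _ m0))// lerD2r.
Qed.

Lemma Rintegral_odd {R : realType} (g : R -> R) :
  (@lebesgue_measure R).-integrable [set: R] (EFin \o g) -> (forall x, g (- x) = - g x) ->
  \int[@lebesgue_measure R]_x g x = 0.
Proof.
move=> ig go; have /measurable_EFinP mg := measurable_int _ ig.
have mN : measurable_fun [set: measurableTypeR R] (-%R : measurableTypeR R -> measurableTypeR R).
  have h : measurable_fun [set: R] (fun x : R => - x) by exact: measurable_funN.
  by move=> mT A mA; exact: h.
suff : \int[@lebesgue_measure R]_x g x = - \int[@lebesgue_measure R]_x g x by lra.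
rewrite -[in RHS](mulN1r) -RintegralZl//; rewrite /Rintegral; congr fine.
have iN : (@lebesgue_measure R).-integrable [set: R] ((EFin \o g) \o -%R).
  apply: (eq_integrable measurableT) (integrableZl measurableT (-1) ig) => //= x _.
  by rewrite /= go -EFinM mulN1r.
transitivity (\int[@lebesgue_measure R]_(x in -%R @^-1` [set: R]) ((EFin \o g) \o -%R) x)%E; last first.
  by rewrite preimage_setT; apply: eq_integral => x _ /=; rewrite go mulN1r.
rewrite -(integral_pushforward mN)//; last exact/measurable_EFinP.
by apply: eq_measure_integral => A mA _; exact/esym/lebesgue_measureN.
Qed.

Section CompoundPoisson.
Context {R : realType} d (T : measurableType d) (P : probability T R).
Local Open Scope complex_scope.
Local Notation cRe := (@complex.Re R).
Local Notation cIm := (@complex.Im R).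
Local Notation normc := (@Normc.normc R).
Local Notation mu := (@lebesgue_measure R).
Local Notation Ec := (cintegral P [set: T]).
Variables (lambda : R) (f : R -> R).
Variables (N : {RV P >-> nat}) (W : nat -> {RV P >-> R}) (Z : {RV P >-> R}).
Hypothesis lambda_gt0 : 0 < lambda.
Hypothesis f_density : probability_density f.
Hypothesis N_poisson : forall k : nat,
  distribution P N [set k] = (poisson_pmf lambda k)%:E.
Hypothesis W_density : forall (j : nat) (A : set R), measurable A ->
  distribution P (W j) A = (\int[mu]_(x in A) (f x)%:E)%E.
Hypothesis W_indep : independent_rvs P (fun j => W j : T -> R).
Hypothesis Z_normal : forall A : set R, measurable A ->
  distribution P Z A = normal_prob 0 1 A.
Hypothesis NWZ_indep : independent3 P (sigma_rv (N : T -> nat))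
  (sigma_rvs (fun j => W j : T -> R)) (sigma_rv (Z : T -> R)).

Definition compound_sum w := \sum_(j < N w) W j w + Z w.
Local Notation S := compound_sum.

Let p k := poisson_pmf lambda k.
Let N_ k := N @^-1` [set k].
Let S_ k w := \sum_(0 <= j < k) W j w + Z w.

Let pE k : p k = expR (- lambda) * (lambda ^+ k / k`!%:R).
Proof. by rewrite /p /poisson_pmf lambda_gt0 mulrC. Qed.

Let p_ge0 k : 0 <= p k. Proof. exact: poisson_pmf_ge0. Qed.

Let mN k : measurable (N_ k).
Proof. by rewrite -[X in measurable X]setTI; exact: (measurable_funP N). Qed.

Let SN k w : N_ k w -> S w = S_ k w.
Proof. by rewrite /N_ /S /S_ /= => ->; rewrite big_mkord. Qed.

Let mW j : measurable_fun [set: T] (W j). Proof. by []. Qed.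
Let mZ : measurable_fun [set: T] Z. Proof. by []. Qed.
Let mWsum k : measurable_fun [set: T] (fun w => \sum_(0 <= j < k) W j w).
Proof. exact: measurable_sum. Qed.

Lemma measurable_compound_sum : measurable_fun [set: T] S.
Proof.
move=> _ A mA; rewrite setTI.
have -> : S @^-1` A = \bigcup_k (N_ k `&` S_ k @^-1` A).
  apply/seteqP; split => [w Aw|w [k _ [kw]]]; last by rewrite /= (SN kw).
  by exists (N w) => //; split => //=; rewrite -(SN (erefl _)).
apply: bigcupT_measurable => k; apply: measurableI => //.
rewrite -[X in measurable X]setTI; apply: measurable_funD => //.
Qed.

Let sigma_W j (A : set R) : measurable A -> sigma_rvs (fun j => W j : T -> R) (W j @^-1` A).
Proof.
move=> mA; apply: sub_gen_smallest; exists j => //; exists A => //.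
by rewrite setTI.
Qed.

Let sigma_Wsum k (A : set R) : measurable A ->
  sigma_rvs (fun j => W j : T -> R) ((fun w => \sum_(0 <= j < k) W j w) @^-1` A).
Proof.
pose T' := g_sigma_algebraType (\bigcup_j sigma_rv (fun w => W j w : R)).
have mW' j : @measurable_fun _ _ T' _ setT (fun w => W j w).
  by move=> _ B mB; rewrite setTI; exact: sigma_W.
have : @measurable_fun _ _ T' _ setT (fun w => \sum_(0 <= j < k) W j w).
  exact: measurable_sum.
by move=> h mA; have := h measurableT A mA; rewrite setTI.
Qed.

(** Y stands for any function of the W j, such as one of them or a partial sum.
    *)
Let NWZ_cintegral k (Y : T -> R) (g h : R -> R[i]) : measurable_fun [set: T] Y ->
  (forall A : set R, measurable A -> sigma_rvs (fun j => W j : T -> R) (Y @^-1` A)) ->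
  cbounded_measurable g -> cbounded_measurable h ->
  Ec (fun w => (\1_(N_ k) w)%:C * (g (Y w) * h (Z w))) =
  (p k)%:C * (Ec (fun w => g (Y w)) * Ec (fun w => h (Z w))).
Proof.
move=> mY sY bg bh.
pose G (i : 'I_3) w : R[i] :=
  match val i with 0%N => (\1_(N_ k) w)%:C | 1%N => g (Y w) | _ => h (Z w) end.
have := @mutually_independent_cintegral _ _ _ P _ _
  [:: @Ordinal 3 0 isT; @Ordinal 3 1 isT; @Ordinal 3 2 isT] G NWZ_indep.
have -> : (p k)%:C = Ec (fun w => (\1_(N_ k) w)%:C).
  rewrite cintegral_real; congr (_%:C); rewrite bint_indic//.
  by have := N_poisson k; rewrite /distribution /pushforward => ->.
rewrite !big_cons !big_nil mulr1 => <- //.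
- by apply: eq_cintegral => w; rewrite !big_cons big_nil mulr1.
- move=> i _; case: i => -[|[|[|//]]] i3; rewrite /G /=.
  + by apply: cbounded_measurable_real; exact: bounded_measurable_indic.
  + by case: bg => g1 g2; split; [exact: (bounded_measurable_comp mY g1)|exact: (bounded_measurable_comp mY g2)].
  + by case: bh => g1 g2; split; [exact: (bounded_measurable_comp mZ g1)|exact: (bounded_measurable_comp mZ g2)].
- move=> i _ A mA; case: i => -[|[|[|//]]] i3; rewrite /G /tnth /=.
  + split.
      rewrite (_ : cRe \o _ = (fun n => (n == k)%:R) \o N); first exact: sigma_rv_comp.
      apply/funext => w /=; rewrite indicE; congr (_%:R).
      have [e|ne] := eqVneq (N w) k; first by rewrite mem_set.
      by rewrite memNset// => /= e; rewrite e eqxx in ne.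
    rewrite (_ : cIm \o _ = (fun=> 0) \o N); first exact: sigma_rv_comp.
    by apply/funext.
  + split.
      rewrite -[X in sigma_rvs _ X]/(Y @^-1` ((cRe \o g) @^-1` A)); apply: sY.
      by rewrite -[X in measurable X]setTI; exact: bg.1.1.
    rewrite -[X in sigma_rvs _ X]/(Y @^-1` ((cIm \o g) @^-1` A)); apply: sY.
    by rewrite -[X in measurable X]setTI; exact: bg.2.1.
  + split; first by apply: (@sigma_rv_comp _ _ _ _ _ Z (cRe \o h) A) => //; exact: bh.1.1.
    by apply: (@sigma_rv_comp _ _ _ _ _ Z (cIm \o h) A) => //; exact: bh.2.1.
Qed.

Local Notation phi := (density_cf f).
Local Notation psi := (fun t : R => (expR (- (t ^+ 2 / 2)))%:C).

Let Wsum_cf k t : Ec (fun w => cexpi (t * \sum_(0 <= j < k) W j w)) = phi t ^+ k.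
Proof.
under eq_cintegral do rewrite mulr_sumr cexpi_sum.
rewrite (@iid_cintegral_prod _ _ _ P (fun j => W j) _ _ _ (fun x => cexpi (t * x)))//.
- by rewrite (cintegral_cexpi_density f_density (W_density 0%N)).
- by move=> i g bg; rewrite !(Rintegral_density f_density (W_density _) bg).
- by apply: cbounded_measurable_cexpi; exact: measurable_funM.
Qed.

Let normal_density : probability_density (normal_pdf (0 : R) 1).
Proof.
split; first exact: measurable_normal_pdf.
  by move=> x; exact: normal_pdf_ge0.
exact: integral_normal_pdf.
Qed.

Let Z_cf t : Ec (fun w => cexpi (t * Z w)) = psi t.
Proof.
rewrite (cintegral_cexpi_density normal_density Z_normal) /density_cf.
have c0 := @sqrt2pi_gt0 R.
have pdfE (x : R) : normal_pdf 0 1 x = (Num.sqrt (2 * pi))^-1 * gaussian 1 x.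
  by rewrite normal_pdf_gaussian// mul1r subr0.
have isin : mu.-integrable [set: R] (EFin \o (fun x => sin (t * x) * gaussian 1 x)).
  apply: (@integrable_gaussianM _ _ _ 1) => //; last by move=> x; exact: sin_max.
  by case: (@bounded_measurable_sin R _ R (fun x => t * x)) => //; exact: measurable_funM.
apply: complexP; rewrite /cintegral /=.
  rewrite (@eq_Rintegral _ _ _ mu _ (fun x => (Num.sqrt (2 * pi))^-1 * (cos (t * x) * gaussian 1 x))).
    rewrite RintegralZl//; last exact: integrable_cos_gaussian.
    rewrite gaussian_transform// expr1n !mul1r mulKf// gt_eqF//.
  by move=> x _; rewrite pdfE expR0 mulr0 subr0 mul1r mulrCA.
rewrite (@eq_Rintegral _ _ _ mu _ (fun x => (Num.sqrt (2 * pi))^-1 * (sin (t * x) * gaussian 1 x))).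
  rewrite RintegralZl// Rintegral_odd ?mulr0// => x.
  by rewrite mulrN sinN mulNr /gaussian sqrrN.
by move=> x _; rewrite pdfE expR0 mulr0 add0r mul1r mulrCA.
Qed.

Let term_cf k t : Ec (fun w => (\1_(N_ k) w)%:C * cexpi (t * S w)) =
  (p k)%:C * phi t ^+ k * psi t.
Proof.
have bc : cbounded_measurable (fun x : R => cexpi (t * x)).
  by apply: cbounded_measurable_cexpi; exact: measurable_funM.
have := NWZ_cintegral k (mWsum k) (@sigma_Wsum k) bc bc.
rewrite Wsum_cf Z_cf mulrA => <-.
apply: eq_cintegral => w; rewrite indicE; have [wk|wk] := boolP (w \in N_ k).
  by rewrite inE in wk; rewrite (SN wk) /S_ mulrDr cexpiD.
by rewrite !mul0r.
Qed.

(** On a given outcome all the terms of index larger than N vanish. *)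
Let cvg_indic_sum (g : T -> R) w :
  \sum_(0 <= k < K) \1_(N_ k) w * g w @[K --> \oo] --> g w.
Proof.
apply: cvg_near_cst; near=> K.
have NK : (N w < K)%N by near: K; exact: nbhs_infty_gt.
rewrite (bigD1_seq (N w)) ?mem_index_iota ?iota_uniq//= indicE mem_set// mul1r.
rewrite big1_seq ?addr0// => k /andP[kN _]; rewrite indicE memNset ?mul0r//.
by move=> /= h; rewrite h eqxx in kN.
Unshelve. all: end_near. Qed.

Let indic_sum_le1 w K : 0 <= \sum_(0 <= k < K) (\1_(N_ k) w : R) <= 1.
Proof.
apply/andP; split; first by apply: sumr_ge0 => k _; rewrite indicE.
have [NK|KN] := ltnP (N w) K.
  rewrite (bigD1_seq (N w)) ?mem_index_iota ?iota_uniq//= indicE mem_set//.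
  rewrite big1_seq ?addr0// => k /andP[kN _]; rewrite indicE memNset//.
  by move=> /= h; rewrite h eqxx in kN.
rewrite big1_seq// => k; rewrite mem_index_iota => /andP[_ kK].
rewrite indicE memNset// => /= h; by move: kK; rewrite -h ltnNge KN.
Qed.

Let cvg_Rintegral_indic (g : T -> R) : bounded_measurable g ->
  \sum_(0 <= k < K) \int[P]_w (\1_(N_ k) w * g w) @[K --> \oo] --> \int[P]_w g w.
Proof.
move=> bg; have [mg [B gB]] := bg.
have bt k : bounded_measurable (fun w => \1_(N_ k) w * g w).
  by apply: bounded_measurableM => //; exact: bounded_measurable_indic.
under eq_fun do rewrite -bint_sum//.
apply: (cvg_Rintegral_dominated (g := fun=> B) measurableT _ _ _ _).2.
- by move=> K; case: (bounded_measurable_sum (index_iota 0 K) bt).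
- by move=> w _; exact: cvg_indic_sum.
- by apply: bounded_measurable_integrable; exact: bounded_measurable_cst.
- move=> K w _; have /andP[s0 s1] := indic_sum_le1 w K.
  rewrite -mulr_suml normrM (ger0_norm s0) -[leRHS]mul1r ler_pM//.
Qed.

(** On the event N = k the contribution is p k * phi t ^+ k * psi t, by
    independence; summing over k yields an exponential series. *)
Lemma compound_sum_cf t :
  Ec (fun w => cexpi (t * S w)) = cexp (lambda%:C * (phi t - 1)) * psi t.
Proof.
pose a K := \sum_(0 <= k < K) (p k)%:C * phi t ^+ k * psi t.
have bS : cbounded_measurable (fun w => cexpi (t * S w)).
  apply: cbounded_measurable_cexpi; apply: measurable_funM => //.
  exact: measurable_compound_sum.
have aRe : cRe (a K) @[K --> \oo] --> cRe (Ec (fun w => cexpi (t * S w))).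
  have := cvg_Rintegral_indic bS.1; apply: cvg_trans; apply: near_eq_cvg; near=> K.
  rewrite /a Re_sum; apply: eq_bigr => k _; rewrite -term_cf /=.
  by apply: eq_Rintegral => w _; rewrite mul0r subr0.
have aIm : cIm (a K) @[K --> \oo] --> cIm (Ec (fun w => cexpi (t * S w))).
  have := cvg_Rintegral_indic bS.2; apply: cvg_trans; apply: near_eq_cvg; near=> K.
  rewrite /a Im_sum; apply: eq_bigr => k _; rewrite -term_cf /=.
  by apply: eq_Rintegral => w _; rewrite mul0r addr0.
set z := _ * psi t.
have aE K : a K - z = (expR (- lambda))%:C * psi t *
    (\sum_(0 <= k < K) (k`!%:R^-1)%:C * (lambda%:C * phi t) ^+ k - cexp (lambda%:C * phi t)).
  rewrite mulrBr; congr (_ - _).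
    rewrite /a mulr_sumr; apply: eq_bigr => k _.
    rewrite pE exprMn -rmorphXn /= !rmorphM /=; ring.
  by rewrite /z mulrBr mulr1 cexpD -rmorphN cexp_real; ring.
have az : normc (a K - z) @[K --> \oo] --> (0 : R).
  under eq_fun do rewrite aE Normc.normcM.
  rewrite -(mulr0 (normc ((expR (- lambda))%:C * psi t))).
  by apply: cvgMr; exact: cvg_exp_series.
have cz (F : R[i] -> R) : (forall u v, F (u - v) = F u - F v) ->
    (forall u, `|F u| <= normc u) -> F (a K) @[K --> \oo] --> F z.
  move=> FB Fn; apply/subr_cvg0; apply: norm_cvg0.
  apply: (squeeze_cvgr _ (cvg_cst 0) az); near=> K.
  by rewrite normr_ge0 -FB Fn.
apply: complexP.
  apply: (cvg_unique _ aRe) => //; apply: cz; last exact: normr_Re_le.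
  by move=> u v; rewrite cReD cReN.
apply: (cvg_unique _ aIm) => //; apply: cz; last exact: normr_Im_le.
by move=> u v; rewrite cImD cImN.
Unshelve. all: end_near. Qed.

Hypothesis first_moment : mu.-integrable [set: R] (EFin \o (fun x => `|x| * f x)).

Let mean_W := \int[mu]_x (`|x| * f x).
Let mean_Z := \int[mu]_x (`|x| * normal_pdf 0 1 x).

Let Z_first_moment : mu.-integrable [set: R] (EFin \o (fun x => `|x| * normal_pdf 0 1 x)).
Proof.
apply: (eq_integrable measurableT) (integrableZl measurableT (Num.sqrt (2 * pi))^-1 (integrable_id_gaussian ltr01)) => //= x _.
by rewrite /= -EFinM normal_pdf_gaussian// mul1r subr0 mulrCA.
Qed.

Let bmin (m : nat) (Y : T -> R) : measurable_fun [set: T] Y ->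
  bounded_measurable (fun w => Num.min `|Y w| m%:R).
Proof.
move=> mY; split; first by apply: measurable_minr => //; exact: measurableT_comp.
exists m%:R => x; rewrite ger0_norm ?ge_min ?lexx ?orbT//.
Qed.

Let bmin0 (m : nat) : bounded_measurable (fun x : R => Num.min `|x| m%:R).
Proof.
split; first by apply: measurable_minr => //; exact: measurableT_comp.
exists m%:R => x; rewrite ger0_norm ?ge_min ?lexx ?orbT//.
Qed.

Let term_mean_W k j m : \int[P]_w (\1_(N_ k) w * Num.min `|W j w| m%:R) <= p k * mean_W.
Proof.
have b1 : @cbounded_measurable R _ R (fun=> 1) by exact: cbounded_measurable_cst.
have := NWZ_cintegral k (mW j) (@sigma_W j) (cbounded_measurable_real (bmin0 m)) b1.
rewrite (cintegral_real P (fun w => Num.min `|W j w| m%:R)).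
rewrite (_ : Ec (fun=> 1) = 1); last first.
  by rewrite (cintegral_real P (fun=> 1)) bint_cst.
rewrite (eq_cintegral _ (G := fun w => (\1_(N_ k) w * Num.min `|W j w| m%:R)%:C)); last first.
  by move=> w; rewrite mulr1 -rmorphM.
rewrite (cintegral_real P (fun w => \1_(N_ k) w * Num.min `|W j w| m%:R)) mulr1 -rmorphM => -[->].
by rewrite ler_wpM2l// (truncated_first_moment_le f_density (W_density j)).
Qed.

Let term_mean_Z k m : \int[P]_w (\1_(N_ k) w * Num.min `|Z w| m%:R) <= p k * mean_Z.
Proof.
have b1 : @cbounded_measurable R _ R (fun=> 1) by exact: cbounded_measurable_cst.
have := NWZ_cintegral k (mW 0%N) (@sigma_W 0%N) b1 (cbounded_measurable_real (bmin0 m)).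
rewrite (cintegral_real P (fun w => Num.min `|Z w| m%:R)).
rewrite (_ : Ec (fun=> 1) = 1); last first.
  by rewrite (cintegral_real P (fun=> 1)) bint_cst.
rewrite (eq_cintegral _ (G := fun w => (\1_(N_ k) w * Num.min `|Z w| m%:R)%:C)); last first.
  by move=> w; rewrite mul1r -rmorphM.
rewrite (cintegral_real P (fun w => \1_(N_ k) w * Num.min `|Z w| m%:R)) mul1r -rmorphM => -[->].
by rewrite ler_wpM2l// (truncated_first_moment_le normal_density Z_normal).
Qed.

Let sum_p_le1 K : \sum_(0 <= k < K) p k <= 1.
Proof.
have bi k : bounded_measurable (\1_(N_ k) : T -> R) by exact: bounded_measurable_indic.
have -> : \sum_(0 <= k < K) p k = \int[P]_w (\sum_(0 <= k < K) \1_(N_ k) w).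
  rewrite bint_sum//; apply: eq_bigr => k _; rewrite bint_indic//.
  by have := N_poisson k; rewrite /distribution /pushforward => ->.
rewrite -[leRHS](bint_cst P); apply: bint_le.
- exact: bounded_measurable_sum.
- exact: bounded_measurable_cst.
- by move=> w; case/andP: (indic_sum_le1 w K).
Qed.

Let sum_kp_le K : \sum_(0 <= k < K) k%:R * p k <= lambda.
Proof.
case: K => [|K]; first by rewrite big_geq// ltW.
rewrite big_nat_recl// mul0r add0r (_ : \sum_(0 <= i < K) _ = lambda * \sum_(0 <= k < K) p k).
  by rewrite -[leRHS]mulr1 ler_wpM2l// ltW.
rewrite mulr_sumr; apply: eq_bigr => k _; rewrite !pE exprS factS natrM invfM.
rewrite (_ : _ * _ = (k.+1%:R * k.+1%:R^-1) * (lambda * (expR (- lambda) * (lambda ^+ k / k`!%:R)))).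
  by rewrite mulfV ?mul1r// pnatr_eq0.
ring.
Qed.

Let mean_ge0 (g : R -> R) : (forall x, 0 <= g x) -> 0 <= \int[mu]_x (`|x| * g x).
Proof. by move=> g0; apply: Rintegral_ge0 => x _; rewrite mulr_ge0. Qed.

Let truncated_mean_le m : \int[P]_w Num.min `|S w| m%:R <= lambda * mean_W + mean_Z.
Proof.
have mS := measurable_compound_sum.
have bW k j : bounded_measurable (fun w => \1_(N_ k) w * Num.min `|W j w| m%:R).
  by apply: bounded_measurableM; [exact: bounded_measurable_indic|exact: bmin].
have bZ k : bounded_measurable (fun w => \1_(N_ k) w * Num.min `|Z w| m%:R).
  by apply: bounded_measurableM; [exact: bounded_measurable_indic|exact: bmin].
have mean_W0 : 0 <= mean_W by apply: mean_ge0; case: f_density.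
have mean_Z0 : 0 <= mean_Z by apply: mean_ge0; case: normal_density.
have cS := cvg_Rintegral_indic (bmin m mS).
rewrite -(cvg_lim _ cS)//; apply: limr_le; first by apply/cvg_ex; eexists; exact: cS.
near=> K.
apply: (@le_trans _ _ (\sum_(0 <= k < K) (k%:R * p k * mean_W + p k * mean_Z))); last first.
  rewrite big_split/= -!mulr_suml lerD// ?ler_wpM2r//.
  by rewrite -[leRHS]mul1r ler_wpM2r.
apply: ler_sum => k _.
apply: (@le_trans _ _ (\int[P]_w (\sum_(0 <= j < k) \1_(N_ k) w * Num.min `|W j w| m%:R + \1_(N_ k) w * Num.min `|Z w| m%:R))).
  apply: bint_le.
  - by apply: bounded_measurableM; [exact: bounded_measurable_indic|exact: bmin].
  - by apply: bounded_measurableD => //; exact: bounded_measurable_sum.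
  - move=> w; rewrite -mulr_sumr -mulrDr indicE; have [wk|_] := boolP (w \in N_ k); last by rewrite !mul0r.
    rewrite inE in wk; rewrite !mul1r (SN wk) /S_ (le_trans (min_normD _ _ _))// lerD2r.
    exact: min_norm_sum.
rewrite bintD//; last exact: bounded_measurable_sum.
rewrite bint_sum//; apply: lerD; last exact: term_mean_Z.
apply: (@le_trans _ _ (\sum_(0 <= j < k) p k * mean_W)); first by apply: ler_sum => j _; exact: term_mean_W.
by rewrite sumr_const_nat subn0 -mulrA mulr_natl.
Unshelve. all: end_near. Qed.

(** The truncations min (`|x|, m) are subadditive and bounded, so that the
    expectation of the truncated sum on each event N = k is controlled by
    independence for bounded functions; the bound is uniform in m and monotone
    convergence applies. *)
Lemma integrable_compound_sum : P.-integrable [set: T] (EFin \o S).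
Proof.
have mS := measurable_compound_sum.
apply/integrableP; split; first exact/measurable_EFinP.
pose g m w : \bar R := (Num.min `|S w| m%:R)%:E.
have gE w : limn (g ^~ w) = `|(EFin \o S) w|%E.
  apply/cvg_lim => //; apply: cvg_near_cst; near=> m.
  rewrite /g /=; congr (_%:E); apply/min_idPl.
  by near: m; exact: nbhs_infty_ger.
under eq_integral do rewrite -gE.
rewrite monotone_convergence//.
- apply: (@le_lt_trans _ _ (lambda * mean_W + mean_Z)%:E); last by rewrite ltry.
  apply: lime_le.
    apply: ereal_nondecreasing_is_cvgn => a b ab; apply: ge0_le_integral => //.
    + by move=> w _; rewrite lee_fin le_min normr_ge0 ler0n.
    + by apply/measurable_EFinP; case: (bmin a mS).
    + by apply/measurable_EFinP; case: (bmin b mS).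
    + move=> w _; rewrite lee_fin le_min ge_min lexx/= ge_min.
      by rewrite ler_nat ab orbT.
  near=> m.
  have ig : P.-integrable [set: T] (g m) by exact: (bounded_measurable_integrable _ (bmin m mS)).
  by rewrite -(fineK (integrable_fin_num measurableT ig)) lee_fin truncated_mean_le.
- by move=> m; apply/measurable_EFinP; case: (bmin m mS).
- by move=> m w _; rewrite lee_fin le_min normr_ge0 ler0n.
- move=> w _ a b ab; rewrite lee_fin le_min ge_min lexx/= ge_min.
  by rewrite ler_nat ab orbT.
Unshelve. all: end_near. Qed.

End CompoundPoisson.

(** * Linearization of the estimator for a fixed sample *)

Section ComplexFunctionsOfReal.
Context {R : realType}.
Local Open Scope complex_scope.
Local Notation cRe := (@complex.Re R).
Local Notation cIm := (@complex.Im R).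
Local Notation normc := (@Normc.normc R).
Implicit Types F G : R -> R[i].

Definition ccontinuous F :=
  continuous (fun t => cRe (F t)) /\ continuous (fun t => cIm (F t)).

Lemma ccontinuous_cst c : ccontinuous (fun=> c).
Proof. by split => t; exact: cvg_cst. Qed.

Lemma ccontinuousD F G : ccontinuous F -> ccontinuous G -> ccontinuous (fun t => F t + G t).
Proof.
move=> [F1 F2] [G1 G2]; split => t.
  by under eq_fun do rewrite cReD; apply: cvgD; [exact: F1|exact: G1].
by under eq_fun do rewrite cImD; apply: cvgD; [exact: F2|exact: G2].
Qed.

Lemma ccontinuousN F : ccontinuous F -> ccontinuous (fun t => - F t).
Proof.
move=> [F1 F2]; split => t.
  by under eq_fun do rewrite cReN; apply: cvgN; exact: F1.
by under eq_fun do rewrite cImN; apply: cvgN; exact: F2.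
Qed.

Lemma ccontinuousM F G : ccontinuous F -> ccontinuous G -> ccontinuous (fun t => F t * G t).
Proof.
move=> [F1 F2] [G1 G2]; split => t.
  under eq_fun do rewrite cReM; apply: cvgB; apply: cvgM;
    [exact: F1|exact: G1|exact: F2|exact: G2].
under eq_fun do rewrite cImM; apply: cvgD; apply: cvgM;
  [exact: F1|exact: G2|exact: F2|exact: G1].
Qed.

Lemma ccontinuous_sum (I : Type) (s : seq I) (F : I -> R -> R[i]) :
  (forall i, ccontinuous (F i)) -> ccontinuous (fun t => \sum_(i <- s) F i t).
Proof.
move=> cF; elim: s => [|i s ih].
  by under eq_fun do rewrite big_nil; exact: ccontinuous_cst.
by under eq_fun do rewrite big_cons; exact: ccontinuousD.
Qed.

Lemma ccontinuous_real (f : R -> R) : continuous f -> ccontinuous (fun t => (f t)%:C).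
Proof. by move=> cf; split => //= t; exact: cvg_cst. Qed.

Lemma ccontinuous_cexp F : ccontinuous F -> ccontinuous (fun t => cexp (F t)).
Proof.
move=> [F1 F2]; split => t /=.
  apply: cvgM.
    exact: (continuous_comp (F1 t) (@continuous_expR _ _)).
  exact: (continuous_comp (F2 t) (@continuous_cos _ _)).
apply: cvgM.
  exact: (continuous_comp (F1 t) (@continuous_expR _ _)).
exact: (continuous_comp (F2 t) (@continuous_sin _ _)).
Qed.

Lemma ccontinuous_cexpi (a : R) : ccontinuous (fun t => cexpi (t * a)).
Proof.
apply: ccontinuous_cexp; split => t /=; first exact: cvg_cst.
by apply: cvgMl; exact: cvg_id.
Qed.

Lemma continuous_normc F : ccontinuous F -> continuous (fun t => normc (F t)).
Proof.
move=> [F1 F2] t; under eq_fun do rewrite normc_ReIm.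
apply: (continuous_comp (f := fun t => cRe (F t) ^+ 2 + cIm (F t) ^+ 2) (g := Num.sqrt)); last exact: sqrt_continuous.
apply: cvgD.
  exact: (continuous_comp (F1 t) (@exprn_continuous _ 2 _)).
exact: (continuous_comp (F2 t) (@exprn_continuous _ 2 _)).
Qed.

Local Notation mu := (@lebesgue_measure R).

Lemma integrable_continuous_itv (g : R -> R) (a b : R) : {within `[a, b], continuous g} ->
  mu.-integrable `[a, b] (EFin \o g).
Proof. by move=> cg; apply: continuous_compact_integrable => //; exact: segment_compact. Qed.

Lemma normc_cexpiB_le (a b : R) : normc (cexpi a - cexpi b) <= 2 * `|a - b|.
Proof.
rewrite (le_trans (normc_le_ReIm _))// mulr_natl mulr2n cReD cImD cReN cImN.
by rewrite !Re_cexpi !Im_cexpi lerD ?normr_cosB_le ?normr_sinB_le.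
Qed.

Lemma empirical_cf_lipschitz n (x : nat -> R) s t :
  normc (empirical_cf n x s - empirical_cf n x t) <=
  2 * (n%:R^-1 * \sum_(0 <= j < n) `|x j|) * `|s - t|.
Proof.
have -> : empirical_cf n x s - empirical_cf n x t =
    (n%:R^-1)%:C * \sum_(0 <= j < n) (cexpi (s * x j) - cexpi (t * x j)).
  rewrite /empirical_cf -mulrBr -sumrB big_mkord; congr (_ * _).
  by rewrite fmorphV /= rmorph_nat.
rewrite Normc.normcM normc_real ger0_norm ?invr_ge0//.
rewrite [leRHS](_ : _ = n%:R^-1 * (\sum_(0 <= j < n) 2 * (`|s - t| * `|x j|))); last first.
  by rewrite -mulr_sumr -mulr_sumr; move: (\sum_(0 <= j < n) _) => q; ring.
rewrite ler_wpM2l ?invr_ge0// (le_trans (normc_sum _ _))// ler_sum// => j _.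
by rewrite (le_trans (normc_cexpiB_le _ _))// -mulrBl normrM.
Qed.

(** Let phi_X be the characteristic function exp (lambda (phi - 1) - t^2 / 2)
    of the observations, whose inverse is inv_cf, and let r be the inverse of
    the bandwidth. On [-r, r] the function under the logarithm is exp (lambda
    phi) (1 + z), where 1 + z is the quotient of the empirical characteristic
    function by phi_X. As long as `|z| <= 1/2, the estimator is therefore the
    transform of lambda phi, plus that of z, up to the quadratic error of log
    (1 + z). *)
Section Linearization.
Variables (lambda r v : R) (n : nat) (x : nat -> R) (y : R) (phi : R -> R[i]).
Hypothesis lambda_gt0 : 0 < lambda.
Hypothesis r_gt0 : 0 < r.
Hypothesis phi_continuous : ccontinuous phi.
Hypothesis phi0 : phi 0 = 1.

Definition inv_cf t : R[i] := cexp (lambda%:C * (1 - phi t)) * (expR (t ^+ 2 / 2))%:C.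

Definition relative_error t : R[i] := empirical_cf n x t * inv_cf t - 1.
Local Notation z := relative_error.

Lemma ccontinuous_inv_cf : ccontinuous inv_cf.
Proof.
apply: ccontinuousM.
  apply: ccontinuous_cexp; apply: ccontinuousM; first exact: ccontinuous_cst.
  by apply: ccontinuousD; [exact: ccontinuous_cst|exact: ccontinuousN].
apply: ccontinuous_real => t.
apply: (continuous_comp (f := fun t : R => t ^+ 2 / 2) (g := @expR R)); last exact: continuous_expR.
by apply: cvgMl; exact: exprn_continuous.
Qed.

Lemma ccontinuous_empirical_cf : ccontinuous (empirical_cf n x).
Proof.
apply: ccontinuousM; first exact: ccontinuous_cst.
by apply: ccontinuous_sum => j; exact: ccontinuous_cexpi.
Qed.

Lemma ccontinuous_relative_error : ccontinuous z.
Proof.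
apply: ccontinuousD; last exact: ccontinuous_cst.
by apply: ccontinuousM; [exact: ccontinuous_empirical_cf|exact: ccontinuous_inv_cf].
Qed.

Lemma normc_inv_cf_le t : normc (phi t) <= 1 ->
  normc (inv_cf t) <= expR (2 * lambda) * expR (t ^+ 2 / 2).
Proof.
move=> h; rewrite /inv_cf Normc.normcM normc_cexp normc_real gtr0_norm ?expR_gt0//.
rewrite ler_wpM2r ?expR_ge0// ler_expR cReM /= mul0r subr0 mulrC ler_wpM2r ?(ltW lambda_gt0)//.
rewrite cReD cReN /=; have := le_trans (normr_Re_le (phi t)) h.
by rewrite ler_norml => /andP[]; lra.
Qed.

Hypothesis n_gt0 : (0 < n)%N.

Lemma empirical_cf0 : empirical_cf n x 0 = 1.
Proof.
rewrite /empirical_cf (eq_bigr (fun=> 1)); last first.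
  by move=> j _; rewrite mul0r -[RHS]cexp0.
by rewrite sumr_const card_ord mulVf// pnatr_eq0 -lt0n.
Qed.

Lemma relative_error0 : z 0 = 0.
Proof.
rewrite /z empirical_cf0 /inv_cf phi0 subrr mulr0 cexp0 expr0n mul0r expR0.
by rewrite !mul1r subrr.
Qed.

Lemma cf_ratio_relative_error t : t \in `[- r, r] ->
  cf_ratio lambda r^-1 n x t = cexp (lambda%:C * phi t) * (1 + z t).
Proof.
rewrite in_itv/= => tr.
rewrite /cf_ratio /sinc_kernel_ft indicE mem_set /=; last first.
  by rewrite in_itv/= ler_pdivlMl// mulrN1 ler_pdivrMl// mulr1.
rewrite mulr1 /z addrC subrK mulrCA; congr (_ * _).
rewrite /inv_cf mulrA -cexpD -mulrDr addrC subrK mulr1 cexp_real -rmorphM.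
by rewrite -fmorphV /= invfM -!expRN !opprK.
Qed.

Hypothesis z_le : forall t, t \in `[- r, r] -> normc (z t) <= 2^-1.

Lemma fnh_perturb :
  fnh lambda v r^-1 n x y = (2 * pi * lambda)^-1 *
    \int[mu]_(t in `[- r, r]) cRe (cexpi (- (t * y)) * (lambda%:C * phi t + clog (1 + z t))).
Proof.
have cz := ccontinuous_relative_error.
have dl : is_distinguished_log (cf_ratio lambda r^-1 n x) r lambda%:C
    (fun t => lambda%:C * phi t + clog (1 + z t)).
  have := @distinguished_log_perturb R (cf_ratio lambda r^-1 n x) (fun t => lambda%:C * phi t) z r.
  rewrite phi0 mulr1; apply.
  - apply: continuous_subspaceT; apply/continuous_complexP.
    by apply: ccontinuousM => //; exact: ccontinuous_cst.
  - by apply: continuous_subspaceT; exact/continuous_complexP.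
  - exact: cf_ratio_relative_error.
  - exact: z_le.
  - exact: relative_error0.
rewrite /fnh invrK; case: asboolP => [_|]; last first.
  case=> t tr; rewrite cf_ratio_relative_error// mulf_neq0 ?cexp_neq0//.
  by apply/eqP => e; have := Re_gt0_of_near1 (z_le tr); rewrite e /= ltxx.
congr (_ * _); apply: eq_Rintegral => t; rewrite inE /= => tr.
by rewrite (distinguished_logE (ltW r_gt0) dl).
Qed.

Definition limit_part := (2 * pi * lambda)^-1 *
  \int[mu]_(t in `[- r, r]) cRe (cexpi (- (t * y)) * (lambda%:C * phi t)).
Definition linear_part := (2 * pi * lambda)^-1 *
  \int[mu]_(t in `[- r, r]) cRe (cexpi (- (t * y)) * z t).

Lemma fnh_linearization :
  `|fnh lambda v r^-1 n x y - limit_part - linear_part| <=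
  (2 * pi * lambda)^-1 * (40 * \int[mu]_(t in `[- r, r]) normc (z t) ^+ 2).
Proof.
have cz := ccontinuous_relative_error.
have ce : ccontinuous (fun t => cexpi (- (t * y))).
  by under eq_fun do rewrite -mulrN; exact: ccontinuous_cexpi.
have i1 : mu.-integrable `[- r, r] (EFin \o (fun t => cRe (cexpi (- (t * y)) * (lambda%:C * phi t)))).
  apply: integrable_continuous_itv; apply: continuous_subspaceT.
  suff [] : ccontinuous (fun t => cexpi (- (t * y)) * (lambda%:C * phi t)) by [].
  by apply: ccontinuousM => //; apply: ccontinuousM => //; exact: ccontinuous_cst.
have i2 : mu.-integrable `[- r, r] (EFin \o (fun t => cRe (cexpi (- (t * y)) * z t))).
  apply: integrable_continuous_itv; apply: continuous_subspaceT.
  by have [] := ccontinuousM ce cz.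
have cl : {within `[- r, r], continuous (fun t => clog (1 + z t) : R[i]^o)}.
  apply/subspace_continuousP => t tr.
  apply: cvg_clog; first exact: Re_gt0_of_near1 (z_le tr).
  apply: cvgD; first exact: cvg_cst.
  have /continuous_complexP /(_ t) := cz.
  by apply: cvg_trans; apply: cvg_app; exact: cvg_within.
have i3 : mu.-integrable `[- r, r] (EFin \o (fun t => cRe (cexpi (- (t * y)) * clog (1 + z t)))).
  apply: integrable_continuous_itv.
  have /within_continuous_complexP [l1 l2] := cl; case: ce => e1 e2.
  rewrite (_ : (fun t => _) = (fun t => cRe (cexpi (- (t * y))) * cRe (clog (1 + z t)) -
      cIm (cexpi (- (t * y))) * cIm (clog (1 + z t)))); last by apply/funext => t; rewrite cReM.
  have wM (g k : R -> R) : continuous g -> {within `[- r, r], continuous k} ->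
      {within `[- r, r], continuous (fun t => g t * k t)}.
    by move=> cg ck t; apply: cvgM; [exact: (continuous_subspaceT cg)|exact: ck].
  by move=> t; apply: cvgB; [exact: (wM _ _ e1 l1)|exact: (wM _ _ e2 l2)].
have i4 : mu.-integrable `[- r, r] (EFin \o (fun t => normc (z t) ^+ 2)).
  apply: integrable_continuous_itv; apply: continuous_subspaceT => t.
  apply: (@continuous_comp _ _ _ (fun t => normc (z t)) (fun u : R => u ^+ 2)); [exact: continuous_normc cz t|exact: exprn_continuous].
have -> : fnh lambda v r^-1 n x y - limit_part - linear_part = (2 * pi * lambda)^-1 *
    \int[mu]_(t in `[- r, r]) (cRe (cexpi (- (t * y)) * clog (1 + z t)) - cRe (cexpi (- (t * y)) * z t)).
  rewrite fnh_perturb /limit_part /linear_part -!mulrBr; congr (_ * _).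
  rewrite RintegralB//.
  rewrite (_ : \int[mu]_(t in `[- r, r]) cRe (cexpi (- (t * y)) * (lambda%:C * phi t + clog (1 + z t))) =
      \int[mu]_(t in `[- r, r]) (cRe (cexpi (- (t * y)) * (lambda%:C * phi t)) + cRe (cexpi (- (t * y)) * clog (1 + z t)))).
    by rewrite RintegralD// [X in X - _]addrAC subrr add0r.
  by apply: eq_Rintegral => t _; rewrite mulrDr cReD.
have c0 : 0 <= (2 * pi * lambda)^-1.
  by rewrite invr_ge0 !mulr_ge0 ?pi_ge0// ltW.
rewrite normrM (ger0_norm c0) ler_wpM2l//.
have iB : mu.-integrable `[- r, r] (EFin \o (fun t => cRe (cexpi (- (t * y)) * clog (1 + z t)) -
    cRe (cexpi (- (t * y)) * z t))) by exact: (integrableB _ i3 i2).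
apply: (le_trans (le_normr_Rintegral _ iB)) => //.
rewrite -RintegralZl//; apply: le_Rintegral => //.
- exact: (integrable_norm iB).
- exact: (integrableZl _ 40 i4).
move=> t tr; rewrite -cReN -cReD -mulrBr (le_trans (normr_Re_le _))//.
rewrite Normc.normcM normc_cexpi mul1r; apply: normc_clog1D_sub_le.
exact: z_le.
Qed.

End Linearization.
End ComplexFunctionsOfReal.

(** * Mean of the linearization error *)

Lemma sum4_lt1 {R : realType} (a b c e : R) : 0 <= a -> 0 <= b -> 0 <= c -> 0 <= e ->
  a + b + (c + e) < 1 -> [/\ a < 1, b < 1, c < 1 & e < 1].
Proof. by move=> *; split; lra. Qed.

Lemma integrable_sumr {R : realType} d (T : measurableType d)
    (nu : {measure set T -> \bar R}) (D : set T) (F : nat -> T -> R) m :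
  measurable D -> (forall j, nu.-integrable D (EFin \o F j)) ->
  nu.-integrable D (EFin \o (fun x => \sum_(0 <= j < m) F j x)).
Proof.
move=> mD iF; rewrite (_ : EFin \o _ = (fun x => \sum_(0 <= j < m) (F j x)%:E)%E).
  by apply: integrable_sum => // j _; exact: iF.
by apply/funext => x /=; rewrite sumEFin.
Qed.

Lemma Rintegral_sum {R : realType} d (T : measurableType d)
    (nu : {measure set T -> \bar R}) (D : set T) (F : nat -> T -> R) m :
  measurable D -> (forall j, nu.-integrable D (EFin \o F j)) ->
  \int[nu]_(x in D) (\sum_(0 <= j < m) F j x) = \sum_(0 <= j < m) \int[nu]_(x in D) F j x.
Proof.
move=> mD iF; elim: m => [|m ih].
  rewrite big_geq//; under eq_Rintegral do rewrite big_geq//.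
  by rewrite /Rintegral integral0_eq.
rewrite big_nat_recr//= -ih -RintegralD//; last exact: integrable_sumr.
by apply: eq_Rintegral => x _; rewrite big_nat_recr.
Qed.

Lemma normr_le3 {R : realType} (a b c A B C : R) :
  `|a - b - c| <= A -> `|b| <= B -> `|c| <= C -> `|a| <= A + B + C.
Proof. by rewrite !ler_norml => /andP[? ?] /andP[? ?] /andP[? ?]; apply/andP; split; lra. Qed.

Section Fluctuations.
Context {R : realType} d (T : measurableType d) (P : probability T R).
Local Open Scope complex_scope.
Local Notation cRe := (@complex.Re R).
Local Notation cIm := (@complex.Im R).
Local Notation normc := (@Normc.normc R).
Local Notation mu := (@lebesgue_measure R).
Local Notation Ec := (cintegral P [set: T]).
Variable X : nat -> T -> R.
Hypothesis mX : forall i, measurable_fun [set: T] (X i).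
Hypothesis indX : independent_rvs P X.
Hypothesis idX : forall i (g : R -> R), bounded_measurable g ->
  \int[P]_w g (X i w) = \int[P]_w g (X 0 w).

Lemma bounded_measurable_expR d' (T' : measurableType d') (f : T' -> R) :
  bounded_measurable f -> bounded_measurable (fun x => expR (f x)).
Proof.
move=> [mf [B fB]]; split.
  by apply: measurableT_comp mf; exact: measurable_expR.
exists (expR B) => x; rewrite gtr0_norm ?expR_gt0// ler_expR.
by rewrite (le_trans (ler_norm _)).
Qed.

(** The integrand is at least 1 where the sum exceeds n * tau, so this bounds
    the probability of that event; bounding the integral rather than the
    probability lets the integrand itself be used as a majorant. From expR u <=
    1 + u + 2 u^2 the exponential moment of one summand at s is at most expR (8
    s^2), and s = tau / 16 minimizes 8 s^2 - s tau. *)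
Lemma chernoff (a : R -> R) (tau : R) n : bounded_measurable a ->
  (forall x, `|a x| <= 2) -> \int[P]_w a (X 0 w) = 0 -> 0 <= tau <= 4 ->
  \int[P]_w expR (tau / 16 * (\sum_(0 <= j < n) a (X j w) - n%:R * tau)) <=
  expR (- (n%:R * tau ^+ 2 / 32)).
Proof.
move=> ba a2 a0 /andP[t0 t4]; set s := tau / 16.
have s0 : 0 <= s by rewrite /s; lra.
have bsa : bounded_measurable (fun x => s * a x).
  by apply: bounded_measurableM => //; exact: bounded_measurable_cst.
have be : bounded_measurable (fun x => expR (s * a x)) by exact: bounded_measurable_expR.
have bX (g : R -> R) : bounded_measurable g -> bounded_measurable (fun w => g (X 0 w)).
  by move=> bg; exact: (bounded_measurable_comp (mX 0%N) bg).
have h1 : \int[P]_w expR (s * a (X 0 w)) <= expR (8 * s ^+ 2).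
  apply: (@le_trans _ _ (\int[P]_w (1 + s * a (X 0 w) + 8 * s ^+ 2))).
    apply: bint_le; first exact: (bX _ be).
      apply: (bX (fun x => 1 + s * a x + 8 * s ^+ 2)).
      by apply: bounded_measurableD; [apply: bounded_measurableD => //|]; exact: bounded_measurable_cst.
    move=> w; have := a2 (X 0 w); rewrite ler_norml => /andP[l1 l2].
    rewrite (le_trans (expR_le_quadratic _))//.
      have : s * a (X 0 w) <= s * 2 by rewrite ler_wpM2l.
      by rewrite /s; lra.
    have a4 : a (X 0 w) ^+ 2 <= 2 ^+ 2.
      by rewrite -real_normK ?num_real// lerXn2r ?nnegrE.
    rewrite lerD2l exprMn (_ : 8 * s ^+ 2 = 2 * (s ^+ 2 * 2 ^+ 2)); last by ring.
    by rewrite ler_wpM2l// ler_wpM2l ?sqr_ge0.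
  have b1 : bounded_measurable (fun w => 1 + s * a (X 0 w)).
    by apply: bounded_measurableD; [exact: bounded_measurable_cst|exact: (bX _ bsa)].
  rewrite bintD//; last exact: bounded_measurable_cst.
  rewrite bintD; [|exact: bounded_measurable_cst|exact: (bX _ bsa)].
  by rewrite (bintZ _ s (bX _ ba)) a0 !bint_cst mulr0 addr0 expR_ge1Dx.
have -> : (fun w => expR (s * (\sum_(0 <= j < n) a (X j w) - n%:R * tau))) =
    (fun w => expR (- (s * (n%:R * tau))) * \prod_(0 <= j < n) expR (s * a (X j w))).
  apply/funext => w; rewrite mulrBr expRD mulrC; congr (_ * _).
  by rewrite mulr_sumr expR_sum.
rewrite bintZ; last first.
  by apply: bounded_measurable_prod => j _; exact: (bounded_measurable_comp (mX j) be).
rewrite (iid_Rintegral_prod mX indX idX n be).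
apply: (@le_trans _ _ (expR (- (s * (n%:R * tau))) * expR (8 * s ^+ 2) ^+ n)).
  rewrite ler_wpM2l ?expR_ge0// lerXn2r ?nnegrE ?expR_ge0//.
  by apply: Rintegral_ge0 => w _; exact: expR_ge0.
rewrite -expRM_natl -expRD ler_expR /s le_eqVlt; apply/orP; left; apply/eqP.
by field.
Qed.

Variables (m1 : R).
Hypothesis intX : forall j, P.-integrable [set: T] (EFin \o X j).
Hypothesis absX : forall j, \int[P]_w `|X j w| <= m1.

Variables (lambda : R) (phi : R -> R[i]).
Hypothesis lambda_gt0 : 0 < lambda.
Hypothesis phi_continuous : ccontinuous phi.
Hypothesis phi0 : phi 0 = 1.
Hypothesis phi_le1 : forall t, normc (phi t) <= 1.
Local Notation inv_cf := (inv_cf lambda phi).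
Hypothesis cfX : forall t, Ec (fun w => cexpi (t * X 0 w)) * inv_cf t = 1.

Local Notation Phi := (fun t : R => Ec (fun w => cexpi (t * X 0 w))).

Let m1_ge0 : 0 <= m1.
Proof. by rewrite (le_trans _ (absX 0))// Rintegral_ge0. Qed.

Let mcos t : bounded_measurable (fun x : R => cos (t * x)).
Proof. by apply: bounded_measurable_cos; exact: measurable_funM. Qed.

Let msin t : bounded_measurable (fun x : R => sin (t * x)).
Proof. by apply: bounded_measurable_sin; exact: measurable_funM. Qed.

Let bX (g : R -> R) : bounded_measurable g -> bounded_measurable (fun w => g (X 0 w)).
Proof. by move=> bg; exact: (bounded_measurable_comp (mX 0%N) bg). Qed.

Let RePhi t : cRe (Phi t) = \int[P]_w cos (t * X 0 w).
Proof. by apply: eq_Rintegral => w _; rewrite Re_cexpi. Qed.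

Let ImPhi t : cIm (Phi t) = \int[P]_w sin (t * X 0 w).
Proof. by apply: eq_Rintegral => w _; rewrite Im_cexpi. Qed.

Let RintegralB_le (g1 g2 : R -> R) c : bounded_measurable g1 -> bounded_measurable g2 ->
  0 <= c -> (forall x, `|g1 x - g2 x| <= c * `|x|) ->
  `|\int[P]_w g1 (X 0 w) - \int[P]_w g2 (X 0 w)| <= c * m1.
Proof.
move=> b1 b2 c0 h; rewrite -bintB; [|exact: (bX b1)|exact: (bX b2)].
have bB : bounded_measurable (fun w => g1 (X 0 w) - g2 (X 0 w)).
  by apply: bounded_measurableB; [exact: (bX b1)|exact: (bX b2)].
rewrite (le_trans (bint_norm_le _ bB))//.
apply: (@le_trans _ _ (\int[P]_w (c * `|X 0 w|))); last first.
  by rewrite RintegralZl ?ler_wpM2l//; exact: (integrable_norm (intX 0)).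
apply: le_Rintegral => //.
- exact: (bounded_measurable_integrable _ (bounded_measurable_norm bB)).
- exact: (integrableZl _ c (integrable_norm (intX 0))).
Qed.

Let Phi_lipschitz s t : normc (Phi s - Phi t) <= 2 * (`|s - t| * m1).
Proof.
rewrite (le_trans (normc_le_ReIm _))// mulr_natl mulr2n cReD cImD cReN cImN !RePhi !ImPhi.
apply: lerD; [apply: (RintegralB_le (mcos s) (mcos t))|apply: (RintegralB_le (msin s) (msin t))] => // x.
  by rewrite (le_trans (normr_cosB_le _ _))// -mulrBl normrM.
by rewrite (le_trans (normr_sinB_le _ _))// -mulrBl normrM.
Qed.

Let normc_Phi_le1 t : normc (Phi t) <= 1.
Proof.
apply: normc_cintegral_le => [|w]; last by rewrite normc_cexpi.
by apply: cbounded_measurable_cexpi; exact: measurable_funM.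
Qed.

Section FixedSampleSize.
Variables (n : nat) (r y v : R).
Hypothesis n_gt0 : (0 < n)%N.
Hypothesis r_gt0 : 0 < r.

Let n0 : (0 : R) < n%:R. Proof. by rewrite ltr0n. Qed.

Local Notation emp w t := (empirical_cf n (fun i => X i w) t).
Local Notation z w t := (relative_error lambda n (fun i => X i w) phi t).

Let zE w t : z w t = (emp w t - Phi t) * inv_cf t.
Proof. by rewrite mulrBl cfX. Qed.

Let Re_emp w t : cRe (emp w t) = n%:R^-1 * \sum_(0 <= j < n) cos (t * X j w).
Proof.
rewrite /empirical_cf cReM -[n%:R]/(n%:R : R[i]) -(rmorph_nat (real_complex R)) -fmorphV /= mul0r subr0 Re_sum big_mkord.
by congr (_ * _); apply: eq_bigr => j _; rewrite Re_cexpi.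
Qed.

Let Im_emp w t : cIm (emp w t) = n%:R^-1 * \sum_(0 <= j < n) sin (t * X j w).
Proof.
rewrite /empirical_cf cImM -[n%:R]/(n%:R : R[i]) -(rmorph_nat (real_complex R)) -fmorphV /= mul0r addr0 Im_sum big_mkord.
by congr (_ * _); apply: eq_bigr => j _; rewrite Im_cexpi.
Qed.

Let cosc t x := cos (t * x) - cRe (Phi t).
Let sinc t x := sin (t * x) - cIm (Phi t).

Let ReB w t : cRe (emp w t - Phi t) = n%:R^-1 * \sum_(0 <= j < n) cosc t (X j w).
Proof.
rewrite cReD cReN Re_emp /cosc sumrB mulrBr; congr (_ - _).
by rewrite sumr_const_nat subn0 -[cRe _ *+ n]mulr_natl mulKf// gt_eqF.
Qed.

Let ImB w t : cIm (emp w t - Phi t) = n%:R^-1 * \sum_(0 <= j < n) sinc t (X j w).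
Proof.
rewrite cImD cImN Im_emp /sinc sumrB mulrBr; congr (_ - _).
by rewrite sumr_const_nat subn0 -[cIm _ *+ n]mulr_natl mulKf// gt_eqF.
Qed.

Let bcosc t : bounded_measurable (cosc t).
Proof. by apply: bounded_measurableB => //; exact: bounded_measurable_cst. Qed.

Let bsinc t : bounded_measurable (sinc t).
Proof. by apply: bounded_measurableB => //; exact: bounded_measurable_cst. Qed.

Let cosc_le t x : `|cosc t x| <= 2.
Proof.
have h1 := cos_max (t * x); have h2 := le_trans (normr_Re_le _) (normc_Phi_le1 t).
by rewrite (le_trans (ler_normB _ _))// (le_trans (lerD h1 h2)).
Qed.

Let sinc_le t x : `|sinc t x| <= 2.
Proof.
have h1 := sin_max (t * x); have h2 := le_trans (normr_Im_le _) (normc_Phi_le1 t).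
by rewrite (le_trans (ler_normB _ _))// (le_trans (lerD h1 h2)).
Qed.

Let cosc0 t : \int[P]_w cosc t (X 0 w) = 0.
Proof.
rewrite /cosc bintB ?bint_cst ?RePhi ?subrr//; last exact: bounded_measurable_cst.
exact: (bX (mcos t)).
Qed.

Let sinc0 t : \int[P]_w sinc t (X 0 w) = 0.
Proof.
rewrite /sinc bintB ?bint_cst ?ImPhi ?subrr//; last exact: bounded_measurable_cst.
exact: (bX (msin t)).
Qed.

Let variance_le (a : R -> R) : bounded_measurable a -> (forall x, `|a x| <= 2) ->
  \int[P]_w a (X 0 w) = 0 ->
  \int[P]_w (n%:R^-1 * \sum_(0 <= j < n) a (X j w)) ^+ 2 <= 4 / n%:R.
Proof.
move=> ba a2 a0.
have bs : bounded_measurable (fun w => \sum_(0 <= j < n) a (X j w)).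
  by apply: bounded_measurable_sum => j; exact: (bounded_measurable_comp (mX j) ba).
have bs2 : bounded_measurable (fun w => (\sum_(0 <= j < n) a (X j w)) ^+ 2).
  by under eq_fun do rewrite expr2; exact: bounded_measurableM.
under eq_Rintegral do rewrite exprMn.
rewrite bintZ// (iid_variance_sum mX indX idX)//.
have h : \int[P]_w (a (X 0 w)) ^+ 2 <= 4.
  rewrite -[leRHS](bint_cst P); apply: bint_le.
  - apply: (bX (g := fun x => a x ^+ 2)).
    by under eq_fun do rewrite expr2; exact: bounded_measurableM.
  - exact: bounded_measurable_cst.
  - move=> w; rewrite -real_normK ?num_real// (_ : 4 = 2 ^+ 2); last by rewrite expr2; ring.
    by rewrite lerXn2r ?nnegrE.
rewrite [leLHS](_ : _ = \int[P]_w (a (X 0 w)) ^+ 2 / n%:R); last first.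
  by move: (\int[P]_w _) => q; field; rewrite gt_eqF.
by rewrite ler_wpM2r// invr_ge0 ltW.
Qed.

Let normc2_emp w t : normc (emp w t - Phi t) ^+ 2 =
  (n%:R^-1 * \sum_(0 <= j < n) cosc t (X j w)) ^+ 2 +
  (n%:R^-1 * \sum_(0 <= j < n) sinc t (X j w)) ^+ 2.
Proof. by rewrite sqr_normcE ReB ImB. Qed.

Let bsq (a : R -> R) : bounded_measurable a ->
  bounded_measurable (fun w => (n%:R^-1 * \sum_(0 <= j < n) a (X j w)) ^+ 2).
Proof.
move=> ba; under eq_fun do rewrite expr2.
suff b : bounded_measurable (fun w => n%:R^-1 * \sum_(0 <= j < n) a (X j w)).
  exact: bounded_measurableM.
apply: bounded_measurableM; first exact: bounded_measurable_cst.
by apply: bounded_measurable_sum => j; exact: (bounded_measurable_comp (mX j) ba).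
Qed.

Let second_moment_emp t : \int[P]_w normc (emp w t - Phi t) ^+ 2 <= 8 / n%:R.
Proof.
under eq_Rintegral do rewrite normc2_emp.
rewrite bintD; [|exact: bsq|exact: bsq].
have := variance_le (bcosc t) (@cosc_le t) (cosc0 t).
have := variance_le (bsinc t) (@sinc_le t) (sinc0 t).
move: (\int[P]_w _) (\int[P]_w _) => p q; rewrite -![_ / n%:R]/(_ * _); lra.
Qed.

Let emp_lipschitz w s t :
  normc (emp w s - emp w t) <= 2 * (`|s - t| * (n%:R^-1 * \sum_(0 <= j < n) `|X j w|)).
Proof.
by rewrite (le_trans (empirical_cf_lipschitz _ _ _ _))// -mulrA ler_wpM2l// mulrC.
Qed.

(** On [-r, r] the modulus of phi_X is at least twice this value, so that `|z|
    <= 1/2 when the empirical characteristic function is within this distance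
    of phi_X. The function b below is at least 1 on the outcomes where this may
    fail: either the mean of `|X j| exceeds n, or at one of n^2 + 1 points of a
    grid the mean of cos or sin deviates by more than a quarter of the
    tolerance. Between grid points both characteristic functions are controlled
    by their Lipschitz constants. *)
Definition tolerance := expR (- (2 * lambda)) * expR (- (r ^+ 2 / 2)) / 2.
Local Notation delta := tolerance.
Let tau := delta / 4.
Let grid k := - r + 2 * r / (n ^ 2)%:R * k%:R.
Let ex (a : R -> R) w := expR (tau / 16 * (\sum_(0 <= j < n) a (X j w) - n%:R * tau)).
Let bgrid k w := ex (cosc (grid k)) w + ex (fun x => - cosc (grid k) x) w +
  (ex (sinc (grid k)) w + ex (fun x => - sinc (grid k) x) w).
Let b w := (n ^ 2)%:R^-1 * (\sum_(0 <= j < n) `|X j w|) + \sum_(0 <= k < (n ^ 2).+1) bgrid k w.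

Let delta_gt0 : 0 < delta.
Proof. by rewrite /delta !mulr_gt0 ?expR_gt0. Qed.

Let delta_le1 : delta <= 1.
Proof.
rewrite /delta -expRD ler_pdivrMr// mul1r (@le_trans _ _ 1)//; last by rewrite ler1n.
rewrite -[leRHS]expR0 ler_expR.
have := divr_ge0 (sqr_ge0 r) (ler0n R 2); have := lambda_gt0.
by move: (r ^+ 2 / 2) lambda => q l; lra.
Qed.

Let tau_gt0 : 0 < tau. Proof. by rewrite /tau divr_gt0. Qed.

Let ex_lt1 a w : ex a w < 1 -> n%:R^-1 * \sum_(0 <= j < n) a (X j w) <= tau.
Proof.
rewrite /ex -[X in _ < X]expR0 ltr_expR => h.
have {}h : \sum_(0 <= j < n) a (X j w) - n%:R * tau < 0.
  by move: h; rewrite pmulr_rlt0// divr_gt0.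
rewrite subr_lt0 in h.
by rewrite ler_pdivrMl// ltW.
Qed.

Let mean_norm_le a w : ex a w < 1 -> ex (fun x => - a x) w < 1 ->
  `|n%:R^-1 * \sum_(0 <= j < n) a (X j w)| <= tau.
Proof.
move=> /ex_lt1 h1 /ex_lt1; rewrite sumrN mulrN => h2.
by rewrite ler_norml h1 lerNl h2.
Qed.

Let ex_ge0 a w : 0 <= ex a w. Proof. exact: expR_ge0. Qed.

Let bgrid_ge0 k w : 0 <= bgrid k w.
Proof. by rewrite /bgrid !addr_ge0. Qed.

Let b_ge0 w : 0 <= b w.
Proof.
by rewrite addr_ge0 ?mulr_ge0 ?invr_ge0 ?sumr_ge0.
Qed.

Hypothesis fine_grid : 8 * r * (n%:R + m1) <= delta * (n ^ 2)%:R.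

Let nn0 : (0 : R) < (n ^ 2)%:R. Proof. by rewrite ltr0n expn_gt0 n_gt0. Qed.

Let grid_near t : t \in `[- r, r] ->
  exists2 k, (k < (n ^ 2).+1)%N & `|t - grid k| <= 2 * r / (n ^ 2)%:R.
Proof.
rewrite in_itv/= => /andP[t1 t2].
pose u := (t + r) * (n ^ 2)%:R / (2 * r).
have u0 : 0 <= u by rewrite /u !mulr_ge0 ?invr_ge0 ?mulr_ge0 ?(ltW r_gt0) ?(ltW nn0)//; lra.
have /andP[k1 k2] := truncn_itv u0.
exists (Num.truncn u).
  rewrite ltnS -(ler_nat R) (le_trans k1)// /u ler_pdivrMr ?mulr_gt0// mulrC ler_wpM2l ?(ltW nn0)//; lra.
have e0 : 0 < 2 * r / (n ^ 2)%:R by rewrite divr_gt0 ?mulr_gt0.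
have -> : t - grid (Num.truncn u) = 2 * r / (n ^ 2)%:R * (u - (Num.truncn u)%:R).
  by rewrite /grid /u; field; rewrite !gt_eqF.
rewrite normrM (gtr0_norm e0) -[leRHS]mulr1 ler_wpM2l ?(ltW e0)//.
by rewrite ger0_norm ?subr_ge0// lerBlDl natr1 ltW.
Qed.

Let good_emp w t : b w < 1 -> t \in `[- r, r] -> normc (emp w t - Phi t) <= delta.
Proof.
move=> bw tr; have [k kn tk] := grid_near tr.
have S0 : 0 <= \sum_(0 <= k < (n ^ 2).+1) bgrid k w by rewrite sumr_ge0.
have M0 : 0 <= (n ^ 2)%:R^-1 * (\sum_(0 <= j < n) `|X j w|).
  by rewrite mulr_ge0 ?invr_ge0 ?sumr_ge0.
have mean : n%:R^-1 * (\sum_(0 <= j < n) `|X j w|) <= n%:R.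
  have : (n ^ 2)%:R^-1 * (\sum_(0 <= j < n) `|X j w|) < 1 by move: bw; rewrite /b; lra.
  rewrite ltr_pdivrMl// mulr1 => /ltW h; rewrite ler_pdivrMl//.
  by rewrite -natrM mulnn.
have gk : bgrid k w < 1.
  apply: (@le_lt_trans _ _ (\sum_(0 <= k < (n ^ 2).+1) bgrid k w)); last by move: bw; rewrite /b; lra.
  rewrite (bigD1_seq k) ?mem_index_iota ?iota_uniq//= lerDl sumr_ge0//.
have [c1 c2 s1 s2] : [/\ ex (cosc (grid k)) w < 1, ex (fun x => - cosc (grid k) x) w < 1,
    ex (sinc (grid k)) w < 1 & ex (fun x => - sinc (grid k) x) w < 1].
  have := ex_ge0 (cosc (grid k)) w; have := ex_ge0 (fun x => - cosc (grid k) x) w.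
  have := ex_ge0 (sinc (grid k)) w; have := ex_ge0 (fun x => - sinc (grid k) x) w.
  by move=> *; exact: sum4_lt1.
have hk : normc (emp w (grid k) - Phi (grid k)) <= delta / 2.
  rewrite (le_trans (normc_le_ReIm _))// ReB ImB.
  have -> : delta / 2 = tau + tau by rewrite /tau; field.
  by rewrite lerD ?mean_norm_le.
have -> : emp w t - Phi t = emp w (grid k) - Phi (grid k) +
   ((emp w t - emp w (grid k)) - (Phi t - Phi (grid k))) by ring.
rewrite (le_trans (le_normcD _ _))//.
rewrite [leRHS]splitr lerD//.
rewrite (le_trans (le_normcD _ _))// normcN.
rewrite (le_trans (lerD (emp_lipschitz _ _ _) (Phi_lipschitz _ _)))//.
apply: (@le_trans _ _ (2 * (2 * r / (n ^ 2)%:R * (n%:R + m1)))).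
  rewrite -mulrDr -mulrDr ler_wpM2l// ler_pM ?addr_ge0 ?mulr_ge0 ?invr_ge0 ?sumr_ge0//.
  by rewrite lerD2r.
rewrite (_ : 2 * _ = (8 * r * (n%:R + m1) / (n ^ 2)%:R) / 2); last by field; rewrite gt_eqF.
by rewrite ler_wpM2r ?invr_ge0// ler_pdivrMr.
Qed.

Let inv_cf_le t : t \in `[- r, r] -> normc (inv_cf t) <= (2 * delta)^-1.
Proof.
rewrite in_itv/= => tr.
rewrite (le_trans (normc_inv_cf_le _ (phi_le1 t)))//.
have -> : (2 * delta)^-1 = expR (2 * lambda) * expR (r ^+ 2 / 2).
  rewrite /delta !expRN; field.
  by rewrite !gt_eqF ?expR_gt0.
rewrite ler_wpM2l ?expR_ge0// ler_expR ler_wpM2r ?invr_ge0//.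
by rewrite -real_normK ?num_real// -[leRHS]real_normK ?num_real// lerXn2r ?nnegrE// (ger0_norm (ltW r_gt0)) ler_norml.
Qed.

Let good_z w t : b w < 1 -> t \in `[- r, r] -> normc (z w t) <= 2^-1.
Proof.
move=> bw tr; rewrite zE Normc.normcM.
rewrite (le_trans (ler_pM (normc_ge0 _) (normc_ge0 _) (good_emp bw tr) (inv_cf_le tr)))//.
by rewrite invfM mulrCA mulfV ?mulr1// gt_eqF.
Qed.

Let z_crude w t : t \in `[- r, r] -> normc (z w t) <= delta^-1.
Proof.
move=> tr; rewrite zE Normc.normcM.
have e1 : normc (emp w t) <= 1.
  rewrite /empirical_cf Normc.normcM -(rmorph_nat (real_complex R)) -fmorphV normc_real ger0_norm ?invr_ge0 ?(ltW n0)//.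
  rewrite ler_pdivrMl// mulr1 (le_trans (normc_sum _ _))//.
  rewrite (eq_bigr (fun=> 1)); last by move=> j _; exact: normc_cexpi.
  by rewrite sumr_const card_ord.
have e2 : normc (emp w t - Phi t) <= 2.
  by rewrite (le_trans (le_normcD _ _))// normcN (le_trans (lerD e1 (normc_Phi_le1 t))).
rewrite (le_trans (ler_pM (normc_ge0 _) (normc_ge0 _) e2 (inv_cf_le tr)))//.
by rewrite invfM mulrA mulfV ?mul1r.
Qed.

Let integrable_absX j : P.-integrable [set: T] (EFin \o (fun w => `|X j w|)).
Proof. exact: (integrable_norm (intX j)). Qed.

Let integrable_sum_absX : P.-integrable [set: T] (EFin \o (fun w => \sum_(0 <= j < n) `|X j w|)).
Proof.
by apply: integrable_sumr => // j; exact: integrable_absX.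
Qed.

Let bex a : bounded_measurable a -> bounded_measurable (ex a).
Proof.
move=> ba; apply: bounded_measurable_expR.
apply: bounded_measurableM; first exact: bounded_measurable_cst.
apply: bounded_measurableB; last exact: bounded_measurable_cst.
by apply: bounded_measurable_sum => j; exact: (bounded_measurable_comp (mX j) ba).
Qed.

Let bbgrid k : bounded_measurable (bgrid k).
Proof.
by apply: bounded_measurableD; apply: bounded_measurableD; apply: bex => //; exact: bounded_measurableN.
Qed.

Let integrable_b : P.-integrable [set: T] (EFin \o b).
Proof.
have i1 : P.-integrable [set: T] (EFin \o (fun w => (n ^ 2)%:R^-1 * (\sum_(0 <= j < n) `|X j w|))).
  exact: (integrableZl measurableT _ integrable_sum_absX).
have i2 : P.-integrable [set: T] (EFin \o (fun w => \sum_(0 <= k < (n ^ 2).+1) bgrid k w)).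
  by apply: bounded_measurable_integrable; exact: bounded_measurable_sum.
exact: (integrableD _ i1 i2).
Qed.

Let ex_mean a : bounded_measurable a -> (forall x, `|a x| <= 2) -> \int[P]_w a (X 0 w) = 0 ->
  \int[P]_w ex a w <= expR (- (n%:R * tau ^+ 2 / 32)).
Proof.
move=> ba a2 a0; apply: chernoff => //; rewrite (ltW tau_gt0) /tau/=.
by have := delta_le1; lra.
Qed.

Let opp_mean0 a : bounded_measurable a -> \int[P]_w a (X 0 w) = 0 -> \int[P]_w - a (X 0 w) = 0.
Proof.
move=> ba a0; under eq_Rintegral do rewrite -mulN1r.
by rewrite bintZ ?a0 ?mulr0//; exact: (bX ba).
Qed.

Let bgrid_mean k : \int[P]_w bgrid k w <= 4 * expR (- (n%:R * tau ^+ 2 / 32)).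
Proof.
have bc := bcosc (grid k); have bs := bsinc (grid k).
have bcN := bounded_measurableN bc; have bsN := bounded_measurableN bs.
rewrite bintD; [|by apply: bounded_measurableD; exact: bex|by apply: bounded_measurableD; exact: bex].
rewrite bintD; [|exact: bex|exact: bex]. rewrite bintD; [|exact: bex|exact: bex].
have h1 := ex_mean bc (@cosc_le _) (cosc0 _).
have h2 := ex_mean bs (@sinc_le _) (sinc0 _).
have h3 : \int[P]_w ex (fun x => - cosc (grid k) x) w <= expR (- (n%:R * tau ^+ 2 / 32)).
  by apply: ex_mean => // [x|]; [rewrite normrN|exact: (opp_mean0 bc)].
have h4 : \int[P]_w ex (fun x => - sinc (grid k) x) w <= expR (- (n%:R * tau ^+ 2 / 32)).
  by apply: ex_mean => // [x|]; [rewrite normrN|exact: (opp_mean0 bs)].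
rewrite (_ : 4 * _ = (expR (- (n%:R * tau ^+ 2 / 32)) + expR (- (n%:R * tau ^+ 2 / 32))) +
  (expR (- (n%:R * tau ^+ 2 / 32)) + expR (- (n%:R * tau ^+ 2 / 32)))); last by ring.
by rewrite lerD// lerD.
Qed.

Let b_mean : \int[P]_w b w <=
  m1 / n%:R + 4 * (n ^ 2).+1%:R * expR (- (n%:R * tau ^+ 2 / 32)).
Proof.
rewrite RintegralD//; first last.
- by apply: bounded_measurable_integrable; exact: bounded_measurable_sum.
- exact: (integrableZl measurableT _ integrable_sum_absX).
apply: lerD.
  rewrite RintegralZl//.
  rewrite Rintegral_sum//.
  rewrite ler_pdivrMl// (@le_trans _ _ (\sum_(0 <= j < n) m1))//; first exact: ler_sum.
  by rewrite sumr_const_nat subn0 -mulnn natrM -[m1 *+ n]mulr_natl le_eqVlt; apply/orP; left; apply/eqP; field; rewrite gt_eqF.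
rewrite bint_sum// (@le_trans _ _ (\sum_(0 <= k < (n ^ 2).+1) 4 * expR (- (n%:R * tau ^+ 2 / 32))))//.
  by apply: ler_sum => k _; exact: bgrid_mean.
by rewrite sumr_const_nat subn0 -[_ *+ _.+1]mulr_natl mulrCA mulrA.
Qed.

Local Notation I := (`[- r, r]%classic : set R).

Let c0 := (2 * pi * lambda)^-1.
Let c0_ge0 : 0 <= c0.
Proof. by rewrite invr_ge0 !mulr_ge0 ?pi_ge0// ltW. Qed.

Let mu_I (c : R) : \int[mu]_(t in I) c = c * (2 * r).
Proof.
have -> : 2 * r = r - - r by rewrite opprK mulr_natl mulr2n.
by rewrite Rintegral_cst_itv// (le_trans _ (ltW r_gt0))// oppr_le0 ltW.
Qed.

Let integrable_cst_I (c : R) : mu.-integrable I (EFin \o (fun=> c)).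
Proof. by apply: integrable_continuous_itv; apply: continuous_subspaceT => t; exact: cvg_cst. Qed.

Let cinv := @ccontinuous_inv_cf R lambda phi phi_continuous.

Let cmeasurable_inv_cf : cmeasurable inv_cf.
Proof. by split; apply: continuous_measurable_fun; case: cinv. Qed.

Let cmeasurable_z : cmeasurable (fun p : T * R => z p.1 p.2).
Proof.
have mXt j : measurable_fun [set: T * R] (fun p => p.2 * X j p.1).
  apply: measurable_funM; first exact: measurable_snd.
  exact: measurableT_comp (mX j) measurable_fst.
apply: cmeasurableD; last exact: cmeasurable_cst.
apply: cmeasurableM; last first.
  exact: (cmeasurable_comp cmeasurable_inv_cf measurable_snd).
apply: cmeasurableM; first exact: cmeasurable_cst.
by apply: cmeasurable_sum => j; exact: cmeasurable_cexpi.
Qed.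

Definition quadratic_error w := \int[mu]_(t in I) normc (z w t) ^+ 2.

Let indicI_le (B : R) (c : R) (t : R) : (t \in `[- r, r] -> `|c| <= B) -> `|\1_I t * c| <= B * \1_I t.
Proof.
rewrite indicE mem_setE => h; case: (boolP (t \in _)) => tr; last by rewrite mul0r mulr0 normr0.
by rewrite mul1r mulr1 h.
Qed.

Let integrable_indicI (B : R) : mu.-integrable [set: R] (EFin \o (fun t => B * \1_I t)).
Proof.
have := integrable_cst_I B; rewrite integrable_mkcond//.
by apply: (eq_integrable measurableT) => t _; rewrite /= patchE indicE; case: (t \in I); rewrite ?mulr1 ?mulr0.
Qed.

Let Rintegral_indicI (g : R -> R) : \int[mu]_(t in I) g t = \int[mu]_t (\1_I t * g t).
Proof.
rewrite [LHS]Rintegral_mkcond; apply: eq_Rintegral => t _.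
by rewrite patchE indicE; case: (t \in I); rewrite ?mul1r ?mul0r.
Qed.

Let fubini_I (K : T * R -> R) (B : R) : measurable_fun [set: T * R] K ->
  (forall w t, t \in `[- r, r] -> `|K (w, t)| <= B) ->
  [/\ bounded_measurable (fun w => \int[mu]_(t in I) K (w, t)),
      mu.-integrable I (EFin \o (fun t => \int[P]_w K (w, t))) &
      \int[P]_w (\int[mu]_(t in I) K (w, t)) = \int[mu]_(t in I) (\int[P]_w K (w, t))].
Proof.
move=> mK KB; pose K' p := \1_I p.2 * K p.
have mK' : measurable_fun [set: T * R] K'.
  apply: measurable_funM => //.
  have mi : measurable_fun [set: R] (\1_I : R -> R) by exact: measurable_indic.
  exact: measurableT_comp mi measurable_snd.
have [b1 b2 b3] := fubini_dominated P mK' (integrable_indicI B) (fun w t => indicI_le (@KB w t)).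
have e1 : (fun w => \int[mu]_y K' (w, y)) = (fun w => \int[mu]_(t in I) K (w, t)).
  by apply/funext => w; rewrite Rintegral_indicI.
have e2 : (fun t => \int[P]_w K' (w, t)) = (fun t => \1_I t * \int[P]_w K (w, t)).
  apply/funext => t; rewrite /K' /= indicE; case: (t \in I).
    by rewrite mul1r; apply: eq_Rintegral => w _; rewrite mul1r.
  by rewrite mul0r; under eq_Rintegral do rewrite mul0r; rewrite bint_cst.
rewrite e1 e2 in b1 b2 b3; split => //; last by rewrite Rintegral_indicI.
have : mu.-integrable I (EFin \o (fun t => \1_I t * \int[P]_w K (w, t))) by apply: (integrableS measurableT).
move=> b2'; apply: (eq_integrable _) b2' => // t tI /=; by rewrite indicE tI mul1r.
Qed.

Let z2_measurable : measurable_fun [set: T * R] (fun p => normc (z p.1 p.2) ^+ 2).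
Proof. exact: cmeasurable_sqr_normc. Qed.

Let z2_le w t : t \in `[- r, r] -> `|normc (z w t) ^+ 2| <= delta^-1 ^+ 2.
Proof.
move=> tr; rewrite ger0_norm ?exprn_ge0 ?normc_ge0// lerXn2r ?nnegrE ?normc_ge0 ?invr_ge0 ?(ltW delta_gt0)//.
exact: z_crude.
Qed.

Lemma quadratic_error_mean :
  \int[P]_w quadratic_error w <= 8 / n%:R * (2 * delta)^-1 ^+ 2 * (2 * r).
Proof.
have [_ i1 ->] := fubini_I z2_measurable z2_le.
rewrite -mu_I; apply: le_Rintegral => //.
move=> t /= tr.
under eq_Rintegral do rewrite zE Normc.normcM exprMn mulrC.
rewrite bintZ; last first.
  rewrite (_ : (fun w => _) = (fun w => (n%:R^-1 * \sum_(0 <= j < n) cosc t (X j w)) ^+ 2 +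
    (n%:R^-1 * \sum_(0 <= j < n) sinc t (X j w)) ^+ 2)); last by apply/funext => w; exact: normc2_emp.
  by apply: bounded_measurableD; exact: bsq.
rewrite mulrC ler_pM ?exprn_ge0 ?normc_ge0//.
  by apply: Rintegral_ge0 => w _; rewrite exprn_ge0 ?normc_ge0.
by rewrite lerXn2r ?nnegrE ?normc_ge0 ?invr_ge0 ?mulr_ge0 ?(ltW delta_gt0)// inv_cf_le.
Qed.

(** The contribution of one observation u to the linear part, before centring.
    *)
Definition influence u := c0 * \int[mu]_(t in I) cRe (cexpi (t * (u - y)) * inv_cf t).
Local Notation xi := influence.

Let integrable_I (F : R -> R[i]) : ccontinuous F -> mu.-integrable I (EFin \o (fun t => cRe (F t))).
Proof. by move=> [cF _]; apply: integrable_continuous_itv; exact: continuous_subspaceT. Qed.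

Let cxi u : ccontinuous (fun t => cexpi (t * (u - y)) * inv_cf t).
Proof. by apply: ccontinuousM => //; exact: ccontinuous_cexpi. Qed.

Let xi_integrand_le u t : t \in `[- r, r] -> `|cRe (cexpi (t * (u - y)) * inv_cf t)| <= (2 * delta)^-1.
Proof.
move=> tr; rewrite (le_trans (normr_Re_le _))// Normc.normcM normc_cexpi mul1r.
exact: inv_cf_le.
Qed.

Lemma bounded_measurable_influence : bounded_measurable xi.
Proof.
split.
  apply: measurable_funM => //.
  apply: (measurable_Rintegral_param (K := fun p : R * R => cRe (cexpi (p.2 * (p.1 - y)) * inv_cf p.2))) => //.
  have [] // := @cmeasurableM _ _ (R * R)%type (fun p => cexpi (p.2 * (p.1 - y))) (fun p => inv_cf p.2).
    apply: cmeasurable_cexpi; apply: measurable_funM; first exact: measurable_snd.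
    by apply: measurable_funB => //; exact: measurable_fst.
  exact: (cmeasurable_comp cmeasurable_inv_cf measurable_snd).
exists (c0 * ((2 * delta)^-1 * (2 * r))) => u.
rewrite normrM (ger0_norm c0_ge0) ler_wpM2l//.
rewrite (le_trans (le_normr_Rintegral _ (integrable_I (cxi u))))// -mu_I.
apply: le_Rintegral => //.
- exact: (integrable_norm (integrable_I (cxi u))).
- by move=> t /= tr; exact: xi_integrand_le.
Qed.

Let xi_mean : \int[P]_w xi (X 0 w) = c0 * \int[mu]_(t in I) cRe (cexpi (- (t * y))).
Proof.
have mK : measurable_fun [set: T * R] (fun p => cRe (cexpi (p.2 * (X 0 p.1 - y)) * inv_cf p.2)).
  have [] // := @cmeasurableM _ _ (T * R)%type (fun p => cexpi (p.2 * (X 0 p.1 - y))) (fun p => inv_cf p.2).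
    apply: cmeasurable_cexpi; apply: measurable_funM; first exact: measurable_snd.
    by apply: measurable_funB => //; exact: measurableT_comp (mX 0%N) measurable_fst.
  exact: (cmeasurable_comp cmeasurable_inv_cf measurable_snd).
have [b1 _ b3] := fubini_I mK (fun w t => @xi_integrand_le (X 0 w) t).
rewrite /xi bintZ//; congr (_ * _); rewrite b3.
apply: eq_Rintegral => t _.
have bc : cbounded_measurable (fun w => cexpi (t * X 0 w)).
  by apply: cbounded_measurable_cexpi; exact: measurable_funM.
transitivity (cRe (Ec (fun w => (cexpi (- (t * y)) * inv_cf t) * cexpi (t * X 0 w)))).
  rewrite -[RHS]/(\int[P]_w cRe (cexpi (- (t * y)) * inv_cf t * cexpi (t * X 0 w))).
  by apply: eq_Rintegral => w _; congr cRe; rewrite [_ - y in LHS]/= mulrBr cexpiD; ring.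
by rewrite cintegralZ// -mulrA [inv_cf t * _]mulrC cfX mulr1.
Qed.

Lemma linear_part_influence w :
  linear_part lambda r n (fun i => X i w) y phi =
  n%:R^-1 * \sum_(0 <= j < n) (xi (X j w) - \int[P]_w xi (X 0 w)).
Proof.
rewrite sumrB sumr_const_nat subn0 mulrBr -[(\int[P]_w _) *+ n]mulr_natl mulKf ?gt_eqF//.
rewrite xi_mean /xi -mulr_sumr mulrCA -mulrBr /linear_part; congr (_ * _).
have i1 j : mu.-integrable I (EFin \o (fun t => cRe (cexpi (t * (X j w - y)) * inv_cf t))) by exact: integrable_I.
have i2 : mu.-integrable I (EFin \o (fun t => \sum_(0 <= j < n) cRe (cexpi (t * (X j w - y)) * inv_cf t))).
  exact: integrable_sumr.
have -> : \sum_(0 <= j < n) \int[mu]_(t in I) cRe (cexpi (t * (X j w - y)) * inv_cf t) =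
    \int[mu]_(t in I) \sum_(0 <= j < n) cRe (cexpi (t * (X j w - y)) * inv_cf t).
  by rewrite Rintegral_sum.
rewrite -RintegralZl// -RintegralB//; last 2 first.
- exact: (integrableZl _ n%:R^-1 i2).
- apply: integrable_I; under eq_fun do rewrite -mulrN; exact: ccontinuous_cexpi.
apply: eq_Rintegral => t _.
rewrite /relative_error mulrBr mulr1 cReD cReN; congr (_ - _).
rewrite /empirical_cf -(rmorph_nat (real_complex R)) -fmorphV mulrCA -mulrA cReM (_ : cIm (n%:R^-1)%:C = 0)// mul0r subr0; congr (_ * _).
rewrite mulr_suml Re_sum big_mkord; apply: eq_bigr => j _.
by congr cRe; rewrite mulrBr cexpiD; ring.
Qed.

Lemma bounded_measurable_linear_part :
  bounded_measurable (fun w => linear_part lambda r n (fun i => X i w) y phi).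
Proof.
under eq_fun do rewrite linear_part_influence.
apply: bounded_measurableM; first exact: bounded_measurable_cst.
apply: bounded_measurable_sum => j; apply: bounded_measurableB; last exact: bounded_measurable_cst.
exact: (bounded_measurable_comp (mX j) bounded_measurable_influence).
Qed.

Variable (Mx : R).
Hypothesis Mx_ge : c0 * (2 * r * (lambda + 11)) <= Mx.
Hypothesis measurable_fnh :
  measurable_fun [set: T] (fun w => fnh lambda v r^-1 n (fun i => X i w) y).

Local Notation est w := (fnh_trunc lambda v r^-1 Mx n (fun i => X i w) y).
Local Notation lim_part := (limit_part lambda r y phi).
Local Notation lin_part w := (linear_part lambda r n (fun i => X i w) y phi).

Let Mx_ge0 : 0 <= Mx.
Proof.
apply: le_trans Mx_ge; rewrite mulr_ge0 ?mulr_ge0 ?(ltW r_gt0)//.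
by rewrite addr_ge0// ltW.
Qed.

Lemma bounded_measurable_estimator : bounded_measurable (fun w => est w).
Proof.
split.
  by apply: measurable_maxr => //; apply: measurable_minr.
exists Mx => w; rewrite ler_norml le_max lexx orbT/= ge_max ge_min lexx/=.
by rewrite (le_trans _ Mx_ge0)// oppr_le0.
Qed.

Let transform_le (F : R -> R[i]) (B : R) : ccontinuous F ->
  (forall t, t \in `[- r, r] -> normc (F t) <= B) ->
  `|c0 * \int[mu]_(t in I) cRe (cexpi (- (t * y)) * F t)| <= c0 * (2 * r * B).
Proof.
move=> cF FB; rewrite normrM (ger0_norm c0_ge0) ler_wpM2l//.
have ce : ccontinuous (fun t => cexpi (- (t * y)) * F t).
  by apply: ccontinuousM => //; under eq_fun do rewrite -mulrN; exact: ccontinuous_cexpi.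
rewrite (le_trans (le_normr_Rintegral _ (integrable_I ce)))// mulrC -mu_I.
apply: le_Rintegral => //.
- exact: (integrable_norm (integrable_I ce)).
- move=> t /= tr; rewrite (le_trans (normr_Re_le _))// Normc.normcM normc_cexpi mul1r.
  exact: FB.
Qed.

Let lim_part_le : `|lim_part| <= c0 * (2 * r * lambda).
Proof.
apply: transform_le => [|t tr]; first by apply: ccontinuousM => //; exact: ccontinuous_cst.
rewrite Normc.normcM normc_real gtr0_norm// -[leRHS]mulr1 ler_wpM2l// ltW//.
Qed.

Let lin_part_le w (B : R) : (forall t, t \in `[- r, r] -> normc (z w t) <= B) ->
  `|lin_part w| <= c0 * (2 * r * B).
Proof.
by move=> h; apply: transform_le => //; exact: ccontinuous_relative_error.
Qed.

Let quadratic_error_le w (B : R) : (forall t, t \in `[- r, r] -> normc (z w t) <= B) ->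
  quadratic_error w <= B ^+ 2 * (2 * r).
Proof.
move=> h; rewrite -mu_I; apply: le_Rintegral => //.
  apply: integrable_continuous_itv; apply: continuous_subspaceT => t.
  have cz := @ccontinuous_relative_error R lambda n (fun i => X i w) phi phi_continuous.
  apply: (@continuous_comp _ _ _ (fun t => normc (z w t)) (fun u : R => u ^+ 2)); [exact: continuous_normc cz t|exact: exprn_continuous].
move=> t /= tr; rewrite lerXn2r ?nnegrE ?normc_ge0 ?h//.
by rewrite (le_trans (normc_ge0 _) (h t tr)).
Qed.

Let quadratic_error_ge0 w : 0 <= quadratic_error w.
Proof. by apply: Rintegral_ge0 => t _; rewrite exprn_ge0 ?normc_ge0. Qed.

Definition crude_bound := Mx + c0 * (2 * r * lambda) + c0 * (2 * r * delta^-1).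

(** On a good outcome truncation is inactive and the remainder is quadratic;
    on a bad one every term is bounded deterministically. *)
Lemma remainder_le w : `|est w - lim_part - lin_part w| <=
  c0 * (40 * quadratic_error w) + crude_bound * b w.
Proof.
have cr0 : 0 <= crude_bound.
  have r0 := ltW r_gt0; have l0 := ltW lambda_gt0; have d0 := ltW delta_gt0.
  have di0 : 0 <= delta^-1 by rewrite invr_ge0.
  by rewrite /crude_bound addr_ge0 ?addr_ge0 ?mulr_ge0.
have q0 : 0 <= c0 * (40 * quadratic_error w) by rewrite !mulr_ge0.
have [bad|good] := leP 1 (b w).
  rewrite (@le_trans _ _ crude_bound)//; last first.
    by rewrite (@le_trans _ _ (crude_bound * b w)) ?ler_peMr// lerDr.
  rewrite (le_trans (ler_normB _ _))// lerD//; last first.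
    by apply: lin_part_le => t; exact: z_crude.
  rewrite (le_trans (ler_normB _ _))// lerD//.
  rewrite ler_norml le_max lexx orbT/= ge_max ge_min lexx/=.
  by rewrite (le_trans _ Mx_ge0)// oppr_le0.
have zs t := @good_z w t good.
have fl := @fnh_linearization R lambda r v n (fun i => X i w) y phi lambda_gt0 r_gt0 phi_continuous phi0 n_gt0 zs.
suff -> : est w = fnh lambda v r^-1 n (fun i => X i w) y.
  by rewrite (le_trans fl)// lerDl mulr_ge0.
have : `|fnh lambda v r^-1 n (fun i => X i w) y| <= Mx.
  apply: le_trans Mx_ge.
  rewrite (le_trans (normr_le3 fl lim_part_le (lin_part_le zs)))//.
  have hq : c0 * (40 * quadratic_error w) <= c0 * (40 * (2^-1 ^+ 2 * (2 * r))).
    by rewrite ler_wpM2l// ler_wpM2l// quadratic_error_le.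
  rewrite (le_trans (lerD (lerD hq (lexx _)) (lexx _)))// -!mulrDr ler_wpM2l//.
  rewrite (_ : _ + _ = 2 * r * (lambda + 2^-1 + 10)); last by field.
  rewrite ler_wpM2l ?mulr_ge0 ?(ltW r_gt0)// -addrA lerD2l -lerBrDr.
  have -> : 11 - 10 = 1 :> R by ring.
  by rewrite invf_le1 ?ler1n.
rewrite ler_norml => /andP[f1 f2].
by rewrite /fnh_trunc (min_idPr f2) (max_idPl f1).
Qed.

Let integrable_remainder_bound : P.-integrable [set: T] (EFin \o (fun w => c0 * (40 * quadratic_error w) + crude_bound * b w)).
Proof.
have [bq _ _] := fubini_I z2_measurable z2_le.
have i1 : P.-integrable [set: T] (EFin \o (fun w => c0 * (40 * quadratic_error w))).
  apply: bounded_measurable_integrable; apply: bounded_measurableM; first exact: bounded_measurable_cst.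
  by apply: bounded_measurableM; first exact: bounded_measurable_cst.
have i2 : P.-integrable [set: T] (EFin \o (fun w => crude_bound * b w)).
  exact: (integrableZl measurableT crude_bound integrable_b).
exact: (integrableD _ i1 i2).
Qed.

(** The mean of the quadratic error is a variance, of order 1 / n up to the
    factor tolerance^-2, and the bad outcomes have probability of order m1 / n
    up to an exponentially small term. *)
Theorem remainder_mean : \int[P]_w `|est w - lim_part - lin_part w| <=
  c0 * (40 * (8 / n%:R * (2 * delta)^-1 ^+ 2 * (2 * r))) +
  crude_bound * (m1 / n%:R + 4 * (n ^ 2).+1%:R * expR (- (n%:R * (delta / 4) ^+ 2 / 32))).
Proof.
have [bq _ _] := fubini_I z2_measurable z2_le.
have cr0 : 0 <= crude_bound.
  have r0 := ltW r_gt0; have l0 := ltW lambda_gt0; have d0 := ltW delta_gt0.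
  have di0 : 0 <= delta^-1 by rewrite invr_ge0.
  by rewrite /crude_bound addr_ge0 ?addr_ge0 ?mulr_ge0.
apply: (@le_trans _ _ (\int[P]_w (c0 * (40 * quadratic_error w) + crude_bound * b w))).
  apply: le_Rintegral => //; last by move=> w _; exact: remainder_le.
  apply: bounded_measurable_integrable; apply: bounded_measurable_norm.
  apply: bounded_measurableB; last exact: bounded_measurable_linear_part.
  by apply: bounded_measurableB; [exact: bounded_measurable_estimator|exact: bounded_measurable_cst].
have b40 : bounded_measurable (fun w => 40 * quadratic_error w).
  by apply: bounded_measurableM; first exact: bounded_measurable_cst.
rewrite RintegralD//; first last.
- exact: (integrableZl measurableT crude_bound integrable_b).
- by apply: bounded_measurable_integrable; apply: bounded_measurableM; first exact: bounded_measurable_cst.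
rewrite (bintZ _ c0 b40) (bintZ _ 40 bq) RintegralZl//.
apply: lerD; first by rewrite ler_wpM2l// ler_wpM2l// quadratic_error_mean.
by rewrite ler_wpM2l// b_mean.
Qed.

End FixedSampleSize.
End Fluctuations.

(** * Measurability of the estimator; characteristic functions of densities *)

Section Measurability.
Context {R : realType} d (T : measurableType d).
Local Open Scope complex_scope.
Local Notation cRe := (@complex.Re R).
Local Notation cIm := (@complex.Im R).
Local Notation normc := (@Normc.normc R).
Local Notation mu := (@lebesgue_measure R).

Lemma measurable_fnh (X : nat -> T -> R) (lambda v h : R) n y :
  (forall i, measurable_fun [set: T] (X i)) -> 0 < h ->
  measurable_fun [set: T] (fun w => fnh lambda v h n (fun i => X i w) y).
Proof.
move=> mX h0; have hi : 0 <= h^-1 by rewrite invr_ge0 ltW.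
pose emp w t := empirical_cf n (fun i => X i w) t.
have cE w t : t \in `[- h^-1, h^-1] -> cf_ratio lambda h n (fun i => X i w) t =
    cexp (lambda + t ^+ 2 / 2)%:C * emp w t.
  rewrite in_itv/= => tr; rewrite /cf_ratio /sinc_kernel_ft indicE mem_set /=; last first.
    have := tr; rewrite in_itv/= -ler_pdivlMl// -ler_pdivrMl//.
    by rewrite mulrN1 mulr1.
  rewrite mulr1 mulrC; congr (_ * _); rewrite cexp_real -fmorphV; congr (_%:C).
  by rewrite expRD /= invfM !expRN !invrK.
have neE w : (fun t => t \in `[- h^-1, h^-1] -> cf_ratio lambda h n (fun i => X i w) t != 0) =
    (fun t => t \in `[- h^-1, h^-1] -> emp w t != 0).
  apply/funext => t; apply/propext; split => H tr.
    by have := H tr; rewrite cE//; apply: contraNneq => ->; rewrite mulr0.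
  by rewrite cE// mulf_neq0// ?cexp_neq0// H.
(* without data the empirical characteristic function vanishes everywhere *)
case: n @emp cE neE => [|n] emp cE neE.
  rewrite (_ : (fun w => _) = fun=> v); first exact: measurable_cst.
  apply/funext => w; rewrite /fnh; case: asboolP => // H.
  have := H 0; rewrite cE; last by rewrite in_itv/= oppr_le0 hi.
  rewrite /emp /empirical_cf big_ord0 !mulr0 eqxx => /(_ _)/negP; case => //.
  by rewrite in_itv/= oppr_le0 hi.
have cl : continuous ((fun t => (lambda + t ^+ 2 / 2)%:C) : R -> R[i]^o).
  apply/continuous_complexP; apply: ccontinuous_real => t.
  by apply: cvgD; [exact: cvg_cst|apply: cvgMl; exact: exprn_continuous].
have memp : cmeasurable (fun p : T * R => emp p.1 p.2).
  apply: cmeasurableM; first exact: cmeasurable_cst.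
  apply: cmeasurable_sum => j; apply: cmeasurable_cexpi.
  apply: measurable_funM; first exact: measurable_snd.
  exact: measurableT_comp (mX j) measurable_fst.
have lip w : exists K : R, forall s t, normc (emp w s - emp w t) <= K * `|s - t|.
  by eexists => s t; exact: empirical_cf_lipschitz.
have emp1 w : (forall t, t \in `[- h^-1, h^-1] -> emp w t != 0) -> emp w 0 = 1.
  by move=> _; exact: empirical_cf0.
have := @measurable_log_transform R _ T emp h^-1 hi memp lip
  (fun t => (lambda + t ^+ 2 / 2)%:C) (fun w => cf_ratio lambda h n.+1 (fun i => X i w)) cl emp1 cE y.
rewrite expr0n mul0r addr0 => mJ.
pose c : R := (2 * pi * lambda)^-1.
have mgood : measurable [set w | forall t, t \in `[- h^-1, h^-1] -> emp w t != 0].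
  exact: measurable_nonvanishing.
rewrite (_ : (fun w => _) = (fun w => if `[< forall t, t \in `[- h^-1, h^-1] -> emp w t != 0 >] then
   c * (if `[< forall t, t \in `[- h^-1, h^-1] -> emp w t != 0 >] then
    \int[mu]_(t in `[- h^-1, h^-1]) cRe (cexpi (- (t * y)) * distinguished_log (cf_ratio lambda h n.+1 (fun i => X i w)) h^-1 lambda%:C t)
    else 0) else v)).
  apply: measurable_fun_ifT.
  - apply: (measurable_fun_bool true); rewrite setTI.
    rewrite (_ : _ @^-1` _ = [set w | forall t, t \in `[- h^-1, h^-1] -> emp w t != 0])//.
    by apply/seteqP; split => w /=; [move/asboolP|move=> ?; apply/asboolP].
  - by apply: measurable_funM => //; exact: (mJ 0).
  - exact: measurable_cst.
apply/funext => w; rewrite /fnh /=.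
have -> : (forall t, t \in `[- h^-1, h^-1] -> cf_ratio lambda h n.+1 (fun i => X i w) t != 0) =
  (forall t, t \in `[- h^-1, h^-1] -> emp w t != 0).
  by have := neE w => /(congr1 (fun Q => forall t, Q t)).
by case: asboolP.
Qed.

End Measurability.

Section DensityCf.
Context {R : realType}.
Local Open Scope complex_scope.
Local Notation cRe := (@complex.Re R).
Local Notation cIm := (@complex.Im R).
Local Notation normc := (@Normc.normc R).
Local Notation mu := (@lebesgue_measure R).

(** A value e at t0 forces an integral of order e^2 / K near t0, whereas the
    integral over the tail tends to 0. *)
Lemma integrable_lipschitz_vanish (g : R -> R) (K : R) :
  (forall s t, `|g s - g t| <= K * `|s - t|) -> mu.-integrable [set: R] (EFin \o g) ->
  forall e : R, 0 < e -> exists A : R, forall t, A <= `|t| -> `|g t| <= e.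
Proof.
move=> lip ig e e0.
have /measurable_EFinP mg := measurable_int _ ig.
have K0 : 0 <= K by have := lip 1 0; rewrite subr0 normr1 mulr1; apply: le_trans.
pose dl := e / (2 * (K + 1)).
have K1 : 0 < K + 1 by rewrite ltr_wpDl.
have dl0 : 0 < dl by rewrite divr_gt0 ?mulr_gt0.
pose G (m : nat) (t : R) : R := `|g t| * (m%:R <= `|t|)%R%:R.
have mG m : measurable_fun [set: R] (G m).
  apply: measurable_funM; first exact: measurableT_comp.
  rewrite (_ : (fun t : R => _) = \1_[set t : R | m%:R <= `|t|]); last first.
    by apply/funext => t; rewrite indicE mem_setE.
  apply: measurable_indic; rewrite -[X in measurable X]setTI; apply: measurable_fun_le => //.
have GE m t : 0 <= G m t <= `|g t|.
  by rewrite /G; case: (m%:R <= `|t|)%R; rewrite ?mulr1 ?mulr0 ?lexx normr_ge0.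
have iG m : mu.-integrable [set: R] (EFin \o G m).
  apply: (le_integrable measurableT _ _ (integrable_norm ig)); first by apply/measurable_EFinP; exact: mG.
  by move=> t _ /=; have /andP[p1 p2] := GE m t; rewrite lee_fin normr_id ger0_norm.
have cG : \int[mu]_t G m t @[m --> \oo] --> (0 : R).
  have -> : 0 = \int[mu]_t (0 : R) :> R by rewrite /Rintegral integral0_eq.
  apply: (@cvg_Rintegral_dominated _ _ _ mu setT G (fun=> 0) (fun t => `|g t|) measurableT mG _ (integrable_norm ig) _).2.
    move=> t _; apply: cvg_near_cst; near=> m; rewrite /G [_ <= _]leNgt.
    have -> : `|t| < m%:R by near: m; exact: nbhs_infty_gtr.
    by rewrite mulr0.
  by move=> m t _; have /andP[p1 p2] := GE m t; rewrite ger0_norm.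
have [m _ hm] : \forall m \near \oo, \int[mu]_t G m t < e * dl.
  apply: (cvgr_lt 0) => //; exact: mulr_gt0.
exists (m%:R + dl) => t0 tA; rewrite leNgt; apply/negP => egt.
have := hm m (leqnn m); rewrite ltNge => /negP; apply.
have le0 : t0 - dl <= t0 + dl by lra.
have -> : e * dl = \int[mu]_(t in `[t0 - dl, t0 + dl]) (e / 2).
  by rewrite Rintegral_cst_itv//; field.
rewrite Rintegral_mkcond; apply: le_Rintegral => //.
  have i0 : mu.-integrable `[t0 - dl, t0 + dl] (EFin \o (fun=> e / 2)).
    by apply: integrable_continuous_itv; apply: continuous_subspaceT => t; exact: cvg_cst.
  have := i0; rewrite [X in X -> _]integrable_mkcond//.
  by apply: (eq_integrable measurableT) => t _; rewrite /= !patchE; case: ifP.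
move=> t _; rewrite patchE; case: ifPn => [|_]; last by case/andP: (GE m t).
rewrite inE /= in_itv/= => /andP[t1 t2].
have td : `|t0 - t| <= dl by rewrite ler_norml; apply/andP; split; lra.
have tm : m%:R <= `|t|.
  have := ler_normD (t0 - t) t; rewrite subrK; lra.
rewrite /G tm mulr1.
have : `|g t0 - g t| <= e / 2.
  rewrite (le_trans (lip _ _))// (@le_trans _ _ ((K + 1) * dl))//.
    by rewrite ler_pM// lerDl.
  by rewrite /dl le_eqVlt; apply/orP; left; apply/eqP; field; rewrite gt_eqF.
have := ler_normD (g t0 - g t) (g t); rewrite subrK; lra.
Unshelve. all: end_near. Qed.

Lemma continuous_lipschitzr (g : R -> R) (K : R) :
  (forall s t, `|g s - g t| <= K * `|s - t|) -> continuous g.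
Proof.
move=> lip t; apply/cvgrPdist_lt => e e0.
have K0 : 0 <= K by have := lip 1 0; rewrite subr0 normr1 mulr1; apply: le_trans.
have ek : 0 < e / (K + 1) by rewrite divr_gt0 ?ltr_wpDl.
near=> s; rewrite (le_lt_trans (lip _ _))//.
rewrite (@le_lt_trans _ _ ((K + 1) * `|t - s|)) ?ler_wpM2r ?lerDl//.
rewrite mulrC -ltr_pdivlMr ?ltr_wpDl//; near: s.
Unshelve. all: end_near. Qed.

Variable f : R -> R.
Hypothesis f_density : probability_density f.
Local Notation phi := (density_cf f).

Lemma integrable_density_first_moment (rho : R) : 1 <= rho ->
  mu.-integrable [set: R] (fun x => (`|x| `^ rho * f x)%:E) ->
  mu.-integrable [set: R] (EFin \o (fun x => `|x| * f x)).
Proof.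
move=> rho1 irho; have [mf f0 f1] := f_density.
have i1 := integrable_density_bounded f_density (@bounded_measurable_cst R _ R 1).
have i2 := integrableD measurableT i1 irho.
apply: (le_integrable measurableT _ _ i2).
  by apply/measurable_EFinP; apply: measurable_funM => //; exact: measurableT_comp.
have pw (a : R) : 1 <= a -> a <= a `^ rho.
  by move=> a1; rewrite -{1}[a]powRr1 ?ler_powR// (le_trans ler01).
have key (a p q : R) : 0 <= a -> 0 <= p -> 0 <= q -> a <= 1 + p -> `|a * q| <= `|q + p * q|.
  move=> a0 p0 q0 h; rewrite !ger0_norm ?addr_ge0 ?mulr_ge0//.
  by rewrite -{2}[q]mul1r -mulrDl ler_wpM2r.
move=> x _ /=; rewrite lee_fin mul1r; have p0 := powR_ge0 `|x| rho; apply: key => //.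
have [x1|x1] := leP `|x| 1; first by rewrite (le_trans x1)// lerDl.
by rewrite (@le_trans _ _ (`|x| `^ rho)) ?lerDr// pw// ltW.
Qed.

Lemma Re_density_cf t : cRe (phi t) = \int[mu]_x (cos (t * x) * f x).
Proof. by apply: eq_Rintegral => x _; rewrite cReM /= mulr0 subr0 expR0 mul1r. Qed.

Lemma Im_density_cf t : cIm (phi t) = \int[mu]_x (sin (t * x) * f x).
Proof. by apply: eq_Rintegral => x _; rewrite cImM /= mulr0 add0r expR0 mul1r. Qed.

Lemma density_cf0 : phi 0 = 1.
Proof.
have [mf f0 f1] := f_density.
apply: complexP; rewrite ?Re_density_cf ?Im_density_cf.
  under eq_Rintegral do rewrite mul0r cos0 mul1r.
  by rewrite /Rintegral f1.
by under eq_Rintegral do rewrite mul0r sin0 mul0r; rewrite /Rintegral integral0_eq.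
Qed.

Lemma normc_density_cf_le1 d (T : measurableType d) (P : probability T R) (Y : {RV P >-> R}) t :
  (forall A : set R, measurable A -> distribution P Y A = (\int[mu]_(x in A) (f x)%:E)%E) ->
  normc (phi t) <= 1.
Proof.
move=> lawY; rewrite -(cintegral_cexpi_density f_density lawY).
apply: normc_cintegral_le => [|w]; last by rewrite normc_cexpi.
by apply: cbounded_measurable_cexpi; exact: measurable_funM.
Qed.

Hypothesis first_moment : mu.-integrable [set: R] (EFin \o (fun x => `|x| * f x)).

Let K := \int[mu]_x (`|x| * f x).

(** Used for cos and sin, the real and imaginary parts of the exponential. *)
Let lipschitz (g : R -> R) : measurable_fun [set: R] g -> (forall x, `|g x| <= 1) ->
  (forall x y, `|g x - g y| <= `|x - y|) -> forall s t,
  `|\int[mu]_x (g (s * x) * f x) - \int[mu]_x (g (t * x) * f x)| <= K * `|s - t|.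
Proof.
move=> mg g1 glip s t; have [mf f0 f1] := f_density.
have bg u : bounded_measurable (fun x : R => g (u * x)).
  by split; [apply: measurableT_comp mg _; exact: measurable_funM|exists 1].
have i1 u := integrable_density_bounded f_density (bg u).
have iB := integrableB measurableT (i1 s) (i1 t).
rewrite -RintegralB//; apply: (le_trans (le_normr_Rintegral _ iB)) => //.
rewrite mulrC -RintegralZl//; apply: le_Rintegral => //.
- exact: (integrable_norm iB).
- exact: (integrableZl measurableT `|s - t| first_moment).
- move=> x _; rewrite /= -mulrBl normrM (ger0_norm (f0 x)) mulrA ler_wpM2r//.
  by rewrite (le_trans (glip _ _))// -mulrBl normrM.
Qed.

Lemma Re_density_cf_lipschitz s t : `|cRe (phi s) - cRe (phi t)| <= K * `|s - t|.
Proof.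
rewrite !Re_density_cf; apply: lipschitz; [|exact: cos_max|exact: normr_cosB_le].
by apply: continuous_measurable_fun; exact: continuous_cos.
Qed.

Lemma Im_density_cf_lipschitz s t : `|cIm (phi s) - cIm (phi t)| <= K * `|s - t|.
Proof.
rewrite !Im_density_cf; apply: lipschitz; [|exact: sin_max|exact: normr_sinB_le].
by apply: continuous_measurable_fun; exact: continuous_sin.
Qed.

Lemma ccontinuous_density_cf : ccontinuous phi.
Proof.
by split; [exact: continuous_lipschitzr Re_density_cf_lipschitz|exact: continuous_lipschitzr Im_density_cf_lipschitz].
Qed.

Lemma density_cf_vanish : cintegrable mu [set: R] phi ->
  forall e : R, 0 < e -> exists A : R, forall t, A <= `|t| -> normc (phi t) <= e.
Proof.
move=> [i1 i2] e e0; have e2 : 0 < e / 2 by rewrite divr_gt0.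
have [A hA] := integrable_lipschitz_vanish Re_density_cf_lipschitz i1 e2.
have [B hB] := integrable_lipschitz_vanish Im_density_cf_lipschitz i2 e2.
exists (Num.max A B) => t; rewrite ge_max => /andP[tA tB].
by rewrite (splitr e) (le_trans (normc_le_ReIm _))//; apply: lerD; [exact: hA|exact: hB].
Qed.

End DensityCf.

(** * Concentration of exp (t^2 / 2) at the ends of [-r, r] *)

Lemma normc_cexp_sub1_le {R : realType} (z : R[i]) : Normc.normc z <= 2^-1 ->
  Normc.normc (cexp z - 1) <= 8 * Normc.normc z.
Proof.
move=> z2; set a := complex.Re z; set b := complex.Im z.
have a0 := normr_Re_le z; have b0 := normr_Im_le z; rewrite -/a -/b in a0 b0.
have z0 := normc_ge0 z.
have a2 : `|a| <= 2^-1 by exact: le_trans a0 z2.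
have e1 : 1 + a <= expR a by exact: expR_ge1Dx.
have e2 : expR a <= 1 + a + 2 * a ^+ 2.
  by apply: expR_le_quadratic; exact: le_trans (ler_norm _) a2.
have aa : a ^+ 2 <= `|a| / 2.
  by rewrite -real_normK ?num_real// expr2 ler_wpM2l.
have ea : `|expR a - 1| <= 2 * `|a|.
  by have := ler_norm a; have := ler_norm (- a); rewrite normrN ler_norml => *; apply/andP; split; lra.
have eb : expR a <= 2.
  by have := ler_norm a; lra.
have ea0 := expR_ge0 a.
have bb : b ^+ 2 <= Normc.normc z / 2.
  rewrite -real_normK ?num_real// expr2.
  by rewrite ler_pM//; exact: le_trans b0 z2.
rewrite (le_trans (normc_le_ReIm _))// cReD cImD cReN cImN /cexp /= oppr0 addr0 -/a -/b.
have h1 : `|expR a * cos b - 1| <= 2 * `|a| + 2 * (Normc.normc z / 2).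
  have -> : expR a * cos b - 1 = (expR a - 1) + expR a * (cos b - 1) by ring.
  rewrite (le_trans (ler_normD _ _))// lerD// normrM (ger0_norm ea0) ler_pM//.
  exact: le_trans (normr_cos_sub1_le _) bb.
have h2 : `|expR a * sin b| <= 2 * Normc.normc z.
  rewrite normrM (ger0_norm ea0) ler_pM//.
  exact: le_trans (normr_sin_le _) b0.
lra.
Qed.

Section EndpointKernel.
Context {R : realType}.
Local Open Scope complex_scope.
Local Notation cRe := (@complex.Re R).
Local Notation cIm := (@complex.Im R).
Local Notation normc := (@Normc.normc R).
Local Notation mu := (@lebesgue_measure R).
Variable r : R.
Hypothesis r_gt0 : 0 < r.
Local Notation I := (`[- r, r]%classic : set R).

(** The weight exp (t^2 / 2) on [-r, r], normalized so that its mass, which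
    concentrates at the two endpoints as r grows, tends to 2. *)
Definition endpoint_kernel (t : R) := r * expR ((t ^+ 2 - r ^+ 2) / 2).
Local Notation k := endpoint_kernel.

Let rr : - r < r. Proof. by rewrite gtrN. Qed.

Lemma continuous_endpoint_kernel : continuous k.
Proof.
move=> t; apply: cvgMr.
apply: (continuous_comp (f := fun t : R => (t ^+ 2 - r ^+ 2) / 2) (g := @expR R)); last exact: continuous_expR.
by apply: cvgMl; apply: cvgB; [exact: exprn_continuous|exact: cvg_cst].
Qed.

Lemma endpoint_kernel_ge0 t : 0 <= k t.
Proof. by rewrite mulr_ge0 ?expR_ge0 ?ltW. Qed.

(** Since r^2 - t^2 >= r (r - `|t|) on [-r, r], the kernel is bounded by these
    exponentials with s = 1 or s = -1 according to the sign of t, and they have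
    explicit primitives. *)
Let E (s t : R) : R := r * expR (- (r * (r - s * t)) / 2).

Let E_ge0 s t : 0 <= E s t.
Proof. by rewrite mulr_ge0 ?expR_ge0 ?ltW. Qed.

Let cE s : continuous (E s).
Proof.
move=> t; apply: cvgMr.
apply: (continuous_comp (f := fun t : R => - (r * (r - s * t)) / 2) (g := @expR R)); last exact: continuous_expR.
by apply: cvgMl; apply: cvgN; apply: cvgMr; apply: cvgB; [exact: cvg_cst|apply: cvgMr; exact: cvg_id].
Qed.

Let k_le t : t \in `[- r, r] -> k t <= E 1 t + E (-1) t /\
  (r - `|t|) * k t <= (r - t) * E 1 t + (r + t) * E (-1) t.
Proof.
rewrite in_itv/= => /andP[t1 t2].
have tE s : s * t = `|t| -> k t <= E s t.
  move=> st; rewrite ler_wpM2l ?(ltW r_gt0)// ler_expR st ler_wpM2r ?invr_ge0//.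
  have tr : `|t| <= r by rewrite ler_norml t1 t2.
  have : 0 <= `|t| * (r - `|t|) by rewrite mulr_ge0// subr_ge0.
  by rewrite -[t ^+ 2]real_normK ?num_real//; lra.
have e1 := E_ge0 1 t; have e2 := E_ge0 (-1) t.
have p1 : 0 <= (r - t) * E 1 t by rewrite mulr_ge0// subr_ge0.
have p2 : 0 <= (r + t) * E (-1) t by rewrite mulr_ge0// -lerBlDl sub0r.
have [t0|t0] := leP 0 t.
  have := tE 1; rewrite mul1r ger0_norm// => /(_ erefl) h; split; first lra.
  by rewrite (@le_trans _ _ ((r - t) * E 1 t)) ?lerDl// ler_wpM2l// subr_ge0.
have := tE (-1); rewrite mulN1r ltr0_norm// => /(_ erefl) h; split; first lra.
by rewrite opprK (@le_trans _ _ ((r + t) * E (-1) t)) ?lerDr// ler_wpM2l// -lerBlDl sub0r.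
Qed.

Let iI (g : R -> R) : continuous g -> mu.-integrable I (EFin \o g).
Proof. by move=> cg; apply: integrable_continuous_itv; exact: continuous_subspaceT. Qed.

Let intE s : s = 1 \/ s = -1 -> \int[mu]_(t in I) E s t <= 2.
Proof.
move=> s1; have s2 : s ^+ 2 = 1 by case: s1 => ->; rewrite ?sqrrN expr1n.
have dF t : is_derive t (1 : R) (fun t => 2 * s * expR (- (r * (r - s * t)) / 2)) (E s t).
  apply: is_derive_eq; rewrite /GRing.scale /= /E.
  by transitivity (s ^+ 2 * r * expR (- (r * (r - s * t)) / 2)); [field|rewrite s2 mul1r].
rewrite (Rintegral_is_derive rr _ dF)//.
case: s1 => ->; rewrite ?mulr1 ?mulrN1 ?mul1r ?mulN1r ?opprK.
  by rewrite subrr mulr0 oppr0 mul0r expR0 mulr1 lerBlDr lerDl mulr_ge0 ?expR_ge0.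
by rewrite subrr mulr0 oppr0 mul0r expR0 !mulNr mulr1 opprK addrC lerBlDr lerDl mulr_ge0 ?expR_ge0.
Qed.

Let cdist (s : R) : continuous (fun t : R => (r - s * t) * E s t).
Proof.
by move=> t; apply: cvgM; [apply: cvgB; [exact: cvg_cst|apply: cvgMr; exact: cvg_id]|exact: cE].
Qed.

Let intdist s : s = 1 \/ s = -1 -> \int[mu]_(t in I) ((r - s * t) * E s t) <= 4 / r.
Proof.
move=> s1; have s2 : s ^+ 2 = 1 by case: s1 => ->; rewrite ?sqrrN expr1n.
have dF (t : R) : is_derive t (1 : R) (fun t : R => s * ((2 * (r - s * t) + 4 / r) * expR (- (r * (r - s * t)) / 2)))
    ((r - s * t) * E s t).
  apply: is_derive_eq; rewrite /GRing.scale /= /E.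
  transitivity (s ^+ 2 * ((r - s * t) * (r * expR (- (r * (r - s * t)) / 2)))); last by rewrite s2 mul1r.
  by field; rewrite gt_eqF.
rewrite (Rintegral_is_derive rr (@cdist s) dF).
have p : 0 <= (2 * (r + r) + 4 / r) * expR (- (r * (r + r)) / 2).
  by rewrite mulr_ge0 ?expR_ge0// !addr_ge0 ?mulr_ge0 ?addr_ge0 ?invr_ge0 ?(ltW r_gt0).
case: s1 => ->; rewrite ?mul1r ?mulN1r ?opprK subrr mulr0 mulr0 oppr0 mul0r expR0 mulr1 add0r.
  by rewrite lerBlDr lerDl.
by rewrite addrC lerBlDr lerDl.
Qed.

Lemma Rintegral_endpoint_kernel_le4 : \int[mu]_(t in I) k t <= 4.
Proof.
apply: (@le_trans _ _ (\int[mu]_(t in I) (E 1 t + E (-1) t))).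
  apply: le_Rintegral => //; first exact: iI continuous_endpoint_kernel.
    by apply: iI => t; apply: cvgD; exact: cE.
  by move=> t /= tr; have [] := k_le tr.
rewrite RintegralD//; [|exact: iI|exact: iI].
rewrite (_ : 4 = 2 + 2); last by ring.
by apply: lerD; apply: intE; [left|right].
Qed.

Lemma Rintegral_endpoint_distance_le : \int[mu]_(t in I) ((r - `|t|) * k t) <= 8 / r.
Proof.
apply: (@le_trans _ _ (\int[mu]_(t in I) ((r - 1 * t) * E 1 t + (r - -1 * t) * E (-1) t))).
  apply: le_Rintegral => //.
  - apply: iI => t; apply: cvgM; last exact: continuous_endpoint_kernel.
    by apply: cvgB; [exact: cvg_cst|exact: norm_continuous].
  - by apply: iI => t; apply: cvgD; exact: cdist.
  - by move=> t /= tr; have [_] := k_le tr; rewrite mulN1r mul1r opprK.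
rewrite RintegralD//; [|exact: (iI (@cdist 1))|exact: (iI (@cdist (-1)))].
have -> : 8 / r = 4 / r + 4 / r by rewrite -mulrDl; congr (_ / _); ring.
by apply: lerD; apply: intdist; [left|right].
Qed.

(** The mass is found by comparing the kernel with (1 + t^2) k / r^2, the
    derivative of t k / r^2. *)
Lemma Rintegral_endpoint_kernel : `|\int[mu]_(t in I) k t - 2| <= 16 / r ^+ 2.
Proof.
have ck := continuous_endpoint_kernel.
have cD : continuous (fun t : R => (1 + t ^+ 2) * (r ^- 2 * k t)).
  move=> t; apply: cvgM.
    by apply: cvgD; [exact: cvg_cst|exact: exprn_continuous].
  by apply: cvgMr; exact: ck.
have dk (t : R) : is_derive t (1 : R) k (t * k t).
  apply: is_derive_eq; rewrite /GRing.scale /= /k.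
  by move: (expR _) => q; field.
have dF (t : R) : is_derive t (1 : R) (fun t : R => t * (r ^- 2 * k t)) ((1 + t ^+ 2) * (r ^- 2 * k t)).
  apply: is_derive_eq; rewrite /GRing.scale /=.
  by move: (k t) (r ^- 2) => q a; ring.
have e2 : \int[mu]_(t in I) ((1 + t ^+ 2) * (r ^- 2 * k t)) = 2.
  rewrite (Rintegral_is_derive rr cD dF).
  by rewrite /k sqrrN subrr mul0r expR0; field; rewrite gt_eqF.
have ck2 : continuous (fun t => r ^- 2 * k t) by move=> t; apply: cvgMr; exact: ck.
have cd : continuous (fun t => (r - `|t|) * k t).
  move=> t; apply: cvgM; last exact: ck.
  by apply: cvgB; [exact: cvg_cst|exact: norm_continuous].
have cd2 : continuous (fun t => 2 / r * ((r - `|t|) * k t)) by move=> t; apply: cvgMr; exact: cd.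
have h1 : 2 <= \int[mu]_(t in I) (r ^- 2 * k t + k t).
  rewrite -e2; apply: le_Rintegral => //.
  - exact: iI.
  - by apply: iI => t; apply: cvgD; [exact: ck2|exact: ck].
  - move=> t /=; rewrite in_itv/= => tr; rewrite mulrDl mul1r lerD2l mulrA.
    rewrite ler_piMl ?endpoint_kernel_ge0//.
    rewrite ler_pdivrMr ?exprn_gt0// mul1r -real_normK ?num_real// lerXn2r ?nnegrE ?(ltW r_gt0)//.
    by rewrite ler_norml.
have h2 : \int[mu]_(t in I) k t <= \int[mu]_(t in I) ((1 + t ^+ 2) * (r ^- 2 * k t) + 2 / r * ((r - `|t|) * k t)).
  apply: le_Rintegral => //.
  - exact: iI.
  - by apply: iI => t; apply: cvgD; [exact: cD|exact: cd2].
  - move=> t /=; rewrite in_itv/= => tr.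
    have tr' : `|t| <= r by rewrite ler_norml.
    rewrite [leRHS](_ : _ = (1 + t ^+ 2 + 2 * r * (r - `|t|)) * r ^- 2 * k t); last by field; rewrite gt_eqF.
    rewrite ler_peMl ?endpoint_kernel_ge0// ler_pdivlMr ?exprn_gt0// mul1r.
    have := sqr_ge0 (r - `|t|); rewrite -[t ^+ 2]real_normK ?num_real//; lra.
rewrite RintegralD// in h1; [|exact: iI|exact: iI].
rewrite RintegralZl// in h1; last exact: iI.
have e3 : \int[mu]_(t in I) ((1 + t ^+ 2) * (r ^- 2 * k t) + 2 / r * ((r - `|t|) * k t)) =
    2 + 2 / r * \int[mu]_(t in I) ((r - `|t|) * k t).
  rewrite RintegralD//; [|exact: (iI cD)|exact: (iI cd2)].
  by congr (_ + _); [exact: e2|rewrite RintegralZl//; exact: iI].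
rewrite e3 in h2.
have r2 : 0 <= r ^- 2 by rewrite invr_ge0 sqr_ge0.
have dle : 2 / r * \int[mu]_(t in I) ((r - `|t|) * k t) <= 16 * r ^- 2.
  rewrite (_ : 16 * r ^- 2 = 2 / r * (8 / r)); last by field; rewrite gt_eqF.
  by rewrite ler_wpM2l ?divr_ge0 ?(ltW r_gt0)// Rintegral_endpoint_distance_le.
have mle : r ^- 2 * \int[mu]_(t in I) k t <= r ^- 2 * 4 by rewrite ler_wpM2l// Rintegral_endpoint_kernel_le4.
move: h1 h2 dle mle; move: (\int[mu]_(t in I) k t) (\int[mu]_(t in I) _) => q p.
move: (r ^- 2) r2 => a a0 h1 h2 dle mle; rewrite ler_norml; apply/andP; split; lra.
Qed.

End EndpointKernel.

(** * The leading term and its variance *)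

Section LeadingTerm.
Context {R : realType}.
Local Open Scope complex_scope.
Local Notation cRe := (@complex.Re R).
Local Notation cIm := (@complex.Im R).
Local Notation normc := (@Normc.normc R).
Local Notation mu := (@lebesgue_measure R).
Variables (lambda y : R) (phi : R -> R[i]).
Hypothesis lambda_gt0 : 0 < lambda.
Hypothesis phi_continuous : ccontinuous phi.
Hypothesis phi_le1 : forall t, normc (phi t) <= 1.
Hypothesis phi_vanish :
  forall e : R, 0 < e -> exists A : R, forall t, A <= `|t| -> normc (phi t) <= e.

Local Notation c0 := (2 * pi * lambda)^-1.
Let C := c0 * expR lambda.

Let C_ge0 : 0 <= C.
Proof. by rewrite mulr_ge0 ?expR_ge0 ?invr_ge0 ?mulr_ge0 ?pi_ge0 ?ltW. Qed.

(** The influence of an observation, scaled so that it remains bounded as r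
    grows. *)
Definition leading r u := r * expR (- (r ^+ 2 / 2)) * influence lambda phi r y u.

(** The weight inv_cf is exp (lambda + t^2 / 2) times this factor, which tends
    to 1 at infinity as phi vanishes there. *)
Let tilt t := cexp (- (lambda%:C * phi t)).

Let ctilt : ccontinuous tilt.
Proof.
apply: ccontinuous_cexp; apply: ccontinuousN; apply: ccontinuousM => //.
exact: ccontinuous_cst.
Qed.

Let tilt_le t : normc (tilt t) <= expR lambda.
Proof.
rewrite normc_cexp ler_expR cReN cReM /= mul0r subr0 -mulrN -[leRHS]mulr1 ler_wpM2l ?(ltW lambda_gt0)//.
by have := le_trans (normr_Re_le (phi t)) (phi_le1 t); rewrite ler_norml => /andP[]; lra.
Qed.

Lemma tilt_vanish (e : R) : 0 < e -> exists A : R, forall t, A <= `|t| -> normc (tilt t - 1) <= e.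
Proof.
move=> e0; pose e' := Num.min 2^-1 (e / 8) / lambda.
have e'0 : 0 < e' by rewrite divr_gt0// lt_min invr_gt0 ltr0n divr_gt0.
have [A hA] := phi_vanish e'0; exists A => t /hA h.
have nz : normc (- (lambda%:C * phi t)) <= Num.min 2^-1 (e / 8).
  by rewrite normcN Normc.normcM normc_real gtr0_norm// -ler_pdivlMl// mulrC.
move: nz; rewrite le_min => /andP[n1 n2].
rewrite (le_trans (normc_cexp_sub1_le n1))// mulrC.
by rewrite -ler_pdivlMr.
Qed.

Section FixedRadius.
Variable r : R.
Hypothesis r_gt0 : 0 < r.
Local Notation I := (`[- r, r]%classic : set R).
Local Notation k := (endpoint_kernel r).

Let ck := @continuous_endpoint_kernel R r.

Let iI (g : R -> R) : continuous g -> mu.-integrable I (EFin \o g).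
Proof. by move=> cg; apply: integrable_continuous_itv; exact: continuous_subspaceT. Qed.

Let F u t := cRe (cexpi (t * (u - y)) * tilt t).

Let cF u : continuous (F u).
Proof. by have [] := ccontinuousM (ccontinuous_cexpi (u - y)) ctilt. Qed.

Let ckF u : continuous (fun t => k t * F u t).
Proof. by move=> t; apply: cvgM; [exact: ck|exact: cF]. Qed.

Lemma leadingE u : leading r u = C * \int[mu]_(t in I) (k t * F u t).
Proof.
rewrite /leading /influence mulrCA -[C]/(c0 * expR lambda) -[RHS]mulrA; congr (_ * _).
have ci : mu.-integrable I (EFin \o (fun t => cRe (cexpi (t * (u - y)) * inv_cf lambda phi t))).
  have [h _] := ccontinuousM (ccontinuous_cexpi (u - y)) (ccontinuous_inv_cf lambda phi_continuous).
  exact: iI.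
rewrite -(RintegralZl _ _ ci)// -RintegralZl//; last exact: (iI (@ckF u)).
apply: eq_Rintegral => t _.
have -> : inv_cf lambda phi t = (expR lambda * expR (t ^+ 2 / 2))%:C * tilt t.
  rewrite /inv_cf /tilt mulrBr mulr1 cexpD cexp_real rmorphM /=; ring.
have reC (p : R) (z : R[i]) : cRe (p%:C * z) = p * cRe z by rewrite cReM /= mul0r subr0.
rewrite mulrCA reC /F /endpoint_kernel.
have -> : expR ((t ^+ 2 - r ^+ 2) / 2) = expR (t ^+ 2 / 2) * expR (- (r ^+ 2 / 2)).
  by rewrite -expRD; congr expR; ring.
by move: (cRe _) (expR (t ^+ 2 / 2)) (expR (- (r ^+ 2 / 2))) => a p q; ring.
Qed.

Let F_le u t : `|F u t| <= expR lambda.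
Proof.
by rewrite (le_trans (normr_Re_le _))// Normc.normcM normc_cexpi mul1r.
Qed.

Lemma normr_leading_le u : `|leading r u| <= C * (4 * expR lambda).
Proof.
rewrite leadingE normrM (ger0_norm C_ge0) ler_wpM2l//.
apply: (le_trans (le_normr_Rintegral _ (iI (@ckF u)))) => //.
apply: (@le_trans _ _ (\int[mu]_(t in I) (expR lambda * k t))).
  apply: le_Rintegral => //.
  - exact: (integrable_norm (iI (@ckF u))).
  - by apply: iI => t; apply: cvgMr; exact: ck.
  - move=> t _; rewrite normrM ger0_norm ?endpoint_kernel_ge0// mulrC.
    by rewrite ler_wpM2r ?endpoint_kernel_ge0.
rewrite RintegralZl//; last exact: iI.
by rewrite mulrC ler_wpM2r ?expR_ge0// Rintegral_endpoint_kernel_le4.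
Qed.

Lemma bounded_measurable_leading : bounded_measurable (leading r).
Proof.
split; last by exists (C * (4 * expR lambda)); exact: normr_leading_le.
apply: measurable_funM => //; apply: measurable_funM => //.
apply: (measurable_Rintegral_param (K := fun p : R * R => cRe (cexpi (p.2 * (p.1 - y)) * inv_cf lambda phi p.2))) => //.
have [] // := @cmeasurableM _ _ (R * R)%type (fun p => cexpi (p.2 * (p.1 - y))) (fun p => inv_cf lambda phi p.2).
  apply: cmeasurable_cexpi; apply: measurable_funM; first exact: measurable_snd.
  by apply: measurable_funB => //; exact: measurable_fst.
apply: (cmeasurable_comp _ measurable_snd).
by have [h1 h2] := ccontinuous_inv_cf lambda phi_continuous; split; exact: continuous_measurable_fun.
Qed.

Variables (e A : R).
Hypothesis e_gt0 : 0 < e.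
Hypothesis A_lt : A < r.
Hypothesis tilt_near1 : forall t, A <= `|t| -> normc (tilt t - 1) <= e.

Let G := expR lambda + 1.

Let tilt_sub1_le t : t \in `[- r, r] -> normc (tilt t - 1) <= e + G / (r - A) * (r - `|t|).
Proof.
move=> tr; have tr' : 0 <= r - `|t| by move: tr; rewrite in_itv/= subr_ge0 ler_norml.
have G0 : 0 <= G by rewrite addr_ge0 ?expR_ge0.
have rA : 0 < r - A by rewrite subr_gt0.
have [tA|tA] := leP A `|t|.
  by rewrite (le_trans (tilt_near1 tA))// lerDl mulr_ge0// divr_ge0// ltW.
rewrite (@le_trans _ _ G)//.
  rewrite (le_trans (le_normcD _ _))// normcN lerD//.
  by rewrite (_ : 1 = (1 : R)%:C)// normc_real normr1.
rewrite (@le_trans _ _ (G / (r - A) * (r - `|t|)))//; last by rewrite lerDr ltW.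
rewrite mulrAC ler_pdivlMr// ler_wpM2l//; lra.
Qed.

Let cos_near_endpoint t a : t \in `[- r, r] -> `|cos (t * a) - cos (r * a)| <= (r - `|t|) * `|a|.
Proof.
rewrite in_itv/= => /andP[t1 t2]; have [t0|t0] := leP 0 t.
  rewrite (le_trans (normr_cosB_le _ _))// -mulrBl normrM (ger0_norm t0).
  by rewrite (_ : `|t - r| = r - t)// distrC ger0_norm// subr_ge0.
rewrite (ltr0_norm t0) opprK -[cos (r * a)]cosN (le_trans (normr_cosB_le _ _))//.
rewrite opprK -mulrDl normrM addrC ger0_norm//; lra.
Qed.

(** The kernel has mass about 2, concentrated where tilt t is close to 1 and
    cos (t a) is close to cos (r a), with a = u - y. *)
Lemma leading_approx u : `|leading r u - 2 * C * cos (r * (u - y))| <=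
  C * (4 * e + (G / (r - A) + `|u - y|) * (8 / r) + 16 / r ^+ 2).
Proof.
set a := u - y; set b := cos (r * a).
have cFb : continuous (fun t => k t * (F u t - b)).
  by move=> t; apply: cvgM; [exact: ck|apply: cvgB; [exact: cF|exact: cvg_cst]].
have -> : leading r u - 2 * C * b = C * (\int[mu]_(t in I) (k t * (F u t - b)) + (\int[mu]_(t in I) k t - 2) * b).
  have -> : \int[mu]_(t in I) (k t * (F u t - b)) = \int[mu]_(t in I) (k t * F u t) - b * \int[mu]_(t in I) k t.
    rewrite -RintegralZl//; last exact: iI.
    rewrite -RintegralB//; [|exact: iI|by apply: iI => t; apply: cvgMr; exact: ck].
    by apply: eq_Rintegral => t _; rewrite mulrBr [b * _]mulrC.
  by rewrite leadingE; ring.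
rewrite normrM (ger0_norm C_ge0) ler_wpM2l// (le_trans (ler_normD _ _))//.
have cd : continuous (fun t => (r - `|t|) * k t).
  move=> t; apply: cvgM; last exact: ck.
  by apply: cvgB; [exact: cvg_cst|exact: norm_continuous].
have cek : continuous (fun t => e * k t) by move=> t; apply: cvgMr; exact: ck.
pose H := G / (r - A) + `|a|.
have H0 : 0 <= H.
  have rA : 0 <= r - A by rewrite subr_ge0 ltW.
  by rewrite /H addr_ge0// divr_ge0// addr_ge0// expR_ge0.
have cdk : continuous (fun t => H * ((r - `|t|) * k t)) by move=> t; apply: cvgMr; exact: cd.
apply: lerD; last first.
  rewrite normrM -[leRHS]mulr1 ler_pM ?cos_max//.
  exact: Rintegral_endpoint_kernel.
apply: (le_trans (le_normr_Rintegral _ (iI cFb))) => //.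
apply: (@le_trans _ _ (\int[mu]_(t in I) (e * k t + H * ((r - `|t|) * k t)))).
  apply: le_Rintegral => //.
  - exact: (integrable_norm (iI cFb)).
  - by apply: iI => t; apply: cvgD; [exact: cek|exact: cdk].
  move=> t /= tr; have k0 := endpoint_kernel_ge0 r_gt0 t.
  rewrite normrM (ger0_norm k0) mulrC mulrA -mulrDl ler_wpM2r//.
  have -> : F u t - b = cRe (cexpi (t * a) * (tilt t - 1)) + (cos (t * a) - b).
    by rewrite mulrBr mulr1 cReD cReN Re_cexpi /F -/a; ring.
  rewrite (le_trans (ler_normD _ _))// /H mulrDl addrA lerD//; last first.
    by rewrite [leRHS]mulrC; exact: cos_near_endpoint.
  rewrite (le_trans (normr_Re_le _))// Normc.normcM normc_cexpi mul1r.
  exact: tilt_sub1_le.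
rewrite RintegralD//; [|exact: iI|exact: (iI cdk)].
rewrite RintegralZl//; last exact: iI.
rewrite RintegralZl//; last exact: iI.
apply: lerD; first by rewrite mulrC ler_wpM2r ?(ltW e_gt0)// Rintegral_endpoint_kernel_le4.
by rewrite ler_wpM2l// Rintegral_endpoint_distance_le.
Qed.

End FixedRadius.

Section Variance.
Context d (T : measurableType d) (P : probability T R).
Local Notation Ec := (cintegral P [set: T]).
Variables (X : T -> R) (m1 : R).
Hypothesis mX : measurable_fun [set: T] X.
Hypothesis intX : P.-integrable [set: T] (EFin \o X).
Hypothesis absX : \int[P]_w `|X w| <= m1.
Hypothesis cfX : forall t, Ec (fun w => cexpi (t * X w)) * inv_cf lambda phi t = 1.

Let bX (g : R -> R) : bounded_measurable g -> bounded_measurable (fun w => g (X w)).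
Proof. by move=> bg; exact: (bounded_measurable_comp mX bg). Qed.

(** The characteristic function of X is dominated by that of its Gaussian
    component. *)
Let mean_cos_le s : `|\int[P]_w cos (s * (X w - y))| <= expR (- (s ^+ 2 / 2)).
Proof.
have bc : cbounded_measurable (fun w => cexpi (s * X w)).
  by apply: cbounded_measurable_cexpi; exact: measurable_funM.
have -> : \int[P]_w cos (s * (X w - y)) = cRe (cexpi (- (s * y)) * Ec (fun w => cexpi (s * X w))).
  rewrite -cintegralZ//; apply: eq_Rintegral => w _.
  by rewrite -cexpiD Re_cexpi; congr cos; ring.
rewrite (le_trans (normr_Re_le _))// Normc.normcM normc_cexpi mul1r.
have := congr1 normc (cfX s); rewrite Normc.normcM (_ : 1 = (1 : R)%:C)// normc_real normr1.
rewrite /inv_cf Normc.normcM normc_cexp normc_real gtr0_norm ?expR_gt0// => e.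
rewrite expRN -div1r ler_pdivlMr ?expR_gt0//.
apply: le_trans (eq_ind _ (fun u => u <= 1) (lexx 1) _ (esym e)).
rewrite ler_wpM2l ?normc_ge0// ler_peMl ?expR_ge0// -expR0 ler_expR.
rewrite cReM /= mul0r subr0 mulr_ge0 ?(ltW lambda_gt0)// cReD cReN /= subr_ge0.
exact: le_trans (ler_norm _) (le_trans (normr_Re_le _) (phi_le1 s)).
Qed.

Variable r : nat -> R.
Hypothesis r_gt0 : forall n, 0 < r n.
Hypothesis r_pinfty : r n @[n --> \oo] --> +oo.

Let mean_cos_cvg c : 0 < c -> \int[P]_w cos (c * r n * (X w - y)) @[n --> \oo] --> (0 : R).
Proof.
move=> c_gt0; apply: norm_cvg0; apply/cvgrPdist_lt => e e0; near=> n.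
rewrite sub0r normrN normr_id (le_lt_trans (mean_cos_le _))//.
have rn : 2 * e^-1 / c ^+ 2 <= r n by near: n; move/cvgryPge : r_pinfty; exact.
have rn1 : 1 <= r n by near: n; move/cvgryPge : r_pinfty; exact.
rewrite expRN invf_plt ?posrE ?expR_gt0//.
rewrite (@lt_le_trans _ _ (1 + (c * r n) ^+ 2 / 2)) ?expR_ge1Dx//.
rewrite (@le_lt_trans _ _ ((c * r n) ^+ 2 / 2)) ?ltrDr//.
rewrite ler_pdivlMr// mulrC exprMn -ler_pdivrMl ?exprn_gt0// mulrC.
have -> : c ^- 2 * (e^-1 * 2) = 2 * e^-1 / c ^+ 2 by rewrite mulrC [e^-1 * 2]mulrC.
by rewrite (le_trans rn)// expr2 ler_peMl// (le_trans _ rn1).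
Unshelve. all: end_near. Qed.

Let bcos s : bounded_measurable (fun u : R => cos (s * (u - y))).
Proof.
apply: bounded_measurable_cos; apply: measurable_funM => //.
exact: measurable_funB.
Qed.

Let bdiff n : bounded_measurable (fun w => `|leading (r n) (X w) - 2 * C * cos (r n * (X w - y))|).
Proof.
apply: (bX (g := fun u => `|leading (r n) u - 2 * C * cos (r n * (u - y))|)).
apply: bounded_measurable_norm; apply: bounded_measurableB; first exact: bounded_measurable_leading.
by apply: bounded_measurableM => //; exact: bounded_measurable_cst.
Qed.

Let D n := \int[P]_w `|leading (r n) (X w) - 2 * C * cos (r n * (X w - y))|.

Let D_ge0 n : 0 <= D n. Proof. exact: Rintegral_ge0. Qed.

Let D_le n (e A : R) : 0 < e -> A < r n -> (forall t, A <= `|t| -> normc (tilt t - 1) <= e) ->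
  D n <= C * (4 * e + ((expR lambda + 1) / (r n - A) + (m1 + `|y|)) * (8 / r n) + 16 / r n ^+ 2).
Proof.
move=> e0 Ar tl; set G := expR lambda + 1.
have icst (c : R) : P.-integrable [set: T] (EFin \o (fun=> c)).
  by apply: bounded_measurable_integrable; exact: bounded_measurable_cst.
have iab : P.-integrable [set: T] (EFin \o (fun w => `|X w| + `|y|)).
  exact: (integrableD _ (integrable_norm intX) (icst `|y|)).
pose q := C * (8 / r n); pose p := C * (4 * e + G / (r n - A) * (8 / r n) + 16 / r n ^+ 2).
have q0 : 0 <= q by rewrite mulr_ge0// divr_ge0// ltW.
apply: (@le_trans _ _ (\int[P]_w (p + q * (`|X w| + `|y|)))).
  apply: le_Rintegral => //.
  - exact: (bounded_measurable_integrable _ (bdiff n)).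
  - exact: (integrableD _ (icst p) (integrableZl measurableT q iab)).
  - move=> w _; rewrite (le_trans (leading_approx (r_gt0 n) e0 Ar tl _))// -/G.
    have := ler_normB (X w) y; move: (`|X w - y|) => a0 ha.
    rewrite (_ : C * _ = p + q * a0); last by rewrite /p /q; ring.
    by rewrite lerD2l ler_wpM2l.
have iq := integrableZl measurableT q iab.
rewrite RintegralD//.
rewrite bint_cst RintegralZl// RintegralD//; last exact: (integrable_norm intX).
rewrite bint_cst (_ : C * _ = p + q * (m1 + `|y|)); last by rewrite /p /q; ring.
by rewrite lerD2l ler_wpM2l// lerD2r.
Qed.

Let D_cvg : D n @[n --> \oo] --> (0 : R).
Proof.
apply: norm_cvg0; apply/cvgrPdist_le => e e0.
rewrite /=; pose e' := e / (7 * (C + 1)).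
have C1 : 0 < C + 1 by rewrite ltr_wpDl.
have e'0 : 0 < e' by rewrite divr_gt0// mulr_gt0.
have [A hA] := tilt_vanish e'0.
pose L := 8 * (expR lambda + 1 + (m1 + `|y|)).
near=> n; rewrite sub0r normrN normr_id ger0_norm//.
have rA : A + 1 <= r n by near: n; move/cvgryPge : r_pinfty; exact.
have rL : L / e' <= r n by near: n; move/cvgryPge : r_pinfty; exact.
have r16 : 16 / e' <= r n by near: n; move/cvgryPge : r_pinfty; exact.
have r1 : 1 <= r n by near: n; move/cvgryPge : r_pinfty; exact.
have Ar : A < r n by lra.
have r0 := r_gt0 n.
have m0 : 0 <= m1 by rewrite (le_trans _ absX)// Rintegral_ge0.
rewrite (le_trans (D_le e'0 Ar hA))//.
apply: (@le_trans _ _ (C * (4 * e' + e' + e'))).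
  rewrite ler_wpM2l// lerD//.
    rewrite lerD2l.
    apply: (@le_trans _ _ ((expR lambda + 1 + (m1 + `|y|)) * (8 / r n))).
      rewrite ler_wpM2r ?divr_ge0 ?(ltW r0)// lerD2r ler_pdivrMr ?subr_gt0//.
      by rewrite ler_peMr ?addr_ge0 ?expR_ge0//; lra.
    rewrite mulrA ler_pdivrMr// -ler_pdivrMl// mulrC mulrC.
    by rewrite [_ * 8]mulrC mulrC.
  rewrite ler_pdivrMr ?exprn_gt0// (@le_trans _ _ (e' * r n))//.
    by rewrite -ler_pdivrMl// mulrC.
  by rewrite ler_wpM2l ?(ltW e'0)// expr2 ler_peMl// ltW.
have -> : 4 * e' + e' + e' = 6 * e' by ring.
have -> : C * (6 * e') = (6 / 7 * (C / (C + 1))) * e by rewrite /e'; field; rewrite gt_eqF.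
rewrite ler_piMl ?(ltW e0)// mulr_ile1 ?divr_ge0 ?(ltW C1)//.
  by rewrite ler_pdivrMr ?mul1r ?ler_nat.
by rewrite ler_pdivrMr// mul1r lerDl.
Unshelve. all: end_near. Qed.

Let mean_leading_cvg : \int[P]_w leading (r n) (X w) @[n --> \oo] --> (0 : R).
Proof.
have bl n := bX (bounded_measurable_leading (r_gt0 n)).
have bc n : bounded_measurable (fun w => 2 * C * cos (r n * (X w - y))).
  by apply: bounded_measurableM; [exact: bounded_measurable_cst|exact: (bX (bcos (r n)))].
have h : \int[P]_w (2 * C * cos (r n * (X w - y))) @[n --> \oo] --> (0 : R).
  rewrite (_ : (fun n => _) = (fun n => 2 * C * \int[P]_w cos (r n * (X w - y)))); last first.
    by apply/funext => n; rewrite (bintZ _ _ (bX (bcos (r n)))).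
  rewrite -(mulr0 (2 * C)); apply: cvgMr.
  have := mean_cos_cvg ltr01; apply: cvg_trans; apply: near_eq_cvg; near=> n.
  by under eq_Rintegral do rewrite mul1r.
rewrite -[X in _ --> X]addr0.
have -> : (fun n => \int[P]_w leading (r n) (X w)) =
    (fun n => \int[P]_w (2 * C * cos (r n * (X w - y))) +
       \int[P]_w (leading (r n) (X w) - 2 * C * cos (r n * (X w - y)))).
  apply/funext => n; rewrite bintB; [|exact: bl|exact: bc].
  by rewrite addrC subrK.
apply: cvgD => //; apply: norm_cvg0; apply: (squeeze_cvgr _ (cvg_cst 0) D_cvg); near=> n.
rewrite normr_ge0 /=; apply: bint_norm_le.
by apply: bounded_measurableB; [exact: bl|exact: bc].
Unshelve. all: end_near. Qed.

Let B := C * (4 * expR lambda).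

(** As cos^2 a = (1 + cos (2 a)) / 2 and the mean of cos (2 r (X - y)) tends to
    0, the square of 2 C cos (r (X - y)) has limit mean 2 C^2. *)
Let mean_leading2_cvg : \int[P]_w leading (r n) (X w) ^+ 2 @[n --> \oo] --> 2 * C ^+ 2.
Proof.
have bl n := bX (bounded_measurable_leading (r_gt0 n)).
have bl2 n : bounded_measurable (fun w => leading (r n) (X w) ^+ 2).
  by under eq_fun do rewrite expr2; exact: bounded_measurableM.
have bc n : bounded_measurable (fun w => 2 * C * cos (r n * (X w - y))).
  by apply: bounded_measurableM; [exact: bounded_measurable_cst|exact: (bX (bcos (r n)))].
have bc2 n : bounded_measurable (fun w => (2 * C * cos (r n * (X w - y))) ^+ 2).
  by under eq_fun do rewrite expr2; exact: bounded_measurableM.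
have h : \int[P]_w (2 * C * cos (r n * (X w - y))) ^+ 2 @[n --> \oo] --> 2 * C ^+ 2.
  have E n : \int[P]_w (2 * C * cos (r n * (X w - y))) ^+ 2 =
      2 * C ^+ 2 + 2 * C ^+ 2 * \int[P]_w cos (2 * r n * (X w - y)).
    rewrite -bintZ; last exact: (bX (bcos _)).
    rewrite -[X in X + _](bint_cst P) -bintD; last 2 first.
    - exact: bounded_measurable_cst.
    - by apply: bounded_measurableM; [exact: bounded_measurable_cst|exact: (bX (bcos _))].
    apply: eq_Rintegral => w _.
    have -> : 2 * r n * (X w - y) = (r n * (X w - y)) *+ 2 by rewrite mulr2n; ring.
    by rewrite cos_mulr2n; ring.
  rewrite (funext E).
  rewrite -[X in _ --> X]addr0; apply: cvgD; first exact: cvg_cst.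
  by rewrite -(mulr0 (2 * C ^+ 2)); apply: cvgMr; exact: mean_cos_cvg.
rewrite -[X in _ --> X]addr0.
have -> : (fun n => \int[P]_w leading (r n) (X w) ^+ 2) =
    (fun n => \int[P]_w (2 * C * cos (r n * (X w - y))) ^+ 2 +
       \int[P]_w (leading (r n) (X w) ^+ 2 - (2 * C * cos (r n * (X w - y))) ^+ 2)).
  apply/funext => n; rewrite bintB; [|exact: bl2|exact: bc2].
  by rewrite addrC subrK.
apply: cvgD => //; apply: norm_cvg0.
have DB : (B + 2 * C) * D n @[n --> \oo] --> (0 : R).
  by rewrite -(mulr0 (B + 2 * C)); apply: cvgMr; exact: D_cvg.
apply: (squeeze_cvgr _ (cvg_cst 0) DB); near=> n.
rewrite normr_ge0 /=.
have bd : bounded_measurable (fun w => leading (r n) (X w) ^+ 2 - (2 * C * cos (r n * (X w - y))) ^+ 2).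
  by apply: bounded_measurableB; [exact: bl2|exact: bc2].
rewrite (le_trans (bint_norm_le _ bd))// /D -bintZ//.
apply: bint_le.
- exact: bounded_measurable_norm.
- by apply: bounded_measurableM; [exact: bounded_measurable_cst|exact: bdiff].
move=> w; rewrite subr_sqr normrM mulrC ler_wpM2r// (le_trans (ler_normD _ _))// lerD//.
  exact: normr_leading_le.
have C2 : 0 <= 2 * C by rewrite mulr_ge0.
by rewrite normrM (ger0_norm C2) ler_piMr// cos_max.
Unshelve. all: end_near. Qed.

Definition centered_leading n u := leading (r n) u - \int[P]_w leading (r n) (X w).

Lemma centered_leadingP :
  [/\ forall n, bounded_measurable (centered_leading n),
      forall n u, `|centered_leading n u| <= 2 * B,
      forall n, \int[P]_w centered_leading n (X w) = 0 &
      \int[P]_w centered_leading n (X w) ^+ 2 @[n --> \oo] --> 2 * C ^+ 2].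
Proof.
have bl n := bX (bounded_measurable_leading (r_gt0 n)).
have bl2 n : bounded_measurable (fun w => leading (r n) (X w) ^+ 2).
  by under eq_fun do rewrite expr2; exact: bounded_measurableM.
split.
- by move=> n; apply: bounded_measurableB; [exact: bounded_measurable_leading|exact: bounded_measurable_cst].
- move=> n u; rewrite (le_trans (ler_normB _ _))// mulr_natl mulr2n lerD//; first exact: normr_leading_le.
  by apply: bint_norm_le_cst => // w; exact: normr_leading_le.
- by move=> n; rewrite bintB ?bint_cst ?subrr//; exact: bounded_measurable_cst.
- have E n : \int[P]_w centered_leading n (X w) ^+ 2 =
     \int[P]_w leading (r n) (X w) ^+ 2 - (\int[P]_w leading (r n) (X w)) ^+ 2.
    set m := \int[P]_w leading (r n) (X w).
    have -> : (fun w => centered_leading n (X w) ^+ 2) =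
       (fun w => leading (r n) (X w) ^+ 2 - (2 * m * leading (r n) (X w) - m ^+ 2)).
      by apply/funext => w; rewrite /centered_leading -/m; ring.
    have b1 : bounded_measurable (fun w => 2 * m * leading (r n) (X w)).
      by apply: bounded_measurableM => //; exact: bounded_measurable_cst.
    rewrite bintB//; last by apply: bounded_measurableB => //; exact: bounded_measurable_cst.
    have bm : bounded_measurable (fun _ : T => m ^+ 2) by exact: bounded_measurable_cst.
    rewrite (bintB _ b1 bm) bint_cst (bintZ _ (2 * m) (bl n)) -/m.
    by move: (\int[P]_w (leading (r n) (X w) ^+ 2)) => q; ring.
  rewrite (funext E).
  rewrite -[X in _ --> X]subr0; apply: cvgB; first exact: mean_leading2_cvg.
  rewrite (_ : (fun n => _ ^+ 2) = (fun n => (\int[P]_w leading (r n) (X w)) * \int[P]_w leading (r n) (X w)))//.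
  by rewrite -[X in _ --> X](mulr0 0); apply: cvgM; exact: mean_leading_cvg.
Qed.

End Variance.
End LeadingTerm.

(** * Equal laws and rates of convergence *)

Section EqualLaws.
Context {R : realType} d (T : measurableType d) (P : probability T R)
  d' (T' : measurableType d') (P' : probability T' R).
Variables (X : T -> R) (S : T' -> R).
Hypothesis mX : measurable_fun [set: T] X.
Hypothesis mS : measurable_fun [set: T'] S.
Hypothesis law : forall A : set R, measurable A -> P (X @^-1` A) = P' (S @^-1` A).

Lemma Rintegral_eq_law (g : R -> R) : bounded_measurable g ->
  \int[P]_w g (X w) = \int[P']_w g (S w).
Proof.
move=> bg; have mg : measurable_fun [set: R] (EFin \o g) by apply/measurable_EFinP; exact: bg.1.
rewrite /Rintegral; congr fine.
transitivity (\int[P]_(w in X @^-1` setT) ((EFin \o g) \o X) w)%E; first by rewrite preimage_setT.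
transitivity (\int[P']_(w in S @^-1` setT) ((EFin \o g) \o S) w)%E; last by rewrite preimage_setT.
rewrite -(integral_pushforward mX)//; last first.
  by rewrite preimage_setT; exact: (bounded_measurable_integrable _ (bounded_measurable_comp mX bg)).
rewrite -(integral_pushforward mS)//; last first.
  by rewrite preimage_setT; exact: (bounded_measurable_integrable _ (bounded_measurable_comp mS bg)).
by apply: eq_measure_integral => A mA _; exact: law.
Qed.

Let integral_norm_eq_law : (\int[P]_w `|X w|%:E = \int[P']_w `|S w|%:E)%E.
Proof.
have mn : measurable_fun [set: R] (fun x : R => `|x|%:E).
  by apply/measurable_EFinP; exact: normr_measurable.
transitivity (\int[P]_(w in X @^-1` setT) ((fun x : R => `|x|%:E) \o X) w)%E; first by rewrite preimage_setT.
transitivity (\int[P']_(w in S @^-1` setT) ((fun x : R => `|x|%:E) \o S) w)%E; last by rewrite preimage_setT.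
rewrite -(ge0_integral_pushforward mX)//.
rewrite -(ge0_integral_pushforward mS)//.
by apply: eq_measure_integral => A mA _; exact: law.
Qed.

Lemma integrable_eq_law : P'.-integrable [set: T'] (EFin \o S) ->
  P.-integrable [set: T] (EFin \o X) /\ \int[P]_w `|X w| = \int[P']_w `|S w|.
Proof.
move=> /integrableP[_ iS]; split; last by rewrite /Rintegral integral_norm_eq_law.
apply/integrableP; split; first exact/measurable_EFinP.
by move: iS; rewrite /= -integral_norm_eq_law.
Qed.

End EqualLaws.

Section Asymptotics.
Context {R : realType}.

Lemma powR_ge (l K a : R) : 0 < a -> 0 <= K -> K `^ a^-1 <= l -> K <= l `^ a.
Proof.
move=> a0 K0 h; rewrite -{1}[K]powRr1// -(mulVf (lt0r_neq0 a0)) powRrM.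
rewrite ge0_ler_powR ?(ltW a0)// ?nnegrE ?powR_ge0//.
by rewrite (le_trans _ h) ?powR_ge0.
Qed.

Lemma ln_natr_ge (A : R) : \forall n \near \oo, A <= ln n%:R.
Proof.
near=> n; rewrite -[A]expRK ler_ln ?posrE ?expR_gt0//.
  by near: n; move/cvgryPge : (@cvgr_idn R); exact.
by rewrite ltr0n; near: n; exact: nbhs_infty_gt.
Unshelve. all: end_near. Qed.

Variables (beta : R) (h : nat -> R).
Hypothesis beta_gt0 : 0 < beta.
Hypothesis beta_lt : beta < 1 / 2.
Hypothesis h_gt0 : forall n, 0 < h n.
Hypothesis h_equiv : h ~_\oo (fun n : nat => ln n%:R `^ (- beta)).

Let h_close : \forall n \near \oo,
  ln n%:R `^ (- beta) / 2 <= h n /\ h n <= 2 * ln n%:R `^ (- beta).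
Proof.
have /eqaddoP H := h_equiv.
have half0 : 0 < 2^-1 :> R by rewrite invr_gt0.
have := H _ half0; apply: filterS => n.
rewrite /= (ger0_norm (powR_ge0 _ _)) ler_norml => /andP[].
have -> : (h - (fun n : nat => ln n%:R `^ (- beta))) n = h n - ln n%:R `^ (- beta) by [].
have := powR_ge0 (ln n%:R : R) (- beta); move: (ln n%:R `^ (- beta)) => g g0 h1 h2.
by split; lra.
Qed.

Lemma inverse_bandwidth_pinfty : (h n)^-1 @[n --> \oo] --> +oo.
Proof.
apply/cvgryPge => A; near=> n.
have [_ h2] : ln n%:R `^ (- beta) / 2 <= h n /\ h n <= 2 * ln n%:R `^ (- beta) by near: n.
have l0 : 1 <= ln n%:R :> R by near: n; exact: ln_natr_ge.
have l1 : (2 * `|A|) `^ beta^-1 <= ln n%:R by near: n; exact: ln_natr_ge.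
have := powR_ge beta_gt0 _ l1 => /(_ _); rewrite mulr_ge0// => /(_ isT) lb.
have p0 : 0 < ln n%:R `^ beta :> R by rewrite powR_gt0// (lt_le_trans ltr01).
rewrite (le_trans (ler_norm A))// (@le_trans _ _ (ln n%:R `^ beta / 2))//.
  by rewrite ler_pdivlMr// mulrC.
rewrite -[leLHS]invrK lef_pV2 ?posrE ?invr_gt0 ?divr_gt0//.
by rewrite invfM invrK -powRN mulrC.
Unshelve. all: end_near. Qed.

(** The square of the inverse bandwidth is of the order of (ln n)^(2 beta), and
    2 beta < 1. *)
Lemma inverse_bandwidth_sqr_le (c : R) : 0 < c ->
  \forall n \near \oo, (h n)^-1 ^+ 2 <= c * ln n%:R.
Proof.
move=> c0; near=> n.
have [h1 _] : ln n%:R `^ (- beta) / 2 <= h n /\ h n <= 2 * ln n%:R `^ (- beta) by near: n.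
have l0 : 1 <= ln n%:R :> R by near: n; exact: ln_natr_ge.
have g0 : 0 < 1 - 2 * beta.
  by have := beta_lt; rewrite ltr_pdivlMr// mulrC subr_gt0.
have c40 : 0 <= 4 / c by rewrite divr_ge0// ltW.
have l1 : (4 / c) `^ (1 - 2 * beta)^-1 <= ln n%:R by near: n; exact: ln_natr_ge.
have lb := powR_ge g0 c40 l1.
have ln0 : 0 < ln n%:R :> R by rewrite (lt_le_trans ltr01).
have p0 : 0 < ln n%:R `^ beta :> R by rewrite powR_gt0.
have hle : (h n)^-1 <= 2 * ln n%:R `^ beta.
  rewrite -[leRHS]invrK lef_pV2 ?posrE ?invr_gt0 ?mulr_gt0//.
  by rewrite invfM -powRN mulrC.
apply: (@le_trans _ _ ((2 * ln n%:R `^ beta) ^+ 2)).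
  by rewrite lerXn2r ?nnegrE ?invr_ge0 ?mulr_ge0 ?(ltW (h_gt0 _)) ?(ltW p0).
have e : ln n%:R = (ln n%:R `^ beta) ^+ 2 * ln n%:R `^ (1 - 2 * beta) :> R.
  rewrite expr2 -!powRD ?(gt_eqF ln0) ?implybT//.
  rewrite (_ : beta + beta + (1 - 2 * beta) = 1); last by ring.
  by rewrite powRr1// ltW.
apply: (@le_trans _ _ (c * ((ln n%:R `^ beta) ^+ 2 * ln n%:R `^ (1 - 2 * beta)))); last by rewrite -e.
have := lb; rewrite ler_pdivrMr// => h4.
rewrite (_ : (2 * _) ^+ 2 = (ln n%:R `^ beta) ^+ 2 * 4); last by ring.
by rewrite mulrCA ler_wpM2l ?sqr_ge0// mulrC.
Unshelve. all: end_near. Qed.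

End Asymptotics.

Section RemainderRate.
Context {R : realType}.

Lemma expRN_le_pow4 (x : R) : 0 < x -> expR (- x) <= 4 ^+ 4 / x ^+ 4.
Proof.
move=> x0; have p4 : 0 < 4 ^+ 4 / x ^+ 4 by apply: divr_gt0; exact: exprn_gt0.
rewrite expRN -[leRHS]invrK lef_pV2 ?posrE ?expR_gt0 ?invr_gt0//.
have h : x / 4 <= expR (x / 4).
  by rewrite (le_trans _ (expR_ge1Dx _))// lerDr.
have x4 : 0 <= x / 4 by rewrite divr_ge0// ltW.
have -> : expR x = expR (x / 4) ^+ 4.
  by rewrite -expRM_natl; congr expR; field.
rewrite (_ : _^-1 = (x / 4) ^+ 4); last by rewrite expr_div_n invfM invrK mulrC.
by rewrite lerXn2r ?nnegrE ?expR_ge0.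
Qed.

(** All quantities are bounded by powers of q = n^(1/44), which is much larger
    than expR (r^2 / 2). The remainder bound is then O(q^10 / n) and its
    normalization at most q^23, so that the product is O(q^-11); the exponent
    44 only has to be large enough. *)
Lemma remainder_rate (lambda c m1 K3 : R) :
  0 < lambda -> 0 < c -> 0 <= m1 -> 0 <= K3 -> exists K : R, forall (r M q : R) (n : nat),
  0 < r -> 1 <= q ->
  n%:R = q ^+ 44 -> r <= q -> expR (r ^+ 2 / 2) <= q -> 0 <= M -> M <= K3 * q ->
  Num.sqrt n%:R * r / expR (r ^+ 2 / 2) *
  (c * (40 * (8 / n%:R * (2 * tolerance lambda r)^-1 ^+ 2 * (2 * r))) +
  (M + c * (2 * r * lambda) + c * (2 * r * (tolerance lambda r)^-1)) *
  (m1 / n%:R + 4 * (n ^ 2).+1%:R * expR (- (n%:R * (tolerance lambda r / 4) ^+ 2 / 32)))) <= K / q.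
Proof.
move=> l0 c0 m0 K30.
(* c4 and a stand for 4 ^+ 4 and 4 ^+ 2 * 32, whose values do not matter. *)
have [c4 c40 hc4] : exists2 c4 : R, 0 <= c4 & forall x : R, 0 < x -> expR (- x) <= c4 / x ^+ 4.
  by exists (4 ^+ 4); [exact: exprn_ge0|exact: expRN_le_pow4].
have [a a0 ha] : exists2 a : R, 0 < a & forall x : R, (x / 4) ^+ 2 / 32 = x ^+ 2 / a.
  by exists (4 ^+ 2 * 32); [exact: mulr_gt0|move=> x; rewrite expr_div_n -[LHS]mulrA -invfM].
pose K1 := 2 * expR (2 * lambda).
pose K4 := 8 * (c4 * (a * K1 ^+ 2) ^+ 4).
exists (160 * c * K1 ^+ 2 + (K3 + 2 * c * lambda + 2 * c * K1) * (m1 + K4)).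
move=> r M q n r0 q1 nq rq Eq M0 Mq; set K := 160 * c * _ + _.
rewrite -[n%:R * _ / 32]mulrA ha.
have q0 : 0 < q by rewrite (lt_le_trans ltr01).
have n0 : 0 < n%:R :> R by rewrite nq exprn_gt0.
have K10 : 0 < K1 by rewrite mulr_gt0 ?expR_gt0.
have pos8 (b : R) : 0 <= 8 * (c4 * (a * b ^+ 2) ^+ 4).
  rewrite mulr_ge0// mulr_ge0// exprn_ge0// mulr_ge0 ?(ltW a0)//; exact: sqr_ge0.
have K40 : 0 <= K4 by exact: pos8.
have E0 := expR_gt0 (r ^+ 2 / 2).
have E1 : 1 <= expR (r ^+ 2 / 2) by rewrite -expR0 ler_expR divr_ge0 ?sqr_ge0.
have dE : (tolerance lambda r)^-1 = K1 * expR (r ^+ 2 / 2).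
  by rewrite /tolerance !expRN /K1; field; rewrite !gt_eqF ?expR_gt0.
have d0 : 0 < tolerance lambda r by rewrite -invr_gt0 dE mulr_gt0.
have dK : (tolerance lambda r)^-1 <= K1 * q by rewrite dE ler_wpM2l ?(ltW K10).
have di0 : 0 <= (tolerance lambda r)^-1 by rewrite invr_ge0 ltW.
have qX m : 1 <= q ^+ m by rewrite exprn_ege1.
have qXle m k : (m <= k)%N -> q ^+ m <= q ^+ k by move=> mk; rewrite ler_weXn2l.
move: (tolerance lambda r) d0 dE dK di0 => dl d0 dE dK di0.
have pre0 : 0 <= Num.sqrt n%:R * r / expR (r ^+ 2 / 2).
  by rewrite divr_ge0 ?mulr_ge0 ?sqrtr_ge0 ?ltW.
have pre : Num.sqrt n%:R * r / expR (r ^+ 2 / 2) <= q ^+ 23.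
  have -> : Num.sqrt n%:R = q ^+ 22 :> R.
    by rewrite nq (_ : q ^+ 44 = (q ^+ 22) ^+ 2) ?sqrtr_sqr ?ger0_norm ?exprn_ge0 ?(ltW q0)// -exprM.
  rewrite ler_pdivrMr// (exprSr q 22) -[leRHS]mulrA ler_wpM2l ?exprn_ge0 ?(ltW q0)//.
  by rewrite (le_trans rq)// ler_peMr// ltW.
have t1 : c * (40 * (8 / n%:R * (2 * dl)^-1 ^+ 2 * (2 * r))) <= 160 * c * K1 ^+ 2 * q ^+ 10 / n%:R.
  have -> : c * (40 * (8 / n%:R * (2 * dl)^-1 ^+ 2 * (2 * r))) = 160 * c * (dl^-1 ^+ 2 * r) / n%:R.
    by field; rewrite !gt_eqF.
  rewrite ler_wpM2r ?invr_ge0 ?(ltW n0)// -[leRHS]mulrA ler_wpM2l ?mulr_ge0 ?(ltW c0)//.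
  apply: (@le_trans _ _ ((K1 * q) ^+ 2 * q)).
    by rewrite ler_pM ?exprn_ge0 ?(ltW r0)// lerXn2r ?nnegrE// mulr_ge0 ?ltW.
  by rewrite exprMn -mulrA ler_wpM2l ?exprn_ge0 ?(ltW K10)// -exprSr qXle.
have crude : M + c * (2 * r * lambda) + c * (2 * r * dl^-1) <= (K3 + 2 * c * lambda + 2 * c * K1) * q ^+ 2.
  rewrite [leRHS]mulrDl [X in _ <= X + _]mulrDl; apply: lerD; first apply: lerD.
  - by rewrite (le_trans Mq)// ler_wpM2l// (qXle 1%N).
  - rewrite (_ : c * _ = 2 * c * lambda * r); last by ring.
    have p0 : 0 <= 2 * c * lambda by rewrite mulr_ge0 ?mulr_ge0// ltW.
    by rewrite ler_wpM2l// (le_trans rq)// (qXle 1%N).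
  - rewrite (_ : c * _ = 2 * c * (dl^-1 * r)); last by ring.
    rewrite -[leRHS]mulrA ler_wpM2l ?mulr_ge0 ?(ltW c0)//.
    by rewrite expr2 mulrA ler_pM// (ltW r0).
have bad : m1 / n%:R + 4 * (n ^ 2).+1%:R * expR (- (n%:R * (dl ^+ 2 / a))) <= (m1 + K4) * q ^+ 8 / n%:R.
  rewrite -[leRHS]mulrA [leRHS]mulrDl; apply: lerD.
    by rewrite ler_wpM2l// ler_peMl ?invr_ge0 ?(ltW n0).
  have x0 : 0 < n%:R * (dl ^+ 2 / a) by rewrite mulr_gt0// divr_gt0// exprn_gt0.
  apply: (@le_trans _ _ (4 * (2 * n%:R ^+ 2) * (c4 / (n%:R * (dl ^+ 2 / a)) ^+ 4))).
    apply: ler_pM; rewrite ?mulr_ge0 ?expR_ge0//; last exact: hc4.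
    rewrite ler_wpM2l// -natr1 natrX mulr_natl mulr2n lerD2l.
    by rewrite nq -exprM.
  have -> : 4 * (2 * n%:R ^+ 2) * (c4 / (n%:R * (dl ^+ 2 / a)) ^+ 4) =
     8 * (c4 * (a * dl^-1 ^+ 2) ^+ 4) / n%:R ^+ 2 by field; rewrite !gt_eqF.
  rewrite [leRHS]mulrA; apply: ler_pM.
  - exact: pos8.
  - by rewrite invr_ge0 exprn_ge0// ltW.
  - rewrite /K4 -[leRHS]mulrA ler_wpM2l// -[leRHS]mulrA ler_wpM2l// (_ : q ^+ 8 = (q ^+ 2) ^+ 4); last by rewrite -exprM.
    rewrite -exprMn lerXn2r ?nnegrE ?mulr_ge0 ?exprn_ge0 ?(ltW K10) ?(ltW q0) ?(ltW a0)//.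
    rewrite -[leRHS]mulrA ler_wpM2l ?(ltW a0)// -exprMn lerXn2r ?nnegrE ?mulr_ge0 ?(ltW K10) ?(ltW q0)//.
  - rewrite lef_pV2 ?posrE ?exprn_gt0// expr2 ler_peMl ?(ltW n0)//.
    by rewrite nq.
set A1 := c * _; set A2 := M + _ + _; set A3 := m1 / _ + _.
have A20 : 0 <= A2.
  by rewrite /A2 addr_ge0 ?addr_ge0// mulr_ge0 ?(ltW c0)// mulr_ge0// ?mulr_ge0// ltW.
have A30 : 0 <= A3.
  apply: addr_ge0; first by apply: mulr_ge0 => //; rewrite invr_ge0 ltW.
  by apply: mulr_ge0; [apply: mulr_ge0|exact: expR_ge0].
have tot : A1 + A2 * A3 <= K * q ^+ 10 / n%:R.
  have -> : K * q ^+ 10 / n%:R = 160 * c * K1 ^+ 2 * q ^+ 10 / n%:R +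
      (K3 + 2 * c * lambda + 2 * c * K1) * q ^+ 2 * ((m1 + K4) * q ^+ 8 / n%:R).
    rewrite /K; clear; move: K1 K4 (n%:R^-1) => b b' u; ring.
  by apply: lerD => //; exact: ler_pM.
have K0 : 0 <= K.
  have c00 := ltW c0; have l00 := ltW l0; have K100 := ltW K10.
  have c20 : 0 <= 2 * c by apply: mulr_ge0.
  apply: addr_ge0; first by apply: mulr_ge0; [apply: mulr_ge0|exact: exprn_ge0].
  apply: mulr_ge0; last exact: addr_ge0.
  by apply: addr_ge0; [apply: addr_ge0 => //; apply: mulr_ge0|apply: mulr_ge0].
apply: (@le_trans _ _ (q ^+ 23 * (K * q ^+ 10 / n%:R))).
  apply: ler_pM => //.
  apply: addr_ge0; last exact: mulr_ge0.
  apply: mulr_ge0; first exact: ltW.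
  apply: mulr_ge0 => //; apply: mulr_ge0; last by apply: mulr_ge0 => //; exact: ltW.
  apply: mulr_ge0; first by apply: mulr_ge0 => //; rewrite invr_ge0 ltW.
  by apply: exprn_ge0; rewrite invr_ge0; apply: mulr_ge0 => //; exact: ltW.
rewrite nq (_ : _ * _ = K / q ^+ 11); last by field; rewrite gt_eqF.
by rewrite ler_wpM2l// lef_pV2 ?posrE ?exprn_gt0// (qXle 1%N).
Qed.

End RemainderRate.

(** * The central limit theorem for the estimator *)

Section CentralLimit.
Context {R : realType} d (T : measurableType d) (P : probability T R).
Local Open Scope complex_scope.
Local Notation normc := (@Normc.normc R).
Local Notation Ec := (cintegral P [set: T]).
Variables (X : nat -> T -> R) (m1 lambda : R) (phi : R -> R[i]).
Hypothesis mX : forall i, measurable_fun [set: T] (X i).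
Hypothesis indX : independent_rvs P X.
Hypothesis idX : forall i (g : R -> R), bounded_measurable g ->
  \int[P]_w g (X i w) = \int[P]_w g (X 0 w).
Hypothesis intX : forall j, P.-integrable [set: T] (EFin \o X j).
Hypothesis absX : forall j, \int[P]_w `|X j w| <= m1.
Hypothesis lambda_gt0 : 0 < lambda.
Hypothesis phi_continuous : ccontinuous phi.
Hypothesis phi0 : phi 0 = 1.
Hypothesis phi_le1 : forall t, normc (phi t) <= 1.
Hypothesis phi_vanish :
  forall e : R, 0 < e -> exists A : R, forall t, A <= `|t| -> normc (phi t) <= e.
Hypothesis cfX : forall t, Ec (fun w => cexpi (t * X 0 w)) * inv_cf lambda phi t = 1.

Variables (beta C v y : R) (h M : nat -> R).
Hypothesis beta_gt0 : 0 < beta.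
Hypothesis beta_lt : beta < 1 / 2.
Hypothesis h_gt0 : forall n, 0 < h n.
Hypothesis h_equiv : h ~_\oo (fun n : nat => ln n%:R `^ (- beta)).
Hypothesis C_gt0 : 0 < C.
Hypothesis M_def : forall n, M n = C * ln n%:R.

Let r n := (h n)^-1.
Let r_gt0 n : 0 < r n. Proof. by rewrite invr_gt0. Qed.

Let M_ge0 n : 0 <= M n.
Proof.
rewrite M_def mulr_ge0 ?(ltW C_gt0)//.
by case: n => [|n]; [rewrite ln0|rewrite ln_ge0// ler1n].
Qed.

Local Notation fhat n w := (fnh_trunc lambda v (h n) (M n) n (fun i => X i w) y).

Let bounded_measurable_fhat n : bounded_measurable (fun w => fhat n w).
Proof.
split.
  by apply: measurable_maxr => //; apply: measurable_minr => //; exact: measurable_fnh.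
exists (M n) => w; rewrite ler_norml le_max lexx orbT/= ge_max ge_min lexx/=.
by rewrite (le_trans _ (M_ge0 n))// oppr_le0.
Qed.

Let a n := Num.sqrt n%:R / (h n * expR (1 / (2 * h n ^+ 2))).

Let aE n : a n = Num.sqrt n%:R * r n / expR (r n ^+ 2 / 2).
Proof.
rewrite /a /r invfM mulrA; congr (_ / expR _).
by rewrite div1r invfM mulrC exprVn.
Qed.

Let a_ge0 n : 0 <= a n.
Proof. by rewrite aE divr_ge0 ?expR_ge0// mulr_ge0 ?sqrtr_ge0// ltW. Qed.

Let lim_part n := limit_part lambda (r n) y phi.
Let lin_part n w := linear_part lambda (r n) n (fun i => X i w) y phi.
Let rem n w := fhat n w - lim_part n - lin_part n w.

Let m1_ge0 : 0 <= m1.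
Proof. by rewrite (le_trans _ (absX 0))// Rintegral_ge0. Qed.

Let c0_gt0 : 0 < (2 * pi * lambda)^-1.
Proof. by rewrite invr_gt0 !mulr_gt0 ?pi_gt0. Qed.

Let remainder_cvg : a n * \int[P]_w `|rem n w| @[n --> \oo] --> (0 : R).
Proof.
have K30 : 0 <= C * 44 by rewrite mulr_ge0// ltW.
have [K hK] := remainder_rate lambda_gt0 c0_gt0 m1_ge0 K30.
pose q (n : nat) : R := expR (ln n%:R / 44).
have q_ge (A : R) : \forall n \near \oo, A <= q n.
  near=> n; rewrite (le_trans _ (expR_ge1Dx _))//.
  have : A * 44 <= ln n%:R by near: n; exact: ln_natr_ge.
  by rewrite -ler_pdivlMr// => /le_trans; apply; rewrite lerDr.
have qK : `|K| / q n @[n --> \oo] --> (0 : R).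
  apply: norm_cvg0; apply/cvgrPdist_le => e e0; near=> n.
  have qn : `|K| / e <= q n by near: n; exact: q_ge.
  have q0 : 0 < q n by exact: expR_gt0.
  rewrite sub0r normrN normr_id ger0_norm ?divr_ge0 ?(ltW q0)//.
  by rewrite ler_pdivrMr// mulrC -ler_pdivrMr.
have rl c : 0 < c -> \forall n \near \oo, r n ^+ 2 <= c * ln n%:R.
  exact: (inverse_bandwidth_sqr_le beta_lt h_gt0 h_equiv).
have rinf := inverse_bandwidth_pinfty beta_gt0 h_gt0 h_equiv.
pose c' := (2 * pi * lambda)^-1 * 2 * (lambda + 11).
have c'0 : 0 < c' by rewrite !mulr_gt0 ?addr_gt0.
have Cc' : 0 < C / c' by rewrite divr_gt0.
apply: (squeeze_cvgr _ (cvg_cst 0) qK); near=> n.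
rewrite mulr_ge0 ?Rintegral_ge0//=.
have n0 : (0 < n)%N by near: n; exact: nbhs_infty_gt.
have q1 : 1 <= q n by near: n; exact: q_ge.
have q0 : 0 < q n by exact: expR_gt0.
have nq : n%:R = q n ^+ 44.
  by rewrite /q -expRM_natl mulrC mulfVK ?pnatr_eq0// lnK// posrE ltr0n.
have l0 : 0 <= ln n%:R :> R by rewrite ln_ge0// ler1n.
have Eq : expR (r n ^+ 2 / 2) <= q n.
  have : r n ^+ 2 <= 22^-1 * ln n%:R by near: n; apply: rl; rewrite invr_gt0.
  by rewrite ler_expR; lra.
have rq : r n <= q n.
  rewrite (le_trans _ Eq)// (le_trans _ (expR_ge1Dx _))//.
  by have := sqr_ge0 (r n - 1); rewrite sqrrB1; lra.
have Mq : M n <= C * 44 * q n.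
  rewrite M_def -mulrA ler_wpM2l ?(ltW C_gt0)// mulrC -ler_pdivrMr//.
  by rewrite (le_trans _ (expR_ge1Dx _))// lerDr.
have r1 : 1 <= r n.
  by near: n; move/cvgryPge : rinf; exact.
rewrite (@le_trans _ _ (K / q n))//; last by rewrite ler_wpM2r ?invr_ge0 ?(ltW q0)// ler_norm.
apply: le_trans (hK (r n) (M n) (q n) n (r_gt0 n) q1 nq rq Eq (M_ge0 n) Mq).
rewrite aE ler_wpM2l//; first by rewrite -aE.
have := @remainder_mean R d T P X mX indX idX m1 intX absX lambda phi lambda_gt0
  phi_continuous phi0 phi_le1 cfX n (r n) y v n0 (r_gt0 n) _ (M n) _ _.
rewrite /r invrK; apply; last exact: measurable_fnh.
- pose K1 := 2 * expR (2 * lambda).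
  have K10 : 0 < K1 by rewrite mulr_gt0 ?expR_gt0.
  have qb : 8 * K1 * (1 + m1) <= q n by near: n; exact: q_ge.
  have dE : (tolerance lambda (r n))^-1 = K1 * expR (r n ^+ 2 / 2).
    by rewrite /tolerance !expRN /K1; field; rewrite !gt_eqF ?expR_gt0.
  have d0 : 0 < tolerance lambda (r n) by rewrite -invr_gt0 dE mulr_gt0 ?expR_gt0.
  have dq : 1 <= tolerance lambda (r n) * (K1 * q n).
    by rewrite -ler_pdivrMl// mulr1 dE ler_wpM2l ?(ltW K10).
  have n1 : 1 <= n%:R :> R by rewrite ler1n.
  have step : 8 * r n * (n%:R + m1) <= 8 * (1 + m1) * q n * n%:R.
    have h1 : n%:R + m1 <= (1 + m1) * n%:R by rewrite mulrDl mul1r lerD2l ler_peMr.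
    rewrite (_ : 8 * (1 + m1) * q n * n%:R = 8 * q n * ((1 + m1) * n%:R)); last by ring.
    by rewrite ler_pM ?mulr_ge0 ?addr_ge0 ?(ltW (r_gt0 n))// ler_wpM2l.
  rewrite (le_trans step)//.
  rewrite (_ : (n ^ 2)%:R = n%:R * n%:R :> R); last by rewrite -natrM mulnn.
  rewrite mulrA ler_wpM2r ?ler0n//.
  apply: (@le_trans _ _ (tolerance lambda (r n) * (K1 * q n) * (8 * (1 + m1) * q n))).
    by rewrite ler_peMl// !mulr_ge0 ?addr_ge0 ?(ltW q0).
  rewrite -mulrA ler_wpM2l ?(ltW d0)//.
  rewrite (_ : _ * _ = 8 * K1 * (1 + m1) * q n ^+ 2); last by ring.
  rewrite nq (@le_trans _ _ (q n * q n ^+ 2))// ?ler_wpM2r ?exprn_ge0 ?(ltW q0)//.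
  by rewrite -exprS ler_weXn2l.
- have : r n ^+ 2 <= C / c' * ln n%:R by near: n; exact: rl.
  rewrite mulrAC ler_pdivlMr// M_def; apply: le_trans.
  rewrite (_ : _ * (2 * (h n)^-1 * (lambda + 11)) = r n * c'); last by rewrite /c' /r; ring.
  by rewrite ler_wpM2r ?(ltW c'0)// expr2 ler_peMl ?(ltW (r_gt0 n)).
Unshelve. all: end_near. Qed.

(** The normalized linear part U n is n^(-1/2) times the sum of the centred
    leading terms psi n (X j). *)
Let psi := centered_leading lambda y phi P (X 0) r.

Let mean_infl n := \int[P]_w influence lambda phi (r n) y (X 0 w).

Let psiE n u : psi n u = r n / expR (r n ^+ 2 / 2) * (influence lambda phi (r n) y u - mean_infl n).
Proof.
have bi := bounded_measurable_influence lambda_gt0 phi_continuous phi_le1 y (r_gt0 n).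
rewrite /psi /centered_leading /leading expRN mulrBr; congr (_ - _).
by rewrite bintZ//; exact: (bounded_measurable_comp (mX 0%N) bi).
Qed.

Let U n w := (Num.sqrt n%:R)^-1 * \sum_(0 <= j < n) psi n (X j w).

Let UE n w : (0 < n)%N -> U n w = a n * lin_part n w.
Proof.
move=> n0; rewrite /lin_part (linear_part_influence mX lambda_gt0 phi_continuous phi_le1 cfX)//.
rewrite /U aE; under eq_bigr do rewrite psiE.
rewrite -mulr_sumr !mulrA; congr (_ * _).
have s0 : Num.sqrt n%:R != 0 :> R by rewrite gt_eqF// sqrtr_gt0 ltr0n.
have -> : n%:R^-1 = (Num.sqrt n%:R)^-1 * (Num.sqrt n%:R)^-1 :> R.
  by rewrite -invfM -expr2 sqr_sqrtr.
by field; rewrite s0 gt_eqF ?expR_gt0.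
Qed.

Let V n w := a n * (fhat n w - \int[P]_w fhat n w).

Let psiP := centered_leadingP y lambda_gt0 phi_continuous phi_le1 phi_vanish
  (mX 0%N) (intX 0%N) (absX 0%N) cfX r_gt0 (inverse_bandwidth_pinfty beta_gt0 h_gt0 h_equiv).

Let bpsi n : bounded_measurable (psi n). Proof. by case: psiP => h1 _ _ _; exact: h1. Qed.
Let psi0 n : \int[P]_w psi n (X 0 w) = 0. Proof. by case: psiP => _ _ h1 _; exact: h1. Qed.

Let blin n : (0 < n)%N -> bounded_measurable (lin_part n).
Proof.
by move=> n0; apply: bounded_measurable_linear_part.
Qed.

Let bU n : bounded_measurable (U n).
Proof.
apply: bounded_measurableM; first exact: bounded_measurable_cst.
by apply: bounded_measurable_sum => j; exact: (bounded_measurable_comp (mX j) (bpsi n)).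
Qed.

Let bV n : bounded_measurable (V n).
Proof.
apply: bounded_measurableM; first exact: bounded_measurable_cst.
by apply: bounded_measurableB => //; exact: bounded_measurable_cst.
Qed.

Let mean_lin n : (0 < n)%N -> a n * \int[P]_w lin_part n w = 0.
Proof.
move=> n0; rewrite -bintZ; last exact: blin.
transitivity (\int[P]_w U n w); first by apply: eq_Rintegral => w _; rewrite UE.
have bj j : bounded_measurable (fun w => psi n (X j w)) by exact: (bounded_measurable_comp (mX j) (bpsi n)).
rewrite /U bintZ ?bint_sum//; last exact: bounded_measurable_sum.
by rewrite big1 ?mulr0// => j _; rewrite (idX j (bpsi n)) psi0.
Qed.

(** V n - U n is the normalized remainder minus its mean, because the linear
    part is centred. *)
Let dist_le n : (0 < n)%N -> \int[P]_w `|V n w - U n w| <= 2 * (a n * \int[P]_w `|rem n w|).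
Proof.
move=> n0.
have brem : bounded_measurable (rem n).
  apply: bounded_measurableB; last exact: blin.
  by apply: bounded_measurableB => //; exact: bounded_measurable_cst.
have bnrem := bounded_measurable_norm brem.
have mean_rem : a n * \int[P]_w rem n w = a n * (\int[P]_w fhat n w - lim_part n).
  rewrite bintB ?bintB ?bint_cst//; last 3 first.
  - exact: bounded_measurable_cst.
  - by apply: bounded_measurableB => //; exact: bounded_measurable_cst.
  - exact: blin.
  by rewrite mulrBr mean_lin// subr0.
have VU w : V n w - U n w = a n * rem n w - a n * \int[P]_w rem n w.
  by rewrite mean_rem UE// /V /rem; move: (\int[P]_w _) => e; ring.
apply: (@le_trans _ _ (\int[P]_w (a n * `|rem n w| + a n * \int[P]_w `|rem n w|))).
  apply: bint_le.
  - by apply: bounded_measurable_norm; apply: bounded_measurableB.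
  - apply: bounded_measurableD; last exact: bounded_measurable_cst.
    by apply: bounded_measurableM => //; exact: bounded_measurable_cst.
  - move=> w; rewrite VU (le_trans (ler_normB _ _))// (normrM _ (rem n w)) (normrM _ (\int[P]_w0 rem n w0)) (ger0_norm (a_ge0 n)) lerD2l.
    by rewrite ler_wpM2l// bint_norm_le.
rewrite bintD ?bintZ ?bint_cst//.
- by rewrite mulr_natl mulr2n.
- exact: bounded_measurable_cst.
- by apply: bounded_measurableM => //; exact: bounded_measurable_cst.
- exact: bounded_measurable_cst.
Qed.

Let dist_cvg (u : R) : `|u| * \int[P]_w `|V n w - U n w| @[n --> \oo] --> (0 : R).
Proof.
have h2 : `|u| * (2 * (a n * \int[P]_w `|rem n w|)) @[n --> \oo] --> (0 : R).
  rewrite -(mulr0 `|u|); apply: cvgMr; rewrite -(mulr0 2); apply: cvgMr.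
  exact: remainder_cvg.
apply: (squeeze_cvgr _ (cvg_cst 0) h2); near=> n.
rewrite mulr_ge0 ?Rintegral_ge0//= ler_wpM2l// dist_le//.
by near: n; exact: nbhs_infty_gt.
Unshelve. all: end_near. Qed.

(** Convergence in mean of V n - U n to 0 carries limits of bounded Lipschitz
    functionals, here cos and sin, from U n to V n. *)
Let transfer (g : R -> R) (u l : R) : measurable_fun [set: R] g ->
  (forall x, `|g x| <= 1) -> (forall x y, `|g x - g y| <= `|x - y|) ->
  \int[P]_w g (u * U n w) @[n --> \oo] --> l ->
  \int[P]_w g (u * V n w) @[n --> \oo] --> l.
Proof.
move=> mg g1 glip gU.
have bg : bounded_measurable g by split => //; exists 1.
have bgW (W : T -> R) : bounded_measurable W -> bounded_measurable (fun w => g (u * W w)).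
  move=> bW; apply: bounded_measurable_comp bg.
  by apply: measurable_funM => //; exact: bW.1.
rewrite -[X in _ --> X]addr0.
have -> : (fun n => \int[P]_w g (u * V n w)) =
   (fun n => \int[P]_w g (u * U n w) + \int[P]_w (g (u * V n w) - g (u * U n w))).
  apply/funext => n; rewrite bintB; [|exact: bgW|exact: bgW].
  by rewrite addrC subrK.
apply: cvgD => //; apply: norm_cvg0; apply: (squeeze_cvgr _ (cvg_cst 0) (dist_cvg u)); near=> n.
rewrite normr_ge0 /=.
have bd : bounded_measurable (fun w => g (u * V n w) - g (u * U n w)).
  by apply: bounded_measurableB; exact: bgW.
have bVU : bounded_measurable (fun w => `|V n w - U n w|).
  by apply: bounded_measurable_norm; exact: bounded_measurableB.
rewrite (le_trans (bint_norm_le _ bd))// -bintZ//; apply: bint_le.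
- exact: bounded_measurable_norm.
- by apply: bounded_measurableM => //; exact: bounded_measurable_cst.
- by move=> w; rewrite (le_trans (glip _ _))// -mulrBr normrM.
Unshelve. all: end_near. Qed.

Theorem estimator_central_limit :
  cvg_in_distribution P
    (fun n w => Num.sqrt n%:R / (h n * expR (1 / (2 * h n ^+ 2))) *
       (fhat n w - \int[P]_w fhat n w))
    (normal_prob 0 (Num.sqrt (expR (2 * lambda) / (2 * pi ^+ 2 * lambda ^+ 2)))).
Proof.
set s := Num.sqrt _.
have pi0 : 0 < pi :> R := pi_gt0 R.
have q0 : 0 < expR (2 * lambda) / (2 * pi ^+ 2 * lambda ^+ 2).
  by rewrite divr_gt0 ?expR_gt0// mulr_gt0 ?exprn_gt0// mulr_gt0 ?exprn_gt0.
have s0 : 0 < s by rewrite sqrtr_gt0.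
have s2 : 2 * ((2 * pi * lambda)^-1 * expR lambda) ^+ 2 = s ^+ 2.
  rewrite sqr_sqrtr ?(ltW q0)// (_ : expR (2 * lambda) = expR lambda ^+ 2); last first.
    by rewrite -expRM_natl.
  have pi1 : (pi : R) != 0 by rewrite gt_eqF.
  have l1 : lambda != 0 by rewrite gt_eqF.
  move: (pi : R) pi1 => p p1; field.
  by rewrite l1 p1.
case: psiP => h1 h2 h3; rewrite s2 => h4.
have cf u := iid_array_cf mX indX idX u (fun n => (h1 n).1) h2 h3 h4.
apply: (levy_normal s0); first by move=> n; exact: (bV n).1.
- move=> u; apply: (transfer (g := @cos R)) (cf u).1.
  + by apply: continuous_measurable_fun; exact: continuous_cos.
  + exact: cos_max.
  + exact: normr_cosB_le.
- move=> u; apply: (transfer (g := @sin R)) (cf u).2.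
  + by apply: continuous_measurable_fun; exact: continuous_sin.
  + exact: sin_max.
  + exact: normr_sinB_le.
Qed.

End CentralLimit.

Theorem theorem2p2 (R : realType)
    (lambda : R) (lambda_gt0 : 0 < lambda)
    (f : R -> R) (f_density : probability_density f)
    (d0 : measure_display) (T0 : measurableType d0) (P0 : probability T0 R)
    (N : {RV P0 >-> nat}) (W : nat -> {RV P0 >-> R}) (Z : {RV P0 >-> R})
    (N_poisson : forall k : nat,
       distribution P0 N [set k] = (poisson_pmf lambda k)%:E)
    (W_density : forall (j : nat) (A : set R), measurable A ->
       distribution P0 (W j) A = (\int[lebesgue_measure]_(x in A) (f x)%:E)%E)
    (W_indep : independent_rvs P0 (fun j => W j : T0 -> R))
    (Z_normal : forall A : set R, measurable A ->
       distribution P0 Z A = normal_prob 0 1 A)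
    (NWZ_indep : independent3 P0 (sigma_rv (N : T0 -> nat))
       (sigma_rvs (fun j => W j : T0 -> R)) (sigma_rv (Z : T0 -> R)))
    (d : measure_display) (T : measurableType d) (P : probability T R)
    (X : nat -> {RV P >-> R})
    (X_law : forall (i : nat) (A : set R), measurable A ->
       distribution P (X i) A =
       P0 ((fun w : T0 => \sum_(j < N w) W j w + Z w) @^-1` A))
    (X_indep : independent_rvs P (fun i => X i : T -> R))
    (cf_integrable :
       cintegrable (@lebesgue_measure R) [set: R] (density_cf f))
    (beta : R) (beta_gt0 : 0 < beta) (beta_lt : beta < 1 / 2)
    (h : nat -> R) (h_gt0 : forall n, 0 < h n)
    (h_equiv : h ~_\oo (fun n : nat => ln n%:R `^ (- beta)))
    (C : R) (C_gt0 : 0 < C)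
    (M : nat -> R) (M_def : forall n, M n = C * ln n%:R)
    (rho : R) (rho_gt : 3 / 2 < rho)
    (moment : (@lebesgue_measure R).-integrable [set: R]
       (fun x => (`|x| `^ rho * f x)%:E))
    (v : R) (x : R) :
  let fhat (n : nat) (w : T) : R :=
    fnh_trunc lambda v (h n) (M n) n (fun i => X i w) x in
  cvg_in_distribution P
    (fun (n : nat) (w : T) =>
       Num.sqrt n%:R / (h n * expR (1 / (2 * h n ^+ 2))) *
       (fhat n w - fine 'E_P[fhat n]))
    (normal_prob 0
       (Num.sqrt (expR (2 * lambda) / (2 * pi ^+ 2 * lambda ^+ 2)))).
Proof.
move=> fhat.
have rho1 : 1 <= rho by lra.
have m1f := integrable_density_first_moment f_density rho1 moment.
have mS := measurable_compound_sum N W Z.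
have mX i : measurable_fun [set: T] (X i : T -> R) by [].
have law i A : measurable A -> P ((X i : T -> R) @^-1` A) = P0 (compound_sum N W Z @^-1` A).
  by move=> mA; exact: X_law.
have iS := integrable_compound_sum lambda_gt0 f_density N_poisson W_density Z_normal NWZ_indep m1f.
have iX i := integrable_eq_law (mX i) mS (law i) iS.
have tX i (g : R -> R) : bounded_measurable g ->
    \int[P]_w g (X i w) = \int[P0]_w g (compound_sum N W Z w).
  by move=> bg; exact: (Rintegral_eq_law (mX i) mS (law i)).
have idX i (g : R -> R) : bounded_measurable g -> \int[P]_w g (X i w) = \int[P]_w g (X 0 w).
  by move=> bg; rewrite !tX.
have cfX t : cintegral P [set: T] (fun w => cexpi (t * X 0 w)) * inv_cf lambda (density_cf f) t = 1.
  have -> : cintegral P [set: T] (fun w => cexpi (t * X 0 w)) =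
            cintegral P0 [set: T0] (fun w => cexpi (t * compound_sum N W Z w)).
    have [bRe bIm] : cbounded_measurable (fun u : R => cexpi (t * u)).
      exact: cbounded_measurable_cexpi.
    by rewrite /cintegral (tX 0 _ bRe) (tX 0 _ bIm).
  rewrite (compound_sum_cf lambda_gt0 f_density N_poisson W_density W_indep Z_normal NWZ_indep).
  rewrite /inv_cf mulrACA -cexpD -mulrDr addrA subrK addrN mulr0 cexp0 mul1r.
  by rewrite -rmorphM -expRD addNr expR0.
have := @estimator_central_limit R d T P (fun i => X i : T -> R) (\int[P0]_w `|compound_sum N W Z w|)
  lambda (density_cf f) mX X_indep idX (fun j => (iX j).1) _ lambda_gt0
  (ccontinuous_density_cf f_density m1f) (density_cf0 f_density)
  (fun t => normc_density_cf_le1 f_density t (W_density 0)) (density_cf_vanish f_density m1f cf_integrable)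
  cfX beta C v x h M beta_gt0 beta_lt h_gt0 h_equiv C_gt0 M_def.
have E n : fine 'E_P[fhat n] = \int[P]_w fhat n w by rewrite unlock.
under [X in _ -> cvg_in_distribution _ X _]eq_fun do under eq_fun do rewrite E.
by apply => j; rewrite (iX j).2.
Qed.
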